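(* Fix $\eta\in[0,1]$. For each integer $N\ge0$ let $a_N$ be the optimal value of the lower-bound optimization problem and $b_N$ the optimal value of the upper-bound optimization problem described in the context. Then $$\lim_{N\to\infty}a_N=C_{\mathrm{BEHC}}=\lim_{N\to\infty}b_N.$$
   Context: Binary energy-harvesting channel (BEHC), $\bar\eta=1-\eta$: battery $S_{i-1}\in\{0,1\}$, $S_0=0$; input $X_i\in\{0,1\}$, $X_i\le S_{i-1}$; energy arrivals $E_i$ i.i.d. Bernoulli$(\eta)$; $S_i=\min\{S_{i-1}-X_i+E_i,1\}$; output $Y_i=X_i$. Battery law $P(s^{+}\mid x,s)$: $P(S^{+}=0\mid x,s)=\bar\eta\,\mathbb{1}\{x=s\}$ for $x\le s$. Codes: $M$ uniform on $\{1,\dots,2^{nR}\}$, $X_i=e_i(M,S^{i-1},Y^{i-1})$ with $X_i\le S_{i-1}$, $\hat M=d(Y^n)$; $C_{\mathrm{BEHC}}$ is the supremum of rates with average error probability $\to0$. $[a:b]=\{a,\dots,b\}$, $\mathcal U=\mathcal Q=[0:N]$, $f(u^{+},s)=s\,\mathbb{1}\{u^{+}=0\}$. Lower bound: $g_L(q,1)=0$, $g_L(q,0)=q+1$ for $q<N$, $g_L(N,0)=0$. $a_N=\sup I(U^{+},U;X\mid Q)$ over policies $P(u^{+}\mid u,q)$ such that the kernel $\sum_xP(u^{+}\mid u,q)\mathbb{1}\{x=f(u^{+},s)\}\mathbb{1}\{q^{+}=g_L(q,x)\}P(s^{+}\mid x,s)$ has a unique stationary distribution $\pi(s,u,q)$,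 with $U\mid Q=q$ in $[0:q]$ and $U^{+}\mid(U=u,Q=q)$ in $\{0,u+1\}$ for $q<N$, $U\mid Q=N$ in $[0:N]$ and $U^{+}=0$ when $Q=N$; mutual information under $\pi(s,u,q)P(u^{+}\mid u,q)\mathbb{1}\{x=f(u^{+},s)\}P(s^{+}\mid x,s)\mathbb{1}\{q^{+}=g_L(q,x)\}$. Upper bound: $g_U$ equals $g_L$ except $g_U(N,0)=N$; $P_U(s^{+}\mid x,s,q)=\mathbb{1}\{s^{+}=1\}$ if $q\in\{N-1,N\}$ and $x=0$, else $P(s^{+}\mid x,s)$. $b_N=\sup I(U^{+},U;X\mid Q)$ over policies such that the kernel $\sum_xP(u^{+}\mid u,q)\mathbb{1}\{x=f(u^{+},s)\}\mathbb{1}\{q^{+}=g_U(q,x)\}P_U(s^{+}\mid x,s,q)$ has a unique stationary distribution $\pi$, with $U\mid Q=q$ in $[0:q]$ and $U^{+}\mid(U=u,Q=q)$ in $\{0,u+1\}$ for $q<N$, $U\mid Q=N$ in $[0:N]$ and $U^{+}\mid Q=N$ in $\{0,1\}$; mutual information under $\pi(s,u,q)P(u^{+}\mid u,q)\mathbb{1}\{x=f(u^{+},s)\}P_U(s^{+}\mid x,s,q)\mathbb{1}\{q^{+}=g_U(q,x)\}$. *)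

(* Defs.v *)
From HB Require Import structures.
From mathcomp Require Import all_boot all_order all_algebra.
From mathcomp Require Import all_classical all_reals all_analysis.
Set Implicit Arguments. Unset Strict Implicit. Unset Printing Implicit Defensive.
Import Order.TTheory GRing.Theory Num.Theory.
Import numFieldNormedType.Exports.
Local Open Scope classical_set_scope.
Local Open Scope ring_scope.

Section BEHC.
Variable R : realType.
Variable eta : R.   (* energy arrival probability *)

Definition log2 (x : R) : R := ln x / ln 2.

Definition cmi (Q A X : finType) (p : Q -> A -> X -> R) : R :=
  let pQ  := fun q => \sum_(a : A) \sum_(x : X) p q a x in
  let pQA := fun q a => \sum_(x : X) p q a x in
  let pQX := fun q x => \sum_(a : A) p q a x in
  \sum_(q : Q) \sum_(a : A) \sum_(x : X)
     (if p q a x == 0 then 0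
      else p q a x * log2 (p q a x * pQ q / (pQA q a * pQX q x))).

(* The binary energy-harvesting channel: battery law P(s+ | x, s)     *)
Definition etab : R := 1 - eta.
Definition bat (splus x s : bool) : R :=
  let p0 := if x == s then etab else 0 in
  if splus then 1 - p0 else p0.

(* Encoder: e_i(m, S^{i-1}, Y^{i-1}), time index i (0-based = size of
   histories); S-history lists S_1..S_{i-1} (S_0 = 0 implicit).        *)
Definition encoder (M : nat) := nat -> 'I_M -> seq bool -> seq bool -> bool.

(* input constraint X_i <= S_{i-1}, with S_0 = 0 *)
Definition valid_encoder M (enc : encoder M) : Prop :=
  forall (i : nat) (m : 'I_M) (hs hy : seq bool),
    size hs = i -> size hy = i -> enc i m hs hy -> last false hs.

Fixpoint run M (enc : encoder M) (m : 'I_M) (es : seq bool) (s : bool)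
    (hs hy : seq bool) : seq bool :=
  match es with
  | [::] => hy
  | e :: es' =>
      let x := enc (size hy) m hs hy in
      (* S_i = min(S_{i-1} - X_i + E_i, 1) *)
      let s' := if x then e else s || e in
      run enc m es' s' (rcons hs s') (rcons hy x)
  end.

Definition prE n (e : n.-tuple bool) : R :=
  \prod_(i < n) (if tnth e i then eta else 1 - eta).

Definition err_prob n M (enc : encoder M) (dec : seq bool -> 'I_M) : R :=
  M%:R^-1 * \sum_(m : 'I_M) \sum_(e : n.-tuple bool)
     (if dec (run enc m e false [::] [::]) != m then prE e else 0).

Definition achievable (r : R) : Prop :=
  forall eps : R, 0 < eps -> exists n0 : nat, forall n : nat, (n0 <= n)%N ->
    exists (M : nat) (enc : encoder M) (dec : seq bool -> 'I_M),
      [/\ 2 `^ (n%:R * r) <= M%:R, valid_encoder enc & err_prob n enc dec <= eps].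

Definition C_BEHC : R := sup [set r | 0 <= r /\ achievable r].

Section Bounds.
Variable N : nat.
Notation idx := 'I_N.+1.
Definition state := (bool * idx * idx)%type.   (* (s, u, q) *)

(* policy P(u+ | u, q), written pol u q u+ *)
Definition policy := idx -> idx -> idx -> R.

Definition is_policy (P : policy) : Prop :=
  (forall u q up, 0 <= P u q up) /\ (forall u q, \sum_(up : idx) P u q up = 1).

Definition f (up : idx) (s : bool) : bool := s && (val up == 0%N).

Definition gL (q : idx) (x : bool) : idx :=
  if x then ord0 else if (val q < N)%N then inord q.+1 else ord0.
Definition gU (q : idx) (x : bool) : idx :=
  if x then ord0 else if (val q < N)%N then inord q.+1 else ord_max.

Definition batU (splus x s : bool) (q : idx) : R :=
  if ((val q).+1 == N) || (val q == N) then
    (if x then bat splus x s else (if splus then 1 else 0))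
  else bat splus x s.

Definition KL (P : policy) (t t' : state) : R :=
  let: (s, u, q) := t in let: (s', up, q') := t' in
  P u q up * (if q' == gL q (f up s) then 1 else 0) * bat s' (f up s) s.
Definition KU (P : policy) (t t' : state) : R :=
  let: (s, u, q) := t in let: (s', up, q') := t' in
  P u q up * (if q' == gU q (f up s) then 1 else 0) * batU s' (f up s) s q.

Definition stationary (K : state -> state -> R) (pi : state -> R) : Prop :=
  (forall t, 0 <= pi t) /\ (\sum_(t : state) pi t = 1) /\
  (forall t', \sum_(t : state) pi t * K t t' = pi t').

Definition unique_stationary (K : state -> state -> R) (pi : state -> R) : Prop :=
  stationary K pi /\ forall pi', stationary K pi' -> pi' = pi.

(* common support constraints: U | Q=q in [0:q] (q < N; automatic for q=N),
   and U+ | (U=u, Q=q) in {0, u+1} for q < N *)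
Definition supp_common (P : policy) (pi : state -> R) : Prop :=
  (forall s u q, (val q < val u)%N -> pi (s, u, q) = 0) /\
  (forall u q up, (val q < N)%N -> val up != 0%N -> val up != (val u).+1 ->
     P u q up = 0).

Definition admissibleL (P : policy) (pi : state -> R) : Prop :=
  [/\ is_policy P, unique_stationary (KL P) pi, supp_common P pi &
      forall u q up, val q = N -> val up != 0%N -> P u q up = 0].

Definition admissibleU (P : policy) (pi : state -> R) : Prop :=
  [/\ is_policy P, unique_stationary (KU P) pi, supp_common P pi &
      forall u q up, val q = N -> (1 < val up)%N -> P u q up = 0].

(* joint pmf of (Q, (U+,U), X) *)
Definition pQAX (P : policy) (pi : state -> R) (q : idx) (a : idx * idx)
    (x : bool) : R :=
  \sum_(s : bool) pi (s, a.2, q) * P a.2 q a.1 *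
     (if x == f a.1 s then 1 else 0).

Definition objective (P : policy) (pi : state -> R) : R := cmi (pQAX P pi).

End Bounds.

Definition a_N (N : nat) : R :=
  sup [set v | exists (P : policy N) (pi : state N -> R),
                 admissibleL P pi /\ v = objective P pi].
Definition b_N (N : nat) : R :=
  sup [set v | exists (P : policy N) (pi : state N -> R),
                 admissibleU P pi /\ v = objective P pi].

End BEHC.

(* Main.v *)
Require Import Defs.
From HB Require Import structures.
From mathcomp Require Import all_boot all_order all_algebra.
From mathcomp Require Import all_classical all_reals all_analysis.
From mathcomp Require Import ring lra zify.
Import Order.TTheory GRing.Theory Num.Theory.
Import numFieldNormedType.Exports.
Local Open Scope classical_set_scope.
Local Open Scope ring_scope.

Set Implicit Arguments.
Unset Strict Implicit.
Unset Printing Implicit Defensive.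

(** Both optimisations are over Markov chains that return to a reset state after
each pulse, so by homogeneity their values are values of one superadditive
functional of flows on the pairs [(u, q)].  The limits follow by squeezing from

    a_N <= C <= b_N <= a_N + O (1 / sqrt N).

First inequality: at each reset of the level [q] the battery has the law it has
after an attempt to transmit, whatever happened before; hence the output law of
a policy is the product law predicted by the level, and a Poisson equation gives
the law of large numbers for the information density required by Feinstein's
greedy coding lemma.

Second inequality: given a message, any encoder has the same output law as a
randomised one that attempts to transmit regardless of the battery.  The
expected numbers of visits and attempts of such encoders, averaged over the
messages and completed by one silent cycle, form a circulation, hence a policy
of the upper bound; concavity of entropy bounds the information by its
objective, and Fano's inequality concludes.

Third inequality: forcing an attempt at level [N] changes the objective by at
most the entropy of the pulses sent from there, whose frequency is at most
[1 / N] because each of them follows a visit to every lower level. *)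

(** * Binary entropy *)

(** An attempt outputs the battery bit itself and leaves a battery law that does not depend on that
    bit. Hence, [u] silent choices after the slot following an attempt, the battery is empty with
    probability [etab eta ^+ u.+1], whatever the level, and it can be eliminated in favour of
    [(u, q)].

    Because the entropy functional is homogeneous, flows may stay unnormalised, and a code is
    compared with a policy by counting slots. The silent cycle that completes a code also sends a
    positive flow to level [N]; this is what makes the stationary distribution of the resulting
    policy unique. The true output law of a code is never formed: divergence from a reference law
    built from the flow suffices, and it needs only inequalities between counts.

    The battery starts empty, so the first slot is silent and leaves the law that follows an
    attempt. Codes therefore have length [n.+1] and effectively start in the state [(0, 0)]. *)

Section Entropy.
Variable R : realType.
Implicit Types a b x y w v : R.

Lemma ln_le_subr1 x : 0 < x -> ln x <= x - 1.
Proof.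
move=> x0; rewrite -{1}(subrKC 1 x); apply: le_ln1Dx.
by rewrite ltrBrDl subrr.
Qed.

Lemma ln_gibbs a y : 0 <= a -> 0 < y -> a - y <= a * (ln a - ln y).
Proof.
rewrite le_eqVlt => /predU1P[<-|a0] y0; first by rewrite !mul0r sub0r oppr_le0 ltW.
have := @ln_le_subr1 (y / a) (divr_gt0 y0 a0); rewrite ln_div ?posrE// => h.
have := ler_wpM2l (ltW a0) h.
rewrite mulrBr mulrBr mulr1 mulrCA divff ?gt_eqF// mulr1; lra.
Qed.

(* [a + b] times the entropy, in nats, of the distribution [(a, b) / (a + b)]:
   this homogeneous form is superadditive. *)
Definition hent a b := (a + b) * ln (a + b) - a * ln a - b * ln b.

Lemma hent0l b : hent 0 b = 0.
Proof. by rewrite /hent add0r mul0r subr0 subrr. Qed.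

Lemma hentC a b : hent a b = hent b a.
Proof. by rewrite /hent (addrC a b) addrAC. Qed.

Lemma hent0r a : hent a 0 = 0.
Proof. by rewrite hentC hent0l. Qed.

Lemma hentZ (c : R) a b : 0 <= c -> 0 <= a -> 0 <= b ->
  hent (c * a) (c * b) = c * hent a b.
Proof.
rewrite le_eqVlt => /predU1P[<-|c0]; first by rewrite !mul0r hent0l.
rewrite le_eqVlt => /predU1P[<-|a0]; first by rewrite mulr0 !hent0l mulr0.
rewrite le_eqVlt => /predU1P[<-|b0]; first by rewrite mulr0 !hent0r mulr0.
have ab0 : 0 < a + b by rewrite addr_gt0.
rewrite /hent -mulrDr !lnM ?posrE//; ring.
Qed.

(** Nonnegativity of relative entropy, also against a sub-probability [(w, v)]. Since [ln 0 = 0]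
    here, a weight must be positive wherever its count is. *)
Lemma hent_gibbs a b w v : 0 <= a -> 0 <= b -> (0 < a -> 0 < w) ->
  (0 < b -> 0 < v) -> 0 <= w -> 0 <= v -> w + v <= 1 ->
  hent a b <= - (a * ln w + b * ln v).
Proof.
move=> a0 b0 aw bv w0 v0 wv.
move: (a0); rewrite le_eqVlt => /predU1P[<-|a1].
  rewrite hent0l mul0r add0r oppr_ge0 mulr_ge0_le0// ln_le0//.
  by apply: le_trans wv; rewrite lerDr.
move: (b0); rewrite le_eqVlt => /predU1P[<-|b1].
  rewrite hent0r mul0r addr0 oppr_ge0 mulr_ge0_le0// ln_le0//.
  by apply: le_trans wv; rewrite lerDl.
have ab0 : 0 < a + b by rewrite addr_gt0.
have := @ln_gibbs a ((a + b) * w) a0 (mulr_gt0 ab0 (aw a1)).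
have := @ln_gibbs b ((a + b) * v) b0 (mulr_gt0 ab0 (bv b1)).
rewrite !lnM ?posrE ?aw ?bv// => hb ha.
have : (a + b) * (w + v) <= a + b by rewrite ger_pMr.
rewrite /hent; nra.
Qed.

Lemma hent_exact a b : 0 <= a -> 0 <= b ->
  hent a b = - (a * ln (a / (a + b)) + b * ln (b / (a + b))).
Proof.
rewrite le_eqVlt => /predU1P[<-|a0].
  rewrite le_eqVlt => /predU1P[<-|b0]; first by rewrite hent0l !mul0r addr0 oppr0.
  by rewrite hent0l !mul0r !add0r divff ?gt_eqF// ln1 mulr0 oppr0.
rewrite le_eqVlt => /predU1P[<-|b0].
  by rewrite hent0r addr0 !mul0r addr0 divff ?gt_eqF// ln1 mulr0 oppr0.
have ab0 : 0 < a + b by rewrite addr_gt0.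
rewrite !ln_div ?posrE// /hent; ring.
Qed.

(** The normalised sum serves as one reference law for both summands: Gibbs' inequality bounds each,
    and the two bounds add up to the entropy of the sum. *)
Lemma hentD a b a' b' : 0 <= a -> 0 <= b -> 0 <= a' -> 0 <= b' ->
  hent a b + hent a' b' <= hent (a + a') (b + b').
Proof.
move=> a0 b0 a'0 b'0.
have [s0|s0] := eqVneq (a + a' + (b + b')) 0.
  have [-> -> -> ->] : [/\ a = 0, b = 0, a' = 0 & b' = 0] by split; lra.
  by rewrite !addr0 !hent0l addr0.
have {}s0 : 0 < a + a' + (b + b') by rewrite lt_neqAle eq_sym s0 !addr_ge0.
rewrite (@hent_exact (a + a')) ?addr_ge0//.
set w := (a + a') / _; set v := (b + b') / _.
have w0 : 0 <= w by rewrite divr_ge0 ?addr_ge0.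
have v0 : 0 <= v by rewrite divr_ge0 ?addr_ge0.
have wv : w + v <= 1 by rewrite /w /v -mulrDl divff ?gt_eqF.
have := @hent_gibbs a b w v a0 b0; have := @hent_gibbs a' b' w v a'0 b'0.
have aw : 0 < a + a' -> 0 < w by move=> h; rewrite divr_gt0.
have bv : 0 < b + b' -> 0 < v by move=> h; rewrite divr_gt0.
have aw1 : 0 < a -> 0 < w by move=> h; apply: aw; rewrite ltr_wpDr.
have aw2 : 0 < a' -> 0 < w by move=> h; apply: aw; rewrite ltr_wpDl.
have bv1 : 0 < b -> 0 < v by move=> h; apply: bv; rewrite ltr_wpDr.
have bv2 : 0 < b' -> 0 < v by move=> h; apply: bv; rewrite ltr_wpDl.
move=> /(_ aw2 bv2 w0 v0 wv) h1 /(_ aw1 bv1 w0 v0 wv) h2.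
by apply: le_trans (lerD h2 h1) _; rewrite le_eqVlt; apply/orP; left; apply/eqP; ring.
Qed.

Lemma hent_ge0 a b : 0 <= a -> 0 <= b -> 0 <= hent a b.
Proof.
move=> a0 b0; have := @hentD a 0 0 b a0 (lexx _) (lexx _) b0.
by rewrite hent0l hent0r addr0 add0r addr0.
Qed.

Lemma hent_sum (I : finType) (Q : pred I) (A B : I -> R) :
  (forall i, Q i -> 0 <= A i) -> (forall i, Q i -> 0 <= B i) ->
  \sum_(i | Q i) hent (A i) (B i) <= hent (\sum_(i | Q i) A i) (\sum_(i | Q i) B i).
Proof.
move=> A0 B0.
suff : [/\ 0 <= \sum_(i | Q i) A i, 0 <= \sum_(i | Q i) B i &
    \sum_(i | Q i) hent (A i) (B i) <= hent (\sum_(i | Q i) A i) (\sum_(i | Q i) B i)].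
  by case.
apply: (big_ind3 (fun x y z => [/\ 0 <= x, 0 <= y & z <= hent x y])).
- by rewrite hent0l.
- move=> x1 y1 z1 x2 y2 z2 [? ? h1] [? ? h2]; split; rewrite ?addr_ge0//.
  by apply: le_trans (lerD h1 h2) (hentD _ _ _ _).
- by move=> i Qi; split; rewrite ?A0 ?B0.
Qed.

(** The increment [(0, b' - b)] has zero entropy and is added by superadditivity. *)
Lemma hent_mono a b b' : 0 <= a -> 0 <= b -> b <= b' -> hent a b <= hent a b'.
Proof.
move=> a0 b0 bb'; have d0 : 0 <= b' - b by rewrite subr_ge0.
have := @hentD a b 0 _ a0 b0 (lexx _) d0.
by rewrite hent0l !addr0 subrKC.
Qed.

Lemma hent_le_ln a b : 0 < a -> 0 <= b -> hent a b <= a * (ln (a + b) - ln a) + a.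
Proof.
move=> a0; rewrite le_eqVlt => /predU1P[<-|b0].
  by rewrite hent0r addr0 subrr mulr0 add0r ltW.
have ab0 : 0 < a + b by rewrite addr_gt0.
have := @ln_gibbs b (a + b) (ltW b0) ab0.
rewrite /hent; lra.
Qed.

(** Only the boundedness of the two optimisations rests on this, so the constant 1 in place of
    [ln 2] does no harm. *)
Lemma hent_leD a b : 0 <= a -> 0 <= b -> hent a b <= a + b.
Proof.
rewrite le_eqVlt => /predU1P[<-|a0] b0; first by rewrite hent0l add0r.
have ab0 : 0 < a + b by rewrite ltr_wpDr.
apply: le_trans (hent_le_ln a0 b0) _.
have := ln_gibbs (ltW a0) ab0; lra.
Qed.

(** With [s = Num.sqrt a], the term [- a * ln a] is [2 * s * (- s * ln s)], at most [2 * s]; the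
    remaining [a] is at most [s]. *)
Lemma hent_sqrt a b : 0 <= a -> 0 <= b -> a + b <= 1 -> hent a b <= 3 * Num.sqrt a.
Proof.
rewrite le_eqVlt => /predU1P[<-|a0] b0 ab1; first by rewrite hent0l sqrtr0 mulr0.
have s0 : 0 < Num.sqrt a by rewrite sqrtr_gt0.
have as2 : a = Num.sqrt a * Num.sqrt a by rewrite -expr2 sqr_sqrtr// ltW.
have s1 : Num.sqrt a <= 1.
  by rewrite -(@sqrtr1 R) ler_sqrt//; apply: le_trans ab1; rewrite lerDl.
apply: le_trans (hent_le_ln a0 b0) _.
have l1 : ln (a + b) <= 0 by rewrite ln_le0.
have := @ln_gibbs 1 (Num.sqrt a) ler01 s0.
rewrite ln1 mul1r sub0r => h2.
have -> : ln a = ln (Num.sqrt a) + ln (Num.sqrt a) by rewrite -lnM ?posrE// -as2.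
have h3 : - (Num.sqrt a * ln (Num.sqrt a)) <= 1.
  have := @ln_gibbs (Num.sqrt a) 1 (ltW s0) ltr01; rewrite ln1 subr0 => h.
  by have := ltW s0; lra.
have : a * ln (a + b) <= 0 by rewrite mulr_ge0_le0// ltW.
have : - (a * ln (Num.sqrt a)) <= Num.sqrt a.
  by rewrite {1}as2 -mulrA -mulrN ger_pMr.
have : a <= Num.sqrt a by rewrite {1}as2 ger_pMr.
rewrite mulrBr mulrDr; lra.
Qed.

End Entropy.

(** * The objective as a difference of entropies *)

Section Objective.
Variable R : realType.

Lemma cmiE (Q A : finType) (p : Q -> A -> bool -> R) :
  (forall q a x, 0 <= p q a x) ->
  cmi p = (\sum_q hent (\sum_a p q a true) (\sum_a p q a false)
           - \sum_q \sum_a hent (p q a true) (p q a false)) / ln 2.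
Proof.
move=> p0; rewrite /cmi -sumrB mulr_suml; apply: eq_bigr => q _.
set T := \sum_a p q a true; set F := \sum_a p q a false.
have T0 : 0 <= T by apply: sumr_ge0.
have F0 : 0 <= F by apply: sumr_ge0.
have QE : \sum_a \sum_(x : bool) p q a x = T + F.
  by rewrite -big_split; apply: eq_bigr => a _; rewrite big_bool.
have leT a : p q a true <= T.
  by rewrite /T (bigD1 a)//= lerDl sumr_ge0.
have leF a : p q a false <= F.
  by rewrite /F (bigD1 a)//= lerDl sumr_ge0.
rewrite (eq_bigr (fun a => (p q a true * (ln (T + F) - ln T)
   + p q a false * (ln (T + F) - ln F)
   - hent (p q a true) (p q a false)) / ln 2)); last first.
  move=> a _; rewrite QE !big_bool /= -/T -/F.
  set t := p q a true; set g := p q a false.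
  have t0 : 0 <= t := p0 _ _ _; have g0 : 0 <= g := p0 _ _ _.
  have -> : (if t == 0 then 0 else t * log2 (t * (T + F) / ((t + g) * T)))
      = t * (ln t + ln (T + F) - ln (t + g) - ln T) / ln 2.
    case: eqP => [->|/eqP tn0]; first by rewrite !mul0r.
    have {}tn0 : 0 < t by rewrite lt_neqAle eq_sym tn0.
    have T1 : 0 < T := lt_le_trans tn0 (leT a).
    have tg : 0 < t + g by rewrite ltr_wpDr.
    have TF : 0 < T + F by rewrite ltr_wpDr.
    by rewrite /log2 ln_div ?posrE ?mulr_gt0// !lnM ?posrE// mulrA; congr (_ * _); ring.
  have -> : (if g == 0 then 0 else g * log2 (g * (T + F) / ((t + g) * F)))
      = g * (ln g + ln (T + F) - ln (t + g) - ln F) / ln 2.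
    case: eqP => [->|/eqP gn0]; first by rewrite !mul0r.
    have {}gn0 : 0 < g by rewrite lt_neqAle eq_sym gn0.
    have F1 : 0 < F := lt_le_trans gn0 (leF a).
    have tg : 0 < t + g by rewrite ltr_wpDl.
    have TF : 0 < T + F by rewrite ltr_wpDl.
    by rewrite /log2 ln_div ?posrE ?mulr_gt0// !lnM ?posrE// mulrA; congr (_ * _); ring.
  by rewrite /hent; ring.
rewrite -mulr_suml sumrB big_split /= -!mulr_suml -/T -/F.
by congr (_ / _); rewrite [hent T F]/hent; ring.
Qed.

Variable N : nat.
Notation idx := 'I_N.+1.
Implicit Types (P : policy R N) (mu : state N -> R).

Lemma sum_state (F : state N -> R) :
  \sum_t F t = \sum_q \sum_u (F (true, u, q) + F (false, u, q)).
Proof.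
rewrite exchange_big /=.
transitivity (\sum_(s : bool) \sum_u \sum_q F (s, u, q)).
  by rewrite pair_bigA pair_bigA /=; apply: eq_bigr => -[[]].
rewrite big_bool -big_split /=.
by apply: eq_bigr => u _; rewrite -big_split.
Qed.

Definition mass mu (q : idx) := \sum_u (mu (true, u, q) + mu (false, u, q)).

Definition emission P mu (q : idx) := \sum_u mu (true, u, q) * P u q ord0.

(** The conditional entropy of the output given [U+], [U] and [Q], in nats: only [U+ = 0] leaves it
    uncertain, for then it is the battery bit. *)
Definition noise P mu (q : idx) :=
  \sum_u P u q ord0 * hent (mu (true, u, q)) (mu (false, u, q)).

Lemma objectiveE P mu : is_policy P -> (forall t, 0 <= mu t) ->
  objective P mu = (\sum_q hent (emission P mu q) (mass mu q - emission P mu q)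
                    - \sum_q noise P mu q) / ln 2.
Proof.
move=> [P0 P1] mu0.
have Et q (a : idx * idx) :
    pQAX P mu q a true = if a.1 == ord0 then mu (true, a.2, q) * P a.2 q a.1 else 0.
  by rewrite /pQAX big_bool /f -[val _ == 0%N]/(a.1 == ord0); case: (a.1 == ord0); rewrite !eqE /=; ring.
have Ef q (a : idx * idx) : pQAX P mu q a false =
    (if a.1 == ord0 then 0 else mu (true, a.2, q) * P a.2 q a.1)
      + mu (false, a.2, q) * P a.2 q a.1.
  by rewrite /pQAX big_bool /f -[val _ == 0%N]/(a.1 == ord0); case: (a.1 == ord0); rewrite !eqE /=; ring.
rewrite /objective cmiE; last first.
  move=> q a x; apply: sumr_ge0 => s _; rewrite !mulr_ge0//.
  by case: ifP.
have emE q : \sum_a pQAX P mu q a true = emission P mu q.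
  rewrite -(pair_bigA _ (fun up u => pQAX P mu q (up, u) true)) /=.
  rewrite exchange_big; apply: eq_bigr => u _ /=.
  rewrite (bigD1 ord0)//= Et eqxx big1 ?addr0// => up up0.
  by rewrite Et (negPf up0).
congr ((_ - _) / _).
  apply: eq_bigr => q _; rewrite emE; congr hent.
  apply/eqP; rewrite -subr_eq opprK addrC -emE -big_split /=; apply/eqP.
  rewrite -(pair_bigA _ (fun up u => pQAX P mu q (up, u) true + pQAX P mu q (up, u) false)) /=.
  rewrite exchange_big; apply: eq_bigr => u _ /=.
  rewrite -[RHS]mulr1 -(P1 u q) mulr_sumr; apply: eq_bigr => up _.
  by rewrite Et Ef /=; case: ifP => _; ring.
apply: eq_bigr => q _.
rewrite -(pair_bigA _ (fun up u => hent (pQAX P mu q (up, u) true) (pQAX P mu q (up, u) false))) /=.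
rewrite exchange_big; apply: eq_bigr => u _ /=.
rewrite (bigD1 ord0)//= Et Ef eqxx add0r big1 ?addr0.
  by rewrite !(mulrC _ (P _ _ _)) hentZ.
by move=> up up0; rewrite Et (negPf up0) hent0l.
Qed.

Lemma mass_ge0 mu q : (forall t, 0 <= mu t) -> 0 <= mass mu q.
Proof. by move=> mu0; apply: sumr_ge0 => u _; rewrite addr_ge0. Qed.

Lemma policy_le1 P u q up : is_policy P -> P u q up <= 1.
Proof.
by move=> [P0 P1]; rewrite -(P1 u q) (bigD1 up)//= lerDl sumr_ge0.
Qed.

Lemma emission_ge0 P mu q : is_policy P -> (forall t, 0 <= mu t) ->
  0 <= emission P mu q.
Proof. by move=> [P0 _] mu0; apply: sumr_ge0 => u _; rewrite mulr_ge0. Qed.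

Lemma emission_le_mass P mu q : is_policy P -> (forall t, 0 <= mu t) ->
  emission P mu q <= mass mu q.
Proof.
move=> Pp mu0; apply: ler_sum => u _.
by rewrite -[leLHS]addr0 lerD// ler_piMr// policy_le1.
Qed.

(** Superadditivity merges the states of a level into pulses and failed attempts; the deliberate
    silences then only enlarge the second count. *)
Lemma noise_le P mu q : is_policy P -> (forall t, 0 <= mu t) ->
  noise P mu q <= hent (emission P mu q) (mass mu q - emission P mu q).
Proof.
move=> Pp mu0; have [P0 _] := Pp.
have b0 u : 0 <= P u q ord0 * mu (false, u, q) by rewrite mulr_ge0.
have a0 u : 0 <= mu (true, u, q) * P u q ord0 by rewrite mulr_ge0.
apply: le_trans (_ : hent (emission P mu q) (\sum_u P u q ord0 * mu (false, u, q)) <= _).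
  apply: le_trans (hent_sum (fun u _ => a0 u) (fun u _ => b0 u)).
  by apply: ler_sum => u _; rewrite (mulrC (mu _)) hentZ.
apply: hent_mono; rewrite ?emission_ge0 ?sumr_ge0//.
rewrite lerBrDr -big_split /=; apply: ler_sum => u _.
by rewrite addrC lerD// ?ler_piMr// ?ler_piMl// policy_le1.
Qed.

Lemma objective_ge0 P mu : is_policy P -> (forall t, 0 <= mu t) -> 0 <= objective P mu.
Proof.
move=> Pp mu0; rewrite objectiveE// divr_ge0 ?ln_ge0 ?ler1n// -sumrB.
by apply: sumr_ge0 => q _; rewrite subr_ge0 noise_le.
Qed.

Lemma sum_mass mu : \sum_q mass mu q = \sum_t mu t.
Proof. by rewrite sum_state. Qed.

End Objective.

(** * Stationary distributions of the two kernels *)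

Section Kernels.
Variables (R : realType) (eta : R).
Hypothesis eta01 : 0 <= eta <= 1.
Variable N : nat.
Hypothesis N0 : (0 < N)%N.
Notation idx := 'I_N.+1.
Implicit Types (P : policy R N) (mu d : state N -> R).

Lemma eta_ge0 : 0 <= eta. Proof. by case/andP: eta01. Qed.

Lemma etab_ge0 : 0 <= etab eta.
Proof. by rewrite /etab subr_ge0; case/andP: eta01. Qed.

Lemma etab_le1 : etab eta <= 1.
Proof. by rewrite /etab gerBl eta_ge0. Qed.

(* Law of the battery in the slot following an attempt to transmit. *)
Definition recharge (s : bool) : R := if s then eta else etab eta.

Lemma recharge_sum : recharge true + recharge false = 1.
Proof. by rewrite /recharge /etab subrKC. Qed.

(** Discharging a full battery and failing with an empty one both leave exactly the next arrival.
    All resets in the proof come from this. *)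
Lemma bat_diag s' s : bat eta s' s s = recharge s'.
Proof. by rewrite /bat eqxx /recharge; case: s' => //; rewrite /etab subKr. Qed.

Lemma bat_sum x s : bat eta true x s + bat eta false x s = 1.
Proof. by rewrite /bat subrK. Qed.

Lemma bat_ge0 s' x s : 0 <= bat eta s' x s.
Proof.
have h0 := etab_ge0; have h1 := etab_le1.
by rewrite /bat; case: s'; case: eqP => _ /=; lra.
Qed.

Lemma batU_sum x s (q : idx) : batU eta true x s q + batU eta false x s q = 1.
Proof. by rewrite /batU; case: ifP => _; [case: x|]; rewrite ?bat_sum ?addr0. Qed.

Lemma eq_ordE (i j : idx) : (i == j) = (i == j :> nat).
Proof. by []. Qed.

Lemma val_gL (q : idx) x : gL q x = (if x then 0 else if q < N then q.+1 else 0)%N :> nat.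
Proof. by rewrite /gL; case: x => //; case: ifP => // h; rewrite /= inordK. Qed.

Lemma val_gU (q : idx) x : gU q x = (if x then 0 else if q < N then q.+1 else N)%N :> nat.
Proof. by rewrite /gU; case: x => //; case: ifP => // h; rewrite /= inordK. Qed.

Lemma f0 s : f (ord0 : idx) s = s.
Proof. by rewrite /f eqxx andbT. Qed.

Lemma fN0 (up : idx) s : up != ord0 -> f up s = false.
Proof. by rewrite /f eq_ordE => /negPf ->; rewrite andbF. Qed.

Lemma sum_silent P u q s : is_policy P ->
  \sum_up P u q up * (~~ f up s)%:R = 1 - s%:R * P u q ord0.
Proof.
move=> [_ /(_ u q)]; rewrite (bigD1 ord0)//= => P1.
rewrite (bigD1 ord0)//= f0 (eq_bigr (P u q)) => [|up up0]; last by rewrite fN0// mulr1.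
by case: s; rewrite /= ?mulr0 ?mulr1 ?mul1r ?mul0r; lra.
Qed.

(** Weighting two stationary laws crosswise by their masses at level 0 gives an invariant signed
    measure without mass there. If it vanishes, the laws are proportional, hence equal; no
    irreducibility argument is involved. *)
Lemma unique_stationary_of_null (K : state N -> state N -> R) mu :
  (forall d, (forall t', \sum_t d t * K t t' = d t') -> mass d ord0 = 0 ->
     forall t, d t = 0) ->
  stationary K mu -> unique_stationary K mu.
Proof.
move=> null smu; split=> // nu snu.
have [_ [mu1 muK]] := smu; have [_ [nu1 nuK]] := snu.
have cross t : mass nu ord0 * mu t = mass mu ord0 * nu t.
  apply/eqP; rewrite -subr_eq0; apply/eqP.
  apply: (null (fun t => mass nu ord0 * mu t - mass mu ord0 * nu t)).
    move=> t'; rewrite -muK -nuK !mulr_sumr -sumrB.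
    by apply: eq_bigr => z _; ring.
  have lin a b : mass (fun t => a * mu t - b * nu t) ord0 = a * mass mu ord0 - b * mass nu ord0.
    by rewrite /mass !mulr_sumr -sumrB; apply: eq_bigr => u _; ring.
  rewrite lin.
  by rewrite mulrC subrr.
have mm : mass nu ord0 = mass mu ord0.
  by rewrite -[LHS]mulr1 -mu1 mulr_sumr (eq_bigr _ (fun t _ => cross t)) -mulr_sumr nu1 mulr1.
have m0 : mass mu ord0 != 0.
  apply/eqP => m0; have z := null mu muK m0.
  by move: mu1; rewrite big1// => /eqP; rewrite eq_sym oner_eq0.
by apply/funext => t; apply: (mulfI m0); rewrite -cross mm.
Qed.

Lemma KL_from P s u (q : idx) s' u' (q' : idx) k : q' = k.+1 :> nat ->
  q != k :> nat -> KL eta P (s, u, q) (s', u', q') = 0.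
Proof.
move=> q'k qk; rewrite /KL eq_ordE val_gL.
rewrite q'k; case: (f u' s); first by rewrite /= mulr0 mul0r.
case: ltnP => _; last by rewrite /= mulr0 mul0r.
by rewrite eqSS eq_sym (negPf qk) mulr0 mul0r.
Qed.

(** The bound [k.+1 < N] excludes the top level, which in this chain also feeds itself. *)
Lemma KU_from P s u (q : idx) s' u' (q' : idx) k : q' = k.+1 :> nat -> (k.+1 < N)%N ->
  q != k :> nat -> KU eta P (s, u, q) (s', u', q') = 0.
Proof.
move=> q'k kN qk; rewrite /KU eq_ordE val_gU.
rewrite q'k; case: (f u' s); first by rewrite /= mulr0 mul0r.
case: ltnP => _; first by rewrite eqSS eq_sym (negPf qk) mulr0 mul0r.
by rewrite ltn_eqF// mulr0 mul0r.
Qed.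

Lemma KU_to0 P s u q s' u' :
  KU eta P (s, u, q) (s', u', ord0) = (u' == ord0)%:R * recharge s' * (s%:R * P u q ord0).
Proof.
rewrite /KU eq_ordE val_gU.
have [->|u'0] := eqVneq u' ord0.
  rewrite f0; case: s => /=; first by rewrite /batU bat_diag if_same; ring.
  by case: ltnP => qN; rewrite ?(ltn_eqF N0) ?mulr0; ring.
rewrite fN0//=; case: ltnP => qN; rewrite ?(ltn_eqF N0) ?mulr0; ring.
Qed.

Lemma KL_to0 P s u (q : idx) s' u' :
  (forall up : idx, q = N :> nat -> up != 0%N :> nat -> P u q up = 0) ->
  KL eta P (s, u, q) (s', u', ord0) =
  (u' == ord0)%:R * recharge s' * ((s || (q == N :> nat))%:R * P u q ord0).
Proof.
move=> PN; rewrite /KL eq_ordE val_gL.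
have qN : (q < N)%N = (q != N :> nat) by rewrite ltn_neqAle -ltnS ltn_ord andbT.
have [->|u'0] := eqVneq u' ord0.
  rewrite f0 bat_diag qN; case: s => /=; first by ring.
  by case: (q == N :> nat) => /=; ring.
rewrite fN0//= qN; have [e|_] := eqVneq (q : nat) N; last by rewrite /=; ring.
by rewrite PN// ?mul0r.
Qed.

(** Level 0 is entered only with a reset, so an invariant measure is there a fixed law times one
    scalar, its mass at that level. *)
Lemma null_level0 (K : state N -> state N -> R) (c : state N -> R) d :
  (forall t s' u', K t (s', u', ord0) = (u' == ord0)%:R * recharge s' * c t) ->
  (forall t', \sum_t d t * K t t' = d t') -> mass d ord0 = 0 ->
  forall s u, d (s, u, ord0) = 0.
Proof.
move=> K0 dK m0.
have dE s u : d (s, u, ord0) = (u == ord0)%:R * recharge s * \sum_t d t * c t.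
  by rewrite -dK mulr_sumr; apply: eq_bigr => t _; rewrite K0; ring.
have c0 : \sum_t d t * c t = 0.
  move: m0; rewrite /mass (bigD1 ord0)//= big1.
    by rewrite addr0 !dE eqxx !mul1r -mulrDl recharge_sum mul1r.
  by move=> u /negPf u0; rewrite !dE u0 !mul0r addr0.
by move=> s u; rewrite dE c0 mulr0.
Qed.

(** Level [k.+1] is entered from level [k] only, so vanishing propagates upwards. *)
Lemma null_KL P d : (forall u (q up : idx), q = N :> nat -> up != 0%N :> nat -> P u q up = 0) ->
  (forall t', \sum_t d t * KL eta P t t' = d t') -> mass d ord0 = 0 ->
  forall t, d t = 0.
Proof.
move=> PN dK m0.
suff H k : forall s u (q : idx), q = k :> nat -> d (s, u, q) = 0.
  by move=> [[s u] q]; apply: (H q).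
elim: k => [|k IH] s u q qk.
  have -> : q = ord0 by apply: val_inj.
  apply: (null_level0 (c := fun t => (t.1.1 || (t.2 == N :> nat))%:R * P t.1.2 t.2 ord0) _ dK m0).
  by move=> [[s1 u1] q1] s' u'; rewrite KL_to0//; apply: PN.
rewrite -dK; apply: big1 => -[[s1 u1] q1] _.
have [e|ne] := eqVneq (q1 : nat) k; first by rewrite IH// mul0r.
by rewrite (KL_from _ _ _ _ _ qk)// mulr0.
Qed.

(** Below [N] vanishing propagates upwards. At [N] the battery is full and silence keeps [u = 1], so
    a single number [D] remains, and it satisfies [D = (1 - theta) * D]. *)
Lemma null_KU P d (theta : R) : theta != 0 ->
  (forall u (q : idx), q = N :> nat -> P u q ord0 = theta) ->
  (forall u (q up : idx), q = N :> nat -> up = 1%N :> nat -> P u q up = 1 - theta) ->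
  (forall u (q up : idx), q = N :> nat -> (1 < up)%N -> P u q up = 0) ->
  (forall t', \sum_t d t * KU eta P t t' = d t') -> mass d ord0 = 0 ->
  forall t, d t = 0.
Proof.
move=> th0 PN0 PN1 PN2 dK m0.
have H k : forall s u (q : idx), q = k :> nat -> (k < N)%N -> d (s, u, q) = 0.
  elim: k => [|k IH] s u q qk kN.
    have -> : q = ord0 by apply: val_inj.
    apply: (null_level0 (c := fun t => t.1.1%:R * P t.1.2 t.2 ord0) _ dK m0).
    by move=> [[s1 u1] q1] s' u'; rewrite KU_to0.
  rewrite -dK; apply: big1 => -[[s1 u1] q1] _.
  have [e|ne] := eqVneq (q1 : nat) k; first by rewrite IH ?mul0r// ltnW.
  by rewrite (KU_from _ _ _ _ _ qk)// mulr0.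
have one : (inord 1 : idx) = 1%N :> nat by rewrite inordK.
pose D := \sum_u d (true, u, ord_max).
have dN s u : d (s, u, ord_max) = (s && (u == inord 1))%:R * (1 - theta) * D.
  rewrite -dK sum_state (bigD1 ord_max)//= [X in _ + X]big1 => [|q qN]; last first.
    have q_lt : (q < N)%N by rewrite ltn_neqAle -ltnS ltn_ord andbT.
    by apply: big1 => v _; rewrite !(H _ _ _ _ erefl q_lt) !mul0r addr0.
  have d0 v : d (false, v, ord_max) * (P v ord_max u *
      (if ord_max == gU ord_max (f u false) then 1 else 0) *
      batU eta s (f u false) false ord_max) = 0.
    have -> : d (false, v, ord_max) = 0.
      rewrite -dK; apply: big1 => -[[s1 u1] q1] _.
      have [q1N|q1N] := ltnP q1 N; first by rewrite (H _ _ _ _ _ q1N)// mul0r.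
      have {}q1N : q1 = N :> nat by apply/eqP; rewrite eqn_leq q1N -ltnS ltn_ord.
      rewrite /KU eq_ordE val_gU q1N ltnn /batU /= q1N eqxx orbT.
      by case: (f v s1); rewrite ?(gtn_eqF N0) ?mulr0 ?mul0r ?mulr0.
    by rewrite mul0r.
  rewrite addr0 /D mulr_sumr; apply: eq_bigr => v _.
  rewrite d0 addr0 /KU; have [->|u0] := eqVneq u ord0.
    rewrite (eqxx 0%N) [ord_max == _]eq_ordE val_gU /= (gtn_eqF N0) eq_ordE one andbF mulr0n; ring.
  rewrite -[u == 0%N :> nat]/(u == ord0) (negPf u0) [ord_max == _]eq_ordE val_gU ltnn /batU /= eqxx orbT.
  have [->|u1] := eqVneq u (inord 1).
    by rewrite PN1// andbT; case: (s) => /=; ring.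
  rewrite PN2//; first by rewrite andbF mulr0n; ring.
  rewrite ltn_neqAle lt0n; move: u0 u1; rewrite !eq_ordE one /= => -> u1.
  by rewrite eq_sym u1.
have D0 : D = 0.
  have : D = (1 - theta) * D.
    rewrite {1}/D (bigD1 (inord 1))//= big1 ?addr0 ?dN ?eqxx ?mul1r// => u /negPf u1.
    by rewrite dN u1 !mul0r.
  move=> e; have : theta * D = 0 by rewrite mulrBl mul1r in e; lra.
  by move/eqP; rewrite mulf_eq0 (negPf th0) => /eqP.
move=> [[s u] q]; have [qN|qN] := ltnP q N; first exact: H qN.
have -> : q = ord_max by apply: val_inj; apply/eqP; rewrite eqn_leq qN -ltnS ltn_ord.
by rewrite dN D0 mulr0.
Qed.

End Kernels.

Arguments gL : simpl never.
Arguments gU : simpl never.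
Arguments KL : simpl never.
Arguments KU : simpl never.

(** * Truncating an upper-bound policy at the top level *)

Section UpperToLower.
Variables (R : realType) (eta : R).
Hypothesis eta01 : 0 <= eta <= 1.
Variable N : nat.
Hypothesis N0 : (0 < N)%N.
Notation idx := 'I_N.+1.
Implicit Types (P : policy R N) (mu nu : state N -> R) (q : idx).

(** The hypothesis holds for nonzero levels, which are entered by silence alone: the level masses
    form a flow that sees only the emissions. *)
Lemma level_inflow (K : state N -> state N -> R) (g : idx -> idx) P mu q' :
  (forall s u q, \sum_u' (K (s, u, q) (true, u', q') + K (s, u, q) (false, u', q'))
     = (q' == g q)%:R * (1 - s%:R * P u q ord0)) ->
  mass (fun t' => \sum_t mu t * K t t') q'
    = \sum_q (q' == g q)%:R * (mass mu q - emission P mu q).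
Proof.
move=> Kq'; rewrite /mass.
transitivity (\sum_t mu t * \sum_u' (K t (true, u', q') + K t (false, u', q'))).
  transitivity (\sum_u' \sum_t mu t * (K t (true, u', q') + K t (false, u', q'))).
    by apply: eq_bigr => u' _; rewrite -big_split; apply: eq_bigr => t _; rewrite mulrDr.
  by rewrite exchange_big; apply: eq_bigr => t _; rewrite -mulr_sumr.
rewrite sum_state; apply: eq_bigr => q _.
rewrite /emission -sumrB mulr_sumr; apply: eq_bigr => u _.
by rewrite !Kq' /=; ring.
Qed.

Lemma KL_level P s u q q' : is_policy P -> q' != ord0 ->
  \sum_u' (KL eta P (s, u, q) (true, u', q') + KL eta P (s, u, q) (false, u', q'))
  = (q' == gL q false)%:R * (1 - s%:R * P u q ord0).
Proof.
move=> Pp q'0; rewrite -sum_silent// mulr_sumr; apply: eq_bigr => u' _.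
rewrite /KL -mulrDr bat_sum mulr1; case: (f u' s) => /=.
  by rewrite (negPf q'0) !mulr0.
by case: (q' == _) => /=; ring.
Qed.

Lemma KU_level P s u q q' : is_policy P -> q' != ord0 ->
  \sum_u' (KU eta P (s, u, q) (true, u', q') + KU eta P (s, u, q) (false, u', q'))
  = (q' == gU q false)%:R * (1 - s%:R * P u q ord0).
Proof.
move=> Pp q'0; rewrite -sum_silent// mulr_sumr; apply: eq_bigr => u' _.
rewrite /KU -mulrDr batU_sum mulr1; case: (f u' s) => /=.
  by rewrite (negPf q'0) !mulr0.
by case: (q' == _) => /=; ring.
Qed.

Lemma objective_le P mu : is_policy P -> (forall t, 0 <= mu t) -> \sum_t mu t = 1 ->
  objective P mu <= (ln 2)^-1.
Proof.
move=> Pp mu0 mu1; rewrite objectiveE// -[leRHS]mul1r ler_wpM2r//.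
  by rewrite invr_ge0 ln_ge0// ler1n.
rewrite -sumrB -mu1 -sum_mass; apply: ler_sum => q _.
have e0 := emission_ge0 q Pp mu0; have em := emission_le_mass q Pp mu0.
have nz : 0 <= noise P mu q.
  by apply: sumr_ge0 => u _; rewrite mulr_ge0 ?hent_ge0//; case: Pp.
have := @hent_leD _ _ (mass mu q - emission P mu q) e0; rewrite subr_ge0 => /(_ em).
by rewrite subrKC; lra.
Qed.

Lemma a_N_ub P mu : admissibleL eta P mu -> objective P mu <= a_N eta N.
Proof.
move=> ad; apply: ub_le_sup; last by exists P, mu.
exists (ln 2)^-1 => _ [P' [mu' [[Pp' [[mu0 [mu1 _]] _] _ _] ->]]].
exact: objective_le.
Qed.

Lemma b_N_ub P mu : admissibleU eta P mu -> objective P mu <= b_N eta N.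
Proof.
move=> ad; apply: ub_le_sup; last by exists P, mu.
exists (ln 2)^-1 => _ [P' [mu' [[Pp' [[mu0 [mu1 _]] _] _ _] ->]]].
exact: objective_le.
Qed.

Lemma sup_ge0 (A : set R) : (forall x, A x -> 0 <= x) -> 0 <= sup A.
Proof.
move=> A0; have [hA|/sup_out->//] := pselect (has_sup A).
have [[x Ax] bA] := hA.
by apply: le_trans (A0 _ Ax) _; apply: ub_le_sup.
Qed.

Lemma a_N_ge0 : 0 <= a_N eta N.
Proof.
by apply: sup_ge0 => _ [P [mu [[Pp [[mu0 _] _] _ _] ->]]]; apply: objective_ge0.
Qed.

Lemma b_N_ge0 : 0 <= b_N eta N.
Proof.
by apply: sup_ge0 => _ [P [mu [[Pp [[mu0 _] _] _ _] ->]]]; apply: objective_ge0.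
Qed.

Section Truncation.
Variables (P : policy R N) (mu : state N -> R).
Hypothesis adm : admissibleU eta P mu.

Definition forced : policy R N :=
  fun u q up => if q == ord_max then (up == ord0)%:R else P u q up.

(** Of each sojourn at level [N] only the first slot is kept, with the battery law of the
    lower-bound chain instead of a full battery. The result is not normalised. *)
Definition truncated (t : state N) : R :=
  if t.2 == ord_max then \sum_t0 mu t0 * KL eta P t0 t else mu t.

Let Z := \sum_t truncated t.

Let Pp : is_policy P. Proof. by case: adm. Qed.
Let mu0 t : 0 <= mu t. Proof. by case: adm => _ [[]]. Qed.
Let mu1 : \sum_t mu t = 1. Proof. by case: adm => _ [[_ []]]. Qed.
Let muK t' : \sum_t mu t * KU eta P t t' = mu t'. Proof. by case: adm => _ [[_ []]]. Qed.

Lemma forced_policy : is_policy forced.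
Proof.
have [P0 P1] := Pp; split=> u q.
  by move=> up; rewrite /forced; case: ifP.
rewrite /forced; case: (q == ord_max); last exact: P1.
by rewrite (bigD1 ord0)//= big1 ?addr0// => up /negPf ->.
Qed.

Lemma lt_ord_max q : q != ord_max -> (q < N)%N.
Proof. by rewrite eq_ordE /= ltn_neqAle -ltnS ltn_ord andbT. Qed.

Lemma ord_maxN0 : (ord_max : idx) != ord0.
Proof. by rewrite eq_ordE /= -lt0n. Qed.

Lemma massU_succ q q' : q' = q.+1 :> nat -> q' != ord_max ->
  mass mu q' = mass mu q - emission P mu q.
Proof.
move=> qq' q'N; have q'0 : q' != ord0 by rewrite eq_ordE qq'.
have -> : mass mu q' = mass (fun t' => \sum_t mu t * KU eta P t t') q'.
  by apply: eq_bigr => u _; rewrite !muK.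
rewrite (@level_inflow _ (fun q => gU q false) P)// => [|s u q0]; last exact: KU_level.
have q'lt := lt_ord_max q'N.
rewrite (bigD1 q)//= big1 ?addr0 => [|q0 q0q].
  by rewrite eq_ordE val_gU qq' ifT ?eqxx ?mul1r//; apply: ltnW; rewrite -qq'.
rewrite eq_ordE val_gU qq'; case: ltnP => _.
  by rewrite eqSS eq_sym -eq_ordE (negPf q0q) mul0r.
by rewrite -qq' ltn_eqF// mul0r.
Qed.

Lemma KL_to_max_inflow q : q.+1 = N ->
  mass truncated ord_max = mass mu q - emission P mu q.
Proof.
move=> qN; rewrite /mass /truncated /= eqxx.
rewrite -[LHS]/(mass (fun t' => \sum_t mu t * KL eta P t t') ord_max).
rewrite (@level_inflow _ (fun q => gL q false) P)// => [|s u q0]; last exact: KL_level ord_maxN0.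
rewrite (bigD1 q)//= big1 ?addr0 => [|q0 q0q].
  by rewrite eq_ordE val_gL /= qN ifT ?eqxx ?mul1r// -qN.
rewrite eq_ordE val_gL /=; case: ltnP => _; last by rewrite gtn_eqF// mul0r.
by rewrite -[X in X == _]qN eqSS eq_sym -eq_ordE (negPf q0q) mul0r.
Qed.

(** Balance at level [N] of the upper-bound chain: what arrives from level [N - 1] is what leaves by
    pulses. *)
Lemma truncated_max : mass truncated ord_max = emission P mu ord_max.
Proof.
have qN : (inord N.-1 : idx).+1 = N by rewrite inordK ?prednK// ltnS leq_pred.
rewrite (KL_to_max_inflow qN).
have : mass mu ord_max = mass (fun t' => \sum_t mu t * KU eta P t t') ord_max.
  by apply: eq_bigr => u _; rewrite !muK.
rewrite (@level_inflow _ (fun q => gU q false) P)// => [|s u q0]; last exact: KU_level ord_maxN0.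
rewrite (bigD1 ord_max)//= (bigD1 (inord N.-1))/=; last first.
  by rewrite eq_ordE; apply/eqP => /= e; lia.
rewrite big1 ?addr0 => [|q /andP[q1 q2]].
  rewrite !eq_ordE !val_gU /= ltnn eqxx qN ifT ?eqxx ?mul1r; last by lia.
  lra.
rewrite eq_ordE val_gU (lt_ord_max q1) /= -[X in X == _]qN eqSS eq_sym -eq_ordE (negPf q2).
by rewrite mul0r.
Qed.

Lemma emission_max_le q : q != ord_max -> emission P mu ord_max <= mass mu q.
Proof.
move=> qm; rewrite -truncated_max.
suff H k : forall q0 : idx, (q0 + k.+1 = N)%N -> mass truncated ord_max <= mass mu q0.
  apply: (H (N - q).-1); rewrite prednK ?subn_gt0 ?lt_ord_max//.
  by rewrite subnKC// -ltnS ltn_ord.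
elim: k => [|k IH] q0 q0k.
  by rewrite (@KL_to_max_inflow q0) ?gerBl ?emission_ge0//; lia.
have q1 : (inord q0.+1 : idx) = q0.+1 :> nat by rewrite inordK//; lia.
apply: le_trans (IH (inord q0.+1) _) _; first by rewrite q1; lia.
rewrite (massU_succ q1) ?gerBl ?emission_ge0//.
by rewrite eq_ordE q1 /= ltn_eqF//; lia.
Qed.

Lemma emission_max_small : N%:R * emission P mu ord_max <= 1.
Proof.
rewrite -[leRHS]mu1 -sum_mass (bigD1 ord_max)//= -[leLHS]add0r lerD ?mass_ge0//.
have -> : N%:R * emission P mu ord_max
    = \sum_(q : idx | q != ord_max) emission P mu ord_max.
  by rewrite sumr_const cardC1 card_ord mulr_natl.
by apply: ler_sum => q; apply: emission_max_le.
Qed.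

Lemma truncated_ge0 t : 0 <= truncated t.
Proof.
rewrite /truncated; case: ifP => // _; apply: sumr_ge0 => t0 _; rewrite mulr_ge0//.
case: t0 t => [[s u] q] [[s' u'] q']; rewrite /KL !mulr_ge0 ?bat_ge0//.
  by case: Pp.
by case: ifP.
Qed.

Lemma mass_truncated q : q != ord_max -> mass truncated q = mass mu q.
Proof. by move=> /negPf qm; rewrite /mass /truncated /= qm. Qed.

Lemma truncated_sum : Z = \sum_(q | q != ord_max) mass mu q + emission P mu ord_max.
Proof.
rewrite /Z -sum_mass (bigD1 ord_max)//= truncated_max addrC; congr (_ + _).
by apply: eq_bigr => q; apply: mass_truncated.
Qed.

Lemma truncated_sum_le1 : Z <= 1.
Proof.
rewrite truncated_sum -mu1 -sum_mass [leRHS](bigD1 ord_max)//= addrC lerD//.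
exact: emission_le_mass.
Qed.

(** The battery laws differ only for silence at levels [N - 1] and [N], and such steps end at level
    [N] or, for [KL] from [N], start there. *)
Lemma KL_KU s u q s' u' q' : q != ord_max -> q' != ord_max ->
  KL eta P (s, u, q) (s', u', q') = KU eta P (s, u, q) (s', u', q').
Proof.
move=> /lt_ord_max qN /lt_ord_max q'N; rewrite /KL /KU /gL /gU qN /batU /=.
case: (f u' s); first by rewrite if_same.
have [q1N|_] := eqVneq q.+1 N; last by rewrite /= ltn_eqF.
by rewrite eq_ordE inordK// q1N ltn_eqF// !mulr0 !mul0r.
Qed.

(** Among the lower levels, only level 0 receives flow from level [N]. The old chain returned its
    top emission there by pulses, the new one returns the whole truncated mass by forced attempts;
    by [truncated_max] the amounts agree, and the reset law is the same. *)
Lemma truncated_stationary t' : \sum_t truncated t * KL eta forced t t' = truncated t'.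
Proof.
have forced0 u q (up : idx) : q = N :> nat -> up != 0%N :> nat -> forced u q up = 0.
  move=> qN up0; rewrite /forced; case: eqP => [_|[]]; last exact: val_inj.
  by rewrite eq_ordE (negPf up0).
have forcedE q s u s' u' q' : q != ord_max ->
    KL eta forced (s, u, q) (s', u', q') = KL eta P (s, u, q) (s', u', q').
  by move=> /negPf qm; rewrite /KL /forced qm.
have from_max p s u s' u' q' : q' != ord0 -> KL eta p (s, u, ord_max) (s', u', q') = 0.
  move=> q'0; rewrite /KL /gL /= ltnn if_same (negPf q'0); ring.
move: t' => [[s' u'] q']; have [->|q'm] := eqVneq q' ord_max.
  rewrite {2}/truncated /= eqxx; apply: eq_bigr => -[[s u] q] _.
  have [->|qm] := eqVneq q ord_max; first by rewrite !from_max ?mulr0 ?ord_maxN0.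
  by rewrite forcedE// /truncated /= (negPf qm).
rewrite {2}/truncated /= (negPf q'm) -[RHS]muK !sum_state.
rewrite (bigD1 ord_max)//= [RHS](bigD1 ord_max)//=; congr (_ + _); last first.
  apply: eq_bigr => q qm; apply: eq_bigr => u _.
  by rewrite /truncated /= (negPf qm) !forcedE// !KL_KU.
have [->|q'0] := eqVneq q' ord0.
  transitivity ((u' == ord0)%:R * recharge eta s' * mass truncated ord_max).
    rewrite /mass mulr_sumr; apply: eq_bigr => u _.
    rewrite !KL_to0//; try by move=> up; apply: forced0.
    by rewrite /= eqxx /forced !eqxx /=; ring.
  rewrite truncated_max /emission mulr_sumr; apply: eq_bigr => u _.
  by rewrite !KU_to0//=; ring.
rewrite big1 ?big1// => u _; last by rewrite !from_max// !mulr0 addr0.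
have KU0 s : KU eta P (s, u, ord_max) (s', u', q') = 0.
  rewrite /KU eq_ordE val_gU /= ltnn; case: (f u' s).
    by rewrite -[X in _ == X]/(nat_of_ord (ord0 : idx)) -eq_ordE (negPf q'0); ring.
  by rewrite ltn_eqF ?lt_ord_max//; ring.
by rewrite !KU0 !mulr0 addr0.
Qed.

Lemma normalized_admissible : Z != 0 -> admissibleL eta forced (fun t => truncated t / Z).
Proof.
move=> Z0; have [_ _ [s1 s2] _] := adm.
have forced0 u q (up : idx) : q = N :> nat -> up != 0%N :> nat -> forced u q up = 0.
  move=> qN up0; rewrite /forced; case: eqP => [_|[]]; last exact: val_inj.
  by rewrite eq_ordE (negPf up0).
split; [exact: forced_policy| | |by []].
  apply: unique_stationary_of_null; first by move=> d; apply: null_KL.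
  split; first by move=> t; rewrite divr_ge0 ?truncated_ge0 ?sumr_ge0// => ? _; apply: truncated_ge0.
  split; first by rewrite -mulr_suml divff.
  move=> t'; rewrite -truncated_stationary mulr_suml; apply: eq_bigr => t _.
  by rewrite mulrAC.
split.
  move=> s u q qu; have qm : q != ord_max.
    by apply/eqP => qm; move: qu; rewrite qm /= ltnNge -ltnS ltn_ord.
  by rewrite /truncated /= (negPf qm) s1 ?mul0r.
move=> u q up qN; have qm : q != ord_max.
  by apply/eqP => qm; move: qN; rewrite qm /= ltnn.
by rewrite /forced (negPf qm); apply: s2.
Qed.

(** The top term is bounded by [hent_sqrt], its noise being dropped. The other terms are those of
    the normalised truncation times [Z], and the factor disappears because [Z <= 1] and objectives
    are nonnegative. *)
Lemma objectiveU_le_aux :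
  objective P mu <= a_N eta N + 3 / ln 2 * Num.sqrt (emission P mu ord_max).
Proof.
have ln2 : 0 < ln 2 :> R by rewrite ln_gt0// ltr1n.
have P0 : forall u q up, 0 <= P u q up by case: Pp.
have e0 q := emission_ge0 q Pp mu0; have em q := emission_le_mass q Pp mu0.
have nz q : 0 <= noise P mu q.
  by apply: sumr_ge0 => u _; rewrite mulr_ge0 ?hent_ge0.
pose A := \sum_(q | q != ord_max) (hent (emission P mu q) (mass mu q - emission P mu q) - noise P mu q).
have mle : mass mu ord_max <= 1.
  by rewrite -mu1 -sum_mass (bigD1 ord_max)//= lerDl sumr_ge0// => q _; apply: mass_ge0.
have step1 : objective P mu <= A / ln 2 + 3 / ln 2 * Num.sqrt (emission P mu ord_max).
  rewrite objectiveE// -sumrB (bigD1 ord_max)//= -/A.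
  rewrite [3 / _ * _]mulrAC -mulrDl ler_wpM2r ?invr_ge0 ?(ltW ln2)// addrC lerD2l.
  have := @hent_sqrt _ (emission P mu ord_max) (mass mu ord_max - emission P mu ord_max).
  rewrite subr_ge0 subrKC => /(_ (e0 _) (em _) mle); have := nz ord_max; lra.
apply: le_trans step1 _; rewrite lerD2r.
have tr0 : forall t, 0 <= truncated t := truncated_ge0.
have Zge0 : 0 <= Z by apply: sumr_ge0.
have AE : A <= Z * objective forced (fun t => truncated t / Z) * ln 2.
  have [Z0|Z0] := eqVneq Z 0.
    rewrite Z0 !mul0r /A; apply: sumr_le0 => q qm.
    have : mass mu q <= 0.
      rewrite -[leRHS]Z0 truncated_sum (bigD1 q)//= -addrA lerDl addr_ge0//.
      by apply: sumr_ge0 => ? _; apply: mass_ge0.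
    move=> m0; have -> : emission P mu q = 0 by have := e0 q; have := em q; lra.
    by rewrite hent0l sub0r oppr_le0.
  rewrite objectiveE; [|exact: forced_policy|by move=> t; rewrite divr_ge0].
  rewrite mulrA mulfVK ?gt_eqF// -sumrB mulr_sumr (bigD1 ord_max)//= -[leLHS]add0r lerD//.
    rewrite mulr_ge0// subr_ge0 noise_le//; first exact: forced_policy.
    by move=> t; rewrite divr_ge0.
  rewrite /A; apply: ler_sum => q qm; rewrite le_eqVlt; apply/orP; left; apply/eqP.
  have Zi : 0 <= Z^-1 by rewrite invr_ge0.
  have -> : emission forced (fun t => truncated t / Z) q = Z^-1 * emission P mu q.
    rewrite mulr_sumr; apply: eq_bigr => u _.
    by rewrite /forced /truncated /= (negPf qm); ring.
  have -> : mass (fun t => truncated t / Z) q = Z^-1 * mass mu q.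
    rewrite mulr_sumr; apply: eq_bigr => u _.
    by rewrite /truncated /= (negPf qm); ring.
  have -> : noise forced (fun t => truncated t / Z) q = Z^-1 * noise P mu q.
    rewrite mulr_sumr; apply: eq_bigr => u _.
    rewrite /forced /truncated /= (negPf qm) !(mulrC _ Z^-1) hentZ//; ring.
  by rewrite -mulrBr hentZ ?subr_ge0// -mulrBr mulrA divff// mul1r.
rewrite ler_pdivrMr//; apply: le_trans AE _; rewrite ler_wpM2r ?(ltW ln2)//.
have [Z0|Z0] := eqVneq Z 0; first by rewrite Z0 mul0r a_N_ge0.
have ad := normalized_admissible Z0.
apply: le_trans (a_N_ub ad); rewrite ler_piMl ?truncated_sum_le1//.
by apply: objective_ge0; [exact: forced_policy|move=> t; rewrite divr_ge0].
Qed.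

Lemma objectiveU_le : objective P mu <= a_N eta N + 3 / ln 2 / Num.sqrt N%:R.
Proof.
apply: le_trans objectiveU_le_aux _; rewrite lerD2l ler_wpM2l//.
  by rewrite divr_ge0// ln_ge0// ler1n.
have Nr : 0 < N%:R :> R by rewrite ltr0n.
rewrite -(sqrtrV (ltW Nr)) ler_sqrt ?invr_gt0//.
by rewrite -[leRHS]mul1r ler_pdivlMr// mulrC emission_max_small.
Qed.

End Truncation.

Lemma b_N_le : b_N eta N <= a_N eta N + 3 / ln 2 / Num.sqrt N%:R.
Proof.
rewrite /b_N; set S := [set _ | _].
have [S0|/set0P/negP] := pselect (S !=set0).
  by apply: ge_sup => // _ [P [mu [ad ->]]]; apply: objectiveU_le.
rewrite negbK => /eqP ->; rewrite sup0 addr_ge0 ?a_N_ge0//.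
by rewrite !divr_ge0 ?sqrtr_ge0// ln_ge0// ler1n.
Qed.

End UpperToLower.

(** * Circulations and admissible upper-bound policies *)

Section Circulation.
Variables (R : realType) (eta : R).
Hypothesis eta01 : 0 <= eta <= 1.
Variable N : nat.
Hypothesis N0 : (0 < N)%N.
Notation idx := 'I_N.+1.

(* [visits u q] and [attempts u q] count the slots spent in the state [(u, q)],
   respectively those in which an attempt to transmit is made; [stay] counts
   the slots spent in the top level [q = N]. *)
Variables (visits attempts : nat -> nat -> R) (stay : R).

Definition empty_prob (u : nat) : R := etab eta ^+ u.+1.

Definition level_visits q : R := \sum_(u < N.+1) visits u q.

Definition level_emission q : R := \sum_(u < N.+1) attempts u q * (1 - empty_prob u).

Hypothesis attempts_ge0 : forall u q, 0 <= attempts u q.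
Hypothesis attempts_le : forall u q, attempts u q <= visits u q.
Hypothesis visits_supp : forall u q, (q < u)%N -> visits u q = 0.
Hypothesis visits_silent : forall u q, (q < N)%N ->
  visits u.+1 q.+1 = visits u q - attempts u q.
Hypothesis visits_failed : forall q, (q < N)%N ->
  visits 0%N q.+1 = \sum_(u < N.+1) attempts u q * empty_prob u.
Hypothesis top_gt0 : 0 < level_visits N.
Hypothesis top_le : level_visits N <= stay.

(** The value 1 on unvisited states matters: for [u = N] and [q < N] there is no index [u.+1], so
    the policy must put all its weight on [0]. *)
Let ratio u q : R := if visits u q == 0 then 1 else attempts u q / visits u q.

(** The pulse rate at which the top level, over [stay] slots, releases exactly the flow that arrives
    there. *)
Let theta : R := level_visits N / stay.

Let circ_policy : policy R N := fun u q up =>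
  if q == ord_max then
    if up == ord0 then theta else if up == 1%N :> nat then 1 - theta else 0
  else if up == ord0 then ratio u q
  else if up == u.+1 :> nat then 1 - ratio u q else 0.

(** At the top the battery is full, and every slot of a sojourn after the first has [u = 1], the
    value that silence gives to [U+] there. *)
Let circ (t : state N) : R :=
  let: (s, u, q) := t in
  if q == ord_max then
    if s then visits u N + (u == 1%N :> nat)%:R * (stay - level_visits N) else 0
  else visits u q * (if s then 1 - empty_prob u else empty_prob u).

Lemma empty_prob_ge0 u : 0 <= empty_prob u.
Proof. by rewrite exprn_ge0 ?etab_ge0. Qed.

Lemma empty_prob_le1 u : empty_prob u <= 1.
Proof. by rewrite exprn_ile1 ?etab_ge0 ?etab_le1. Qed.

Lemma visits_ge0 u q : 0 <= visits u q.
Proof. exact: le_trans (attempts_ge0 _ _) (attempts_le _ _). Qed.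

Let stay_gt0 : 0 < stay. Proof. exact: lt_le_trans top_gt0 top_le. Qed.

Let theta_gt0 : 0 < theta. Proof. exact: divr_gt0. Qed.

Let theta_le1 : theta <= 1. Proof. by rewrite ler_pdivrMr// mul1r. Qed.

Let visits_ratio u q : visits u q * ratio u q = attempts u q.
Proof.
rewrite /ratio; case: eqP => [v0|/eqP v0]; last by rewrite mulrC divfK.
by rewrite v0 mul0r; have := attempts_ge0 u q; have := attempts_le u q; lra.
Qed.

Let ratio_ge0 u q : 0 <= ratio u q.
Proof. by rewrite /ratio; case: ifP => // _; rewrite divr_ge0 ?visits_ge0. Qed.

Let ratio_le1 u q : ratio u q <= 1.
Proof.
rewrite /ratio; case: eqP => // /eqP v0.
by rewrite ler_pdivrMr ?mul1r// lt_neqAle eq_sym v0 visits_ge0.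
Qed.

Let circ_policyP : is_policy circ_policy.
Proof.
split=> u q.
  move=> up; rewrite /circ_policy; case: ifP => _; case: ifP => _ //; try exact: ltW.
    by case: ifP; rewrite ?subr_ge0.
  by case: ifP; rewrite ?subr_ge0.
rewrite /circ_policy; have [qm|qm] := eqVneq q ord_max.
  have one : (inord 1 : idx) = 1%N :> nat by rewrite inordK.
  rewrite (bigD1 ord0)//= (bigD1 (inord 1))/=; last by rewrite eq_ordE one.
  rewrite big1 => [|up /andP[u0 u1]]; first by rewrite !eq_ordE one /= addr0 subrKC.
  by rewrite (negPf u0); move: u1; rewrite eq_ordE one => /negPf ->.
rewrite (bigD1 ord0)//=.
have [uN|uN] := ltnP u N.
  have uS : (inord u.+1 : idx) = u.+1 :> nat by rewrite inordK.
  rewrite (bigD1 (inord u.+1))/=; last by rewrite eq_ordE uS.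
  rewrite big1 => [|up /andP[u0 u1]]; first by rewrite !eq_ordE uS /= eqxx addr0 subrKC.
  by rewrite (negPf u0); move: u1; rewrite eq_ordE uS => /negPf ->.
rewrite big1 ?addr0 => [|up /negPf ->].
  by rewrite /ratio visits_supp ?eqxx// (leq_trans (lt_ord_max qm)).
by rewrite ltn_eqF// (leq_trans (ltn_ord up)).
Qed.

Let circ_ge0 t : 0 <= circ t.
Proof.
case: t => [[[] u] q]; rewrite /circ; case: ifP => _ //.
- by rewrite addr_ge0 ?visits_ge0// mulr_ge0// subr_ge0.
- by rewrite mulr_ge0 ?visits_ge0// subr_ge0 empty_prob_le1.
- by rewrite mulr_ge0 ?visits_ge0// empty_prob_ge0.
Qed.

Let circ_mass (q : idx) : q != ord_max -> mass circ q = level_visits q.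
Proof. by move=> /negPf qm; apply: eq_bigr => u _; rewrite /circ /= qm; ring. Qed.

Let circ_mass_max : mass circ ord_max = stay.
Proof.
have one : (inord 1 : idx) = 1%N :> nat by rewrite inordK.
rewrite /mass /circ /= eqxx; under eq_bigr do rewrite addr0.
rewrite big_split /= -mulr_suml.
rewrite [X in _ + X * _](bigD1 (inord 1))//= one eqxx [X in _ + (_ + X) * _]big1 => [|u].
  by rewrite addr0 mul1r subrKC.
by rewrite eq_ordE one => /negPf ->.
Qed.

Let circ_emission (q : idx) : q != ord_max ->
  emission circ_policy circ q = level_emission q.
Proof.
move=> /negPf qm; apply: eq_bigr => u _; rewrite /circ /circ_policy /= qm.
by rewrite -visits_ratio; ring.
Qed.

Let circ_emission_max : emission circ_policy circ ord_max = level_visits N.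
Proof.
have -> : emission circ_policy circ ord_max = mass circ ord_max * theta.
  rewrite mulr_suml; apply: eq_bigr => u _.
  by rewrite /circ /circ_policy eqxx /=; ring.
by rewrite circ_mass_max mulrC divfK// gt_eqF.
Qed.

Lemma level_visits_succ q : (q < N)%N ->
  level_visits q.+1 = level_visits q - level_emission q.
Proof.
move=> qN; rewrite /level_visits /level_emission big_ord_recl /= visits_failed//.
have -> : \sum_(u < N) visits (lift ord0 u) q.+1 = \sum_(u < N.+1) (visits u q - attempts u q).
  rewrite big_ord_recr /= (@visits_supp N)// sub0r.
  have -> : attempts N q = 0.
    by have := attempts_ge0 N q; have := attempts_le N q; rewrite visits_supp//; lra.
  by rewrite oppr0 addr0; apply: eq_bigr => u _; rewrite -visits_silent.
by rewrite -big_split -sumrB /=; apply: eq_bigr => u _; ring.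
Qed.

(** A cycle either ends with a pulse below level [N] or reaches level [N]. *)
Lemma total_emission : \sum_(q < N) level_emission q + level_visits N = visits 0%N 0%N.
Proof.
have -> : visits 0%N 0%N = level_visits 0.
  by rewrite /level_visits big_ord_recl big1 ?addr0// => u _; rewrite visits_supp.
have H k : (k <= N)%N -> \sum_(q < k) level_emission q + level_visits k = level_visits 0.
  elim: k => [|k IH] kN; first by rewrite big_ord0 add0r.
  by rewrite big_ord_recr /= level_visits_succ// -IH 1?ltnW//; ring.
exact: H.
Qed.

Lemma widen_neq_max (q : 'I_N) : widen_ord (leqnSn N) q != ord_max :> idx.
Proof. by rewrite eq_ordE /= ltn_eqF. Qed.

(** Balance at level 0 is [total_emission]; at intermediate levels it is the two conservation
    hypotheses; at level [N] the self-loop supplies the slots of [stay] beyond the arriving flow. *)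
Let circ_stationary t' : \sum_t circ t * KU eta circ_policy t t' = circ t'.
Proof.
have one : (inord 1 : idx) = 1%N :> nat by rewrite inordK.
have max0 : (ord0 == ord_max :> idx) = false by rewrite eq_ordE /= ltn_eqF.
move: t' => [[s' u'] q']; rewrite sum_state.
have [->|q'0] := eqVneq q' ord0.
  transitivity ((u' == ord0)%:R * recharge eta s' * \sum_q emission circ_policy circ q).
    rewrite mulr_sumr; apply: eq_bigr => q _; rewrite mulr_sumr.
    by apply: eq_bigr => u _; rewrite !KU_to0//=; ring.
  rewrite big_ord_recr /= circ_emission_max.
  rewrite (eq_bigr (fun q : 'I_N => level_emission q)); last first.
    by move=> q _; rewrite circ_emission ?widen_neq_max.
  rewrite total_emission /circ max0; have [->|u'0] := eqVneq u' ord0.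
    by rewrite /empty_prob expr1 /recharge /etab; case: (s'); rewrite /=; ring.
  by rewrite [visits u' _]visits_supp ?mulr0n ?mul0r// lt0n.
have [k q'k] : exists k, q' = k.+1 :> nat by exists q'.-1; rewrite prednK// lt0n.
have kN : (k < N)%N by rewrite -ltnS -q'k ltn_ord.
have ik : (inord k : idx) = k :> nat by rewrite inordK// ltnW.
have km : (inord k : idx) != ord_max by rewrite eq_ordE ik /= ltn_eqF.
have gk : gU (inord k : idx) false = q' by apply: val_inj; rewrite /= val_gU ik kN q'k.
have gk1 q : (q' == gU q true) = false by rewrite eq_ordE val_gU q'k.
have from_k : \sum_(u < N.+1) (circ (true, u, inord k) * KU eta circ_policy (true, u, inord k) (s', u', q')
     + circ (false, u, inord k) * KU eta circ_policy (false, u, inord k) (s', u', q'))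
   = visits u' q' * (if q' == ord_max then s'%:R else if s' then 1 - empty_prob u' else empty_prob u').
  have batUk s : batU eta s' false s (inord k : idx)
       = if q' == ord_max then s'%:R else bat eta s' false s.
    rewrite /batU /= ik (ltn_eqF kN) orbF eq_ordE q'k /=.
    by case: ifP => // _; case: (s').
  rewrite /KU /circ (negPf km) ik /circ_policy (negPf km) ik.
  have [->|u'0] := eqVneq u' ord0.
    under eq_bigr => u _.
      rewrite f0 gk1 f0 gk eqxx batUk//.
      have -> : visits u k * (1 - empty_prob u) * (ratio u k * 0 * batU eta s' true true (inord k : idx))
         + visits u k * empty_prob u * (ratio u k * 1 * (if q' == ord_max then s'%:R else bat eta s' false false))
         = attempts u k * empty_prob u * (if q' == ord_max then s'%:R else bat eta s' false false).
        by rewrite -visits_ratio; ring.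
      over.
    rewrite -mulr_suml -visits_failed// q'k; congr (_ * _); by case: ifP.
  under eq_bigr => u _.
    rewrite !fN0// gk eqxx !batUk//.
    over.
  have [w u'w] : exists w, u' = w.+1 :> nat by exists u'.-1; rewrite prednK// lt0n.
  have wN : (w < N)%N by rewrite -ltnS -u'w ltn_ord.
  have iw : (inord w : idx) = w :> nat by rewrite inordK// ltnW.
  rewrite (bigD1 (inord w))//= big1 ?addr0 => [|u uw]; last first.
    rewrite u'w eqSS eq_sym; have /negPf -> : u != w :> nat by rewrite -iw.
    ring.
  rewrite u'w iw eqxx q'k visits_silent// -visits_ratio.
  have -> : empty_prob w.+1 = etab eta * empty_prob w by rewrite /empty_prob exprS.
  by case: ifP => _; rewrite /bat /etab; case: (s') => /=; ring.
have other q : q != inord k -> q != ord_max -> forall u s,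
    KU eta circ_policy (s, u, q) (s', u', q') = 0.
  move=> qk qm u s; rewrite /KU; case: (f u' s); first by rewrite gk1; ring.
  rewrite eq_ordE val_gU lt_ord_max// q'k eqSS eq_sym.
  by move: qk; rewrite eq_ordE ik => /negPf ->; ring.
rewrite (bigD1 (inord k))//= from_k (bigD1 ord_max)/= 1?eq_sym//.
rewrite [X in _ + (_ + X)]big1 ?addr0 => [|q /andP[qk qm]]; last first.
  by apply: big1 => u _; rewrite !other// !mulr0 addr0.
have [q'm|q'm] := eqVneq q' ord_max; last first.
  rewrite big1 ?addr0// => u _.
  have gmax x : (q' == gU (ord_max : idx) x) = false.
    by rewrite eq_ordE val_gU /= ltnn; case: x; rewrite ?q'k// -q'k ltn_eqF// lt_ord_max.
  by rewrite /KU !gmax; ring.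
rewrite q'm /=.
have -> : \sum_(u < N.+1) (circ (true, u, ord_max) * KU eta circ_policy (true, u, ord_max) (s', u', ord_max)
     + circ (false, u, ord_max) * KU eta circ_policy (false, u, ord_max) (s', u', ord_max))
   = mass circ ord_max * ((u' == 1%N :> nat)%:R * (1 - theta) * s'%:R).
  rewrite mulr_suml; apply: eq_bigr => u _.
  have -> : circ (false, u, ord_max) = 0 by rewrite /circ eqxx.
  rewrite addr0 mul0r addr0; congr (_ * _); rewrite /KU /circ_policy eqxx.
  have [->|u'0] := eqVneq u' ord0.
    by rewrite f0 -q'm gk1 /=; ring.
  rewrite fN0// [ord_max == _]eq_ordE val_gU /= ltnn eqxx /batU /= eqxx orbT.
  by case: ifP => _; case: (s') => /=; ring.
rewrite circ_mass_max.
have -> : stay * ((u' == 1%N :> nat)%:R * (1 - theta) * s'%:R)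
   = (u' == 1%N :> nat)%:R * (stay - level_visits N) * s'%:R.
  have <- : stay * theta = level_visits N by rewrite mulrC divfK// gt_eqF.
  by ring.
by case: (s') => /=; ring.
Qed.

Let len := \sum_(q < N) level_visits q + stay.

(** Division by the length turns the flow into a stationary law, and homogeneity turns its objective
    into this sum. The top level carries no noise because its battery is full. *)
Lemma circulation_le_b_N :
  \sum_(q < N) (hent (level_emission q) (level_visits q - level_emission q)
     - \sum_(u < N.+1) attempts u q * hent (1 - empty_prob u) (empty_prob u))
  + hent (level_visits N) (stay - level_visits N) <= len * b_N eta N * ln 2.
Proof.
have circ_sum : \sum_t circ t = len.
  rewrite -sum_mass big_ord_recr /= circ_mass_max; congr (_ + _).
  by apply: eq_bigr => q _; rewrite circ_mass ?widen_neq_max.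
have len_gt0 : 0 < len.
  by rewrite ltr_wpDl// sumr_ge0// => q _; apply: sumr_ge0 => u _; apply: visits_ge0.
have ln2 : 0 < ln 2 :> R by rewrite ln_gt0// ltr1n.
pose mu t := circ t / len.
have mu0 t : 0 <= mu t by rewrite divr_ge0 ?(ltW len_gt0).
have ad : admissibleU eta circ_policy mu.
  split=> //.
  - apply: unique_stationary_of_null.
      move=> d; apply: (@null_KU _ _ _ N0 _ _ theta); first by rewrite gt_eqF.
      + by move=> u q qN; rewrite /circ_policy eq_ordE qN /= eqxx.
      + by move=> u q up qN up1; rewrite /circ_policy !eq_ordE qN up1 /= eqxx.
      + move=> u q up qN up1; rewrite /circ_policy !eq_ordE qN /= eqxx.
        by rewrite !gtn_eqF// ltnW.
    split=> //; split; first by rewrite -mulr_suml circ_sum divff// gt_eqF.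
    move=> t'; rewrite /mu -circ_stationary mulr_suml.
    by apply: eq_bigr => t _; rewrite mulrAC.
  - split.
      move=> s u q /= qu; rewrite /mu /circ; have -> : (q == ord_max) = false.
        by apply/eqP => qm; move: qu; rewrite qm /= ltnNge -ltnS ltn_ord.
      by rewrite visits_supp ?mul0r.
    move=> u q up /= qN up0 upu; rewrite /circ_policy; have -> : (q == ord_max) = false.
      by rewrite eq_ordE /= ltn_eqF.
    by rewrite eq_ordE (negPf up0) (negPf upu).
  - move=> u q up /= qN up1; rewrite /circ_policy !eq_ordE qN /= eqxx.
    by rewrite !gtn_eqF// ltnW.
rewrite -[leRHS]mulrA mulrC -ler_pdivrMr// mulrC.
apply: le_trans (_ : objective circ_policy mu * ln 2 <= _); last first.
  by rewrite ler_wpM2r ?(ltW ln2)// b_N_ub.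
rewrite objectiveE// mulfVK ?gt_eqF// -sumrB big_ord_recr /=.
have li : 0 <= len^-1 by rewrite invr_ge0 ltW.
have emE q : emission circ_policy mu q = len^-1 * emission circ_policy circ q.
  by rewrite mulr_sumr; apply: eq_bigr => u _; rewrite /mu; ring.
have maE q : mass mu q = len^-1 * mass circ q.
  by rewrite mulr_sumr; apply: eq_bigr => u _; rewrite /mu; ring.
have hE q : hent (emission circ_policy mu q) (mass mu q - emission circ_policy mu q)
   = len^-1 * hent (emission circ_policy circ q) (mass circ q - emission circ_policy circ q).
  rewrite emE maE -mulrBr hentZ//; first exact: emission_ge0.
  by rewrite subr_ge0 emission_le_mass.
rewrite mulrDr mulr_sumr le_eqVlt; apply/orP; left; apply/eqP; congr (_ + _).
  apply: eq_bigr => q _; set q' := widen_ord _ _.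
  have q'm : q' != ord_max := widen_neq_max q.
  rewrite hE circ_emission// circ_mass// mulrBr; congr (_ - _).
  rewrite mulr_sumr; apply: eq_bigr => u _.
  rewrite /circ_policy /mu /circ (negPf q'm) eqxx -visits_ratio.
  rewrite !(mulrC _ len^-1) !hentZ ?mulr_ge0 ?visits_ge0 ?subr_ge0 ?empty_prob_le1 ?empty_prob_ge0//.
  by rewrite /q' /=; ring.
rewrite hE circ_emission_max circ_mass_max -[LHS]subr0; congr (_ - _).
rewrite /noise big1// => u _; rewrite /mu /circ eqxx mul0r hent0r mulr0//.
Qed.

End Circulation.

(** * The channel law along an output sequence *)

Section ChannelLaw.
Variables (R : realType) (eta : R).
Hypothesis eta01 : 0 <= eta <= 1.

Definition next_battery (x s e : bool) := if x then e else s || e.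

(* Expectation of [g] over the battery and the histories reached when the
   outputs are [ys], restricted to that event; with [g = 1] it is the
   probability of [ys]. *)
Fixpoint expect (enc : seq bool -> seq bool -> bool)
    (g : bool -> seq bool -> seq bool -> R) (ys : seq bool) s hs hy : R :=
  if ys is x :: ys' then
    if enc hs hy == x then
      \sum_(e : bool) recharge eta e *
        (let s' := next_battery x s e in
         expect enc g ys' s' (rcons hs s') (rcons hy x))
    else 0
  else g s hs hy.

Lemma sum_tuple_cons (T : finType) n (F : seq T -> R) :
  \sum_(t : n.+1.-tuple T) F t = \sum_x \sum_(t : n.-tuple T) F (x :: t).
Proof.
rewrite pair_bigA /= (reindex (fun p : T * n.-tuple T => [tuple of p.1 :: p.2])) //=.
exists (fun t : n.+1.-tuple T => (thead t, [tuple of behead t])) => [[x t] _|t _] /=.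
  by congr (_, _); apply: val_inj.
by rewrite -tuple_eta.
Qed.

Lemma sum_tuple0 (T : finType) (F : seq T -> R) : \sum_(t : 0.-tuple T) F t = F [::].
Proof.
rewrite (bigD1 [tuple])//= big1 ?addr0// => t /negP[].
by rewrite (tuple0 t).
Qed.

Lemma sum_tuple_rev n (F : seq bool -> R) :
  \sum_(t : n.-tuple bool) F t = \sum_(t : n.-tuple bool) F (rev t).
Proof.
rewrite (reindex (fun t : n.-tuple bool => [tuple of rev t])) //=.
by exists (fun t : n.-tuple bool => [tuple of rev t]) => t _; apply: val_inj; rewrite /= revK.
Qed.

Definition seq_prob (es : seq bool) : R := \prod_(e <- es) recharge eta e.

Lemma prE_seq n (e : n.-tuple bool) : prE eta e = seq_prob e.
Proof. by rewrite /seq_prob big_tuple. Qed.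

(** In each slot the output is determined before the arrival is drawn, so the arrival sequences can
    be grouped by the outputs they produce. *)
Lemma run_law n M (enc : encoder M) m (D : seq bool -> bool) s hs hy :
  \sum_(e : n.-tuple bool) (if D (run enc m e s hs hy) then prE eta e else 0) =
  \sum_(y : n.-tuple bool) (if D (hy ++ y) then
     expect (fun hs hy => enc (size hy) m hs hy) (fun _ _ _ => 1) y s hs hy else 0).
Proof.
under eq_bigr do rewrite prE_seq.
elim: n s hs hy => [|n IH] s hs hy.
  rewrite (sum_tuple0 (fun e => if D (run enc m e s hs hy) then seq_prob e else 0)).
  rewrite (sum_tuple0 (fun y => if D (hy ++ y) then _ y s hs hy else 0)) /=.
  by rewrite cats0 /seq_prob big_nil.
rewrite (sum_tuple_cons n (fun e => if D (run enc m e s hs hy) then seq_prob e else 0)).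
rewrite (sum_tuple_cons n (fun y => if D (hy ++ y) then
   expect (fun hs hy => enc (size hy) m hs hy) (fun _ _ _ => 1) y s hs hy else 0)).
rewrite [RHS](bigD1 (enc (size hy) m hs hy))//= [X in _ + X]big1 ?addr0; last first.
  move=> x /negPf xe; apply: big1 => y _.
  by rewrite eq_sym xe if_same.
rewrite eqxx; set x := enc _ _ _ _.
transitivity (\sum_(e : bool) recharge eta e * \sum_(es : n.-tuple bool)
   (if D (run enc m es (next_battery x s e) (rcons hs (next_battery x s e)) (rcons hy x))
    then seq_prob es else 0)).
  apply: eq_bigr => e _; rewrite mulr_sumr; apply: eq_bigr => es _ /=.
  by rewrite -/x /next_battery; case: ifP; rewrite ?mulr0// /seq_prob big_cons.
rewrite (eq_bigr (fun e => \sum_(y : n.-tuple bool) recharge eta e *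
   (if D (rcons hy x ++ y) then expect (fun hs hy => enc (size hy) m hs hy) (fun _ _ _ => 1) y
      (next_battery x s e) (rcons hs (next_battery x s e)) (rcons hy x) else 0))); last first.
  by move=> e _; rewrite -mulr_sumr; congr (_ * _); apply: IH.
rewrite exchange_big; apply: eq_bigr => y _ /=; rewrite cat_rcons.
by case: ifP => // _; apply: big1 => e _; rewrite mulr0.
Qed.

Variable enc : seq bool -> seq bool -> bool.

(** Prefixes are later stored in reverse and grow at their head, so their recursions have to peel
    off the last slot. *)
Lemma expect_rcons g ys x s hs hy : expect enc g (rcons ys x) s hs hy =
  expect enc (fun s hs hy => if enc hs hy == x then
      \sum_(e : bool) recharge eta e *
        g (next_battery x s e) (rcons hs (next_battery x s e)) (rcons hy x)
    else 0) ys s hs hy.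
Proof.
elim: ys s hs hy => [|y ys IH] s hs hy //=.
by case: ifP => // _; apply: eq_bigr => e _; rewrite IH.
Qed.

Lemma recharge_ge0 e : 0 <= recharge eta e.
Proof. by case: e; [apply: eta_ge0 | apply: etab_ge0]. Qed.

Lemma expect_le g1 g2 ys s hs hy :
  (forall s hs hy, last false hs = s -> size hs = size hy -> g1 s hs hy <= g2 s hs hy) ->
  last false hs = s -> size hs = size hy ->
  expect enc g1 ys s hs hy <= expect enc g2 ys s hs hy.
Proof.
move=> g12; elim: ys s hs hy => [|y ys IH] s hs hy ls szs /=; first exact: g12.
case: ifP => // _; apply: ler_sum => e _; rewrite ler_wpM2l ?recharge_ge0//.
by apply: IH; rewrite ?last_rcons// !size_rcons szs.
Qed.

Lemma expectB g1 g2 (a b : R) ys s hs hy :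
  expect enc (fun s hs hy => a * g1 s hs hy - b * g2 s hs hy) ys s hs hy
  = a * expect enc g1 ys s hs hy - b * expect enc g2 ys s hs hy.
Proof.
elim: ys s hs hy => [|y ys IH] s hs hy //=.
case: ifP => _; last by rewrite !mulr0 subr0.
by rewrite !mulr_sumr -sumrB; apply: eq_bigr => e _; rewrite IH; ring.
Qed.

End ChannelLaw.

(** * Converse *)

Section Averages.
Variables (R : realType) (M : nat).
Hypothesis M0 : (0 < M)%N.
Implicit Types F G : 'I_M -> seq bool -> R.

Definition avg i F : R := M%:R^-1 * \sum_(m < M) \sum_(z : i.-tuple bool) F m z.

Lemma avg_eq i F G : (forall m (z : seq bool), size z = i -> F m z = G m z) ->
  avg i F = avg i G.
Proof.
move=> FG; congr (_ * _); apply: eq_bigr => m _; apply: eq_bigr => z _.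
by rewrite FG// size_tuple.
Qed.

Lemma avg_le i F G : (forall m (z : seq bool), size z = i -> F m z <= G m z) ->
  avg i F <= avg i G.
Proof.
move=> FG; rewrite ler_wpM2l ?invr_ge0//.
by apply: ler_sum => m _; apply: ler_sum => z _; rewrite FG// size_tuple.
Qed.

Lemma avg_ge0 i F : (forall m z, 0 <= F m z) -> 0 <= avg i F.
Proof.
move=> F0; rewrite mulr_ge0 ?invr_ge0//.
by apply: sumr_ge0 => m _; apply: sumr_ge0 => z _.
Qed.

Lemma avgD i F G : avg i (fun m z => F m z + G m z) = avg i F + avg i G.
Proof.
rewrite -mulrDr -big_split; congr (_ * _); apply: eq_bigr => m _.
by rewrite -big_split.
Qed.

Lemma avgB i F G : avg i (fun m z => F m z - G m z) = avg i F - avg i G.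
Proof.
rewrite -mulrBr -sumrB; congr (_ * _); apply: eq_bigr => m _.
by rewrite -sumrB.
Qed.

Lemma avgZr i F (a : R) : avg i (fun m z => F m z * a) = avg i F * a.
Proof.
rewrite -mulrA mulr_suml; congr (_ * _); apply: eq_bigr => m _.
by rewrite mulr_suml.
Qed.

Lemma avg_sum i (I : finType) (F : I -> 'I_M -> seq bool -> R) :
  avg i (fun m z => \sum_k F k m z) = \sum_k avg i (F k).
Proof.
rewrite -mulr_sumr; congr (_ * _); rewrite [RHS]exchange_big; apply: eq_bigr => m _.
by rewrite [RHS]exchange_big.
Qed.

Lemma avgS i F : avg i.+1 F = avg i (fun m z => F m (true :: z) + F m (false :: z)).
Proof.
congr (_ * _); apply: eq_bigr => m _; rewrite sum_tuple_cons big_bool -big_split.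
by [].
Qed.

Lemma avg0 F : avg 0 F = M%:R^-1 * \sum_(m < M) F m [::].
Proof. by congr (_ * _); apply: eq_bigr => m _; rewrite sum_tuple0. Qed.

Lemma avg_const (G : seq bool -> R) i :
  avg i (fun _ z => G z) = \sum_(z : i.-tuple bool) G z.
Proof.
rewrite /avg sumr_const card_ord -[X in _ * X]mulr_natl mulrA mulVf ?mul1r//.
by rewrite pnatr_eq0 -lt0n.
Qed.

Lemma avg_gt0 i F m (z : seq bool) : (forall m z, 0 <= F m z) -> size z = i ->
  0 < F m z -> 0 < avg i F.
Proof.
move=> F0 szz Fz; rewrite mulr_gt0 ?invr_gt0 ?ltr0n//.
rewrite (bigD1 m)//= ltr_wpDr//.
  by apply: sumr_ge0 => ? _; apply: sumr_ge0.
rewrite (bigD1 (Tuple (introT eqP szz)))//= ltr_wpDr//.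
by apply: sumr_ge0.
Qed.

End Averages.

(** * Replacing an encoder by one that ignores its battery *)

Section PrefixMeasure.
Variables (R : realType) (eta : R).
Hypothesis eta01 : 0 <= eta <= 1.

Fixpoint zeros (z : seq bool) : nat := if z is false :: z' then (zeros z').+1 else 0.

(* [P z] is the probability of the reversed output prefix [z] and [Z z] that of
   this prefix together with an empty battery. *)
Record prefix_measure (P Z : seq bool -> R) : Prop := PrefixMeasure {
  pm_nil : P [::] = 1;
  pm_empty_nil : Z [::] = etab eta;
  pm_split : forall z, P (true :: z) + P (false :: z) = P z;
  pm_pulse_ge0 : forall z, 0 <= P (true :: z);
  pm_pulse_le : forall z, P (true :: z) <= P z - Z z;
  pm_empty_ge0 : forall z, 0 <= Z z;
  pm_empty_silent : forall z, Z (false :: z) = etab eta * Z z;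
  pm_empty_pulse : forall z, Z (true :: z) = etab eta * P (true :: z) }.

Variables P Z : seq bool -> R.
Hypothesis PZ : prefix_measure P Z.

(* An encoder that transmits with probability [attempt_prob z] whenever its
   battery is charged has the same output law; [weight z u] is the probability
   of [z] together with a last attempt [u + 1] slots ago. *)
Definition attempt_prob z := P (true :: z) / (P z - Z z).

Fixpoint weight (z : seq bool) (u : nat) : R :=
  match z, u with
  | [::], _ => (u == 0%N)%:R
  | true :: _, _ => (u == 0%N)%:R * P z
  | false :: z', 0%N => attempt_prob z' * Z z'
  | false :: z', u'.+1 => (1 - attempt_prob z') * weight z' u'
  end.

Lemma pm_ge0 z : 0 <= P z.
Proof.
have := pm_pulse_ge0 PZ z; have := pm_pulse_le PZ z; have := pm_empty_ge0 PZ z; lra.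
Qed.

Lemma attempt_probE z : attempt_prob z * (P z - Z z) = P (true :: z).
Proof.
rewrite /attempt_prob; have [e|ne] := eqVneq (P z - Z z) 0; last by rewrite divfK.
by rewrite e mulr0; have := pm_pulse_ge0 PZ z; have := pm_pulse_le PZ z; lra.
Qed.

Lemma attempt_prob_ge0 z : 0 <= attempt_prob z.
Proof.
rewrite divr_ge0 ?(pm_pulse_ge0 PZ)//.
by have := pm_pulse_ge0 PZ z; have := pm_pulse_le PZ z; lra.
Qed.

Lemma attempt_prob_le1 z : attempt_prob z <= 1.
Proof.
rewrite /attempt_prob; have [e|ne] := eqVneq (P z - Z z) 0.
  by rewrite e invr0 mulr0.
have h1 := pm_pulse_ge0 PZ z; have h2 := pm_pulse_le PZ z.
by rewrite ler_pdivrMr ?mul1r// lt_neqAle eq_sym ne (le_trans h1 h2).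
Qed.

Lemma weight_ge0 z u : 0 <= weight z u.
Proof.
elim: z u => [|[] z IH] u //=; first by rewrite mulr_ge0 ?(pm_pulse_ge0 PZ).
case: u => [|u]; first by rewrite mulr_ge0 ?attempt_prob_ge0 ?(pm_empty_ge0 PZ).
by rewrite mulr_ge0 ?IH// subr_ge0 attempt_prob_le1.
Qed.

Lemma weight_supp z u : (zeros z < u)%N -> weight z u = 0.
Proof.
elim: z u => [|[] z IH] u /= zu; first by rewrite gtn_eqF.
  by rewrite gtn_eqF// mul0r.
by case: u zu => // u zu; rewrite IH ?mulr0.
Qed.

(** The randomised encoder reproduces the law of the prefix and of the empty battery together:
    silence multiplies the empty part by [etab eta] whether or not an attempt failed, and a pulse
    resets it. *)
Lemma weight_sums K z : (zeros z < K)%N ->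
  \sum_(u < K) weight z u = P z /\
  \sum_(u < K) weight z u * empty_prob eta u = Z z.
Proof.
elim: z K => [|[] z IH] [|K] //= zK.
- rewrite !big_ord_recl !big1 /= ?(pm_nil PZ) ?(pm_empty_nil PZ) /empty_prob ?expr1; try by move=> u _; rewrite ?mul0r.
  by rewrite !addr0 mul1r.
- rewrite !big_ord_recl !big1 /=; try by move=> u _; rewrite ?mul0r.
  by rewrite !addr0 !mul1r (pm_empty_pulse PZ) /empty_prob expr1 mulrC.
- have [IH1 IH2] := IH K zK; rewrite !big_ord_recl /=; split.
    rewrite -mulr_sumr IH1 -[P (false :: z)](addKr (P (true :: z))) (pm_split PZ).
    by rewrite -attempt_probE; ring.
  rewrite (eq_bigr (fun u : 'I_K => etab eta * (1 - attempt_prob z) * (weight z u * empty_prob eta u))).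
    by rewrite -mulr_sumr IH2 (pm_empty_silent PZ) /empty_prob expr1; ring.
  by move=> u _; rewrite /empty_prob /bump /= add1n exprS; ring.
Qed.

(** Superadditivity bounds the noise of all attempts by the entropy of pulses against failed
    attempts, and the failed attempts are part of the silences. *)
Lemma weight_entropy K z : (zeros z < K)%N ->
  \sum_(u < K) attempt_prob z * weight z u * hent (1 - empty_prob eta u) (empty_prob eta u)
  <= hent (P (true :: z)) (P (false :: z)).
Proof.
move=> zK; have [s1 s2] := weight_sums zK.
have a0 u : 0 <= attempt_prob z * weight z u by rewrite mulr_ge0 ?attempt_prob_ge0 ?weight_ge0.
have e0 u : 0 <= empty_prob eta u := empty_prob_ge0 eta01 u.
have e1 u : 0 <= 1 - empty_prob eta u by rewrite subr_ge0 empty_prob_le1.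
under eq_bigr => u _ do rewrite -hentZ//.
apply: le_trans (hent_sum _ _) _; [by move=> u _; rewrite mulr_ge0..|].
have -> : \sum_(u < K) attempt_prob z * weight z u * (1 - empty_prob eta u) = P (true :: z).
  rewrite -attempt_probE -s1 -s2 -sumrB mulr_sumr.
  by apply: eq_bigr => u _; ring.
have -> : \sum_(u < K) attempt_prob z * weight z u * empty_prob eta u = attempt_prob z * Z z.
  by rewrite -s2 mulr_sumr; apply: eq_bigr => u _; ring.
apply: hent_mono; first exact: (pm_pulse_ge0 PZ).
  by rewrite mulr_ge0 ?attempt_prob_ge0 ?(pm_empty_ge0 PZ).
have : attempt_prob z * Z z <= Z z by rewrite ler_piMl ?attempt_prob_le1 ?(pm_empty_ge0 PZ).
have := pm_pulse_le PZ z; have := pm_split PZ z; lra.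
Qed.

End PrefixMeasure.

(** * The circulation of a code and its divergence from a reference law *)

Section CodeFlow.
Variables (R : realType) (eta : R).
Hypothesis eta01 : 0 <= eta <= 1.
Variable N : nat.
Hypothesis N0 : (0 < N)%N.
Variable M : nat.
Hypothesis M0 : (0 < M)%N.
Variables P Z : 'I_M -> seq bool -> R.
Hypothesis PZ : forall m, prefix_measure eta (P m) (Z m).
Variable n : nat.

Let pulse m z := P m (true :: z).
Let silence m z := P m (false :: z).
Let kappa m z := attempt_prob (P m) (Z m) z.
Let wt m z u := weight (P m) (Z m) z u.

Let P_ge0 m z : 0 <= P m z. Proof. exact: (pm_ge0 (PZ m)). Qed.

Definition code_visits i u q : R := avg i (fun m z => (zeros z == q)%:R * wt m z u).

Definition code_attempts i u q : R :=
  avg i (fun m z => (zeros z == q)%:R * (kappa m z * wt m z u)).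

Definition attempts u q : R := if (q < N)%N then \sum_(i < n) code_attempts i u q else 0.

Definition pulses i q : R := avg i (fun m z => (zeros z == q)%:R * pulse m z).

Definition total_pulses : R := \sum_(i < n) avg i pulse.

(* Conservation of flow determines the visits from the attempts. Starting from
   one more cycle than there are pulses closes the unfinished last cycle, which
   runs silently up to level [N]. *)
Fixpoint visits (u q : nat) : R :=
  match q, u with
  | 0, _ => (u == 0%N)%:R * (1 + total_pulses)
  | q'.+1, 0 => \sum_(w < N.+1) attempts w q' * empty_prob eta w
  | q'.+1, u'.+1 => visits u' q' - attempts u' q'
  end.

(** All levels from [N] on are merged into the top one; the 1 is the single top slot of the
    completing cycle. *)
Definition stay : R :=
  1 + \sum_(i < n) avg i (fun m z => (N <= zeros z)%:R * P m z).

Lemma code_attempts_ge0 i u q : 0 <= code_attempts i u q.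
Proof.
apply: avg_ge0 => m z; rewrite mulr_ge0// mulr_ge0 ?(weight_ge0 (PZ m))//.
exact: (attempt_prob_ge0 (PZ m)).
Qed.

Lemma attempts_ge0 u q : 0 <= attempts u q.
Proof.
by rewrite /attempts; case: ifP => // _; apply: sumr_ge0 => i _; apply: code_attempts_ge0.
Qed.

Lemma code_attempts_le i u q : code_attempts i u q <= code_visits i u q.
Proof.
apply: avg_le => m z _; rewrite ler_wpM2l// ler_piMl ?(weight_ge0 (PZ m))//.
exact: (attempt_prob_le1 (PZ m)).
Qed.

Lemma code_visits_ge0 i u q : 0 <= code_visits i u q.
Proof. exact: le_trans (code_attempts_ge0 _ _ _) (code_attempts_le _ _ _). Qed.

Lemma code_visits_supp i u q : (q < u)%N -> code_visits i u q = 0.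
Proof.
move=> qu; rewrite /code_visits (@avg_eq _ _ _ _ (fun _ _ => 0)).
  by rewrite /avg big1 ?mulr0// => m _; apply: big1.
move=> m z _; case: eqP => [zq|_]; last by rewrite mul0r.
by rewrite /wt weight_supp ?mulr0// zq.
Qed.

Lemma attempts_supp u q : (q < u)%N -> attempts u q = 0.
Proof.
move=> qu; rewrite /attempts; case: ifP => // _; apply: big1 => i _.
by have := code_attempts_ge0 i u q; have := code_attempts_le i u q; rewrite code_visits_supp//; lra.
Qed.

Lemma code_visits_silent i u q :
  code_visits i.+1 u.+1 q.+1 = code_visits i u q - code_attempts i u q.
Proof.
rewrite /code_visits avgS -avgB; apply: avg_eq => m z _.
by rewrite /= eqSS /wt /kappa /= mul0r add0r; ring.
Qed.

Lemma sum_attempts_empty i q : (q <= N)%N ->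
  \sum_(w < N.+1) code_attempts i w q * empty_prob eta w
  = avg i (fun m z => (zeros z == q)%:R * (kappa m z * Z m z)).
Proof.
move=> qN; under eq_bigr do rewrite -avgZr; rewrite -avg_sum; apply: avg_eq => m z _.
case: eqP => [zq|_]; last by rewrite mul0r big1// => w _; rewrite !mul0r.
have zN : (zeros z < N.+1)%N by rewrite zq ltnS.
have [_ <-] := weight_sums (PZ m) zN.
by rewrite mul1r mulr_sumr; apply: eq_bigr => w _; rewrite mul1r mulrA.
Qed.

Lemma sum_attempts_charged i q : (q <= N)%N ->
  \sum_(w < N.+1) code_attempts i w q * (1 - empty_prob eta w) = pulses i q.
Proof.
move=> qN; under eq_bigr do rewrite -avgZr; rewrite -avg_sum; apply: avg_eq => m z _.
case: eqP => [zq|_]; last by rewrite mul0r big1// => w _; rewrite !mul0r.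
have zN : (zeros z < N.+1)%N by rewrite zq ltnS.
rewrite mul1r /pulse -(attempt_probE (PZ m)) -/(kappa m z).
have [<- <-] := weight_sums (PZ m) zN.
by rewrite -sumrB mulr_sumr; apply: eq_bigr => w _; rewrite /wt mul1r; ring.
Qed.

Lemma code_visits_failed i q : (q <= N)%N -> code_visits i.+1 0%N q.+1 =
  \sum_(w < N.+1) code_attempts i w q * empty_prob eta w.
Proof.
move=> qN; rewrite sum_attempts_empty// /code_visits avgS; apply: avg_eq => m z _.
by rewrite /= eqSS /wt /kappa /= mul0r add0r; ring.
Qed.

Lemma code_visits_level0 i : code_visits i.+1 0%N 0%N = avg i pulse.
Proof.
by rewrite /code_visits avgS; apply: avg_eq => m z _; rewrite /wt /= mul0r addr0 !mul1r.
Qed.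

Lemma avg_nil (F : 'I_M -> seq bool -> R) c : (forall m, F m [::] = c) -> avg 0 F = c.
Proof.
move=> Fc; rewrite avg0 (eq_bigr (fun=> c))// sumr_const card_ord.
by rewrite -[X in _ * X]mulr_natl mulrA mulVf ?mul1r// pnatr_eq0 -lt0n.
Qed.

Lemma code_visits_start u q : code_visits 0 u q = ((q == 0%N) && (u == 0%N))%:R.
Proof.
by apply: avg_nil => m; rewrite /wt /= eq_sym -natrM mulnb.
Qed.

Lemma sum_shift (F : nat -> R) :
  \sum_(i < n) F i = F 0%N + \sum_(i < n) F i.+1 - F n.
Proof.
elim: n => [|k IH]; first by rewrite !big_ord0 addr0 subrr.
by rewrite !big_ord_recr /=; lra.
Qed.

(** A shift of time by one slot turns the sum into the inflow minus the visits at time [n];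
    discarding the latter leaves the recursion of [visits]. *)
Lemma code_visits_le u q : (q <= N)%N -> \sum_(i < n) code_visits i u q <= visits u q.
Proof.
elim: q u => [|q IH] u qN.
  case: u => [|u]; last by rewrite /= mul0r big1// => i _; rewrite code_visits_supp.
  rewrite /= mul1r (sum_shift (fun i => code_visits i 0%N 0%N)).
  rewrite code_visits_start /= lerBlDr ler_wpDr ?code_visits_ge0// lerD2l.
  by apply: ler_sum => i _; rewrite code_visits_level0.
rewrite (sum_shift (fun i => code_visits i u q.+1)).
rewrite code_visits_start /= add0r lerBlDr ler_wpDr ?code_visits_ge0//.
case: u => [|u] /=; last first.
  under eq_bigr do rewrite code_visits_silent.
  rewrite sumrB /attempts qN lerD2r; apply: IH; exact: ltnW.
rewrite (eq_bigr _ (fun (i : 'I_n) _ => code_visits_failed i (ltnW qN))) exchange_big /=.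
by apply: ler_sum => w _; rewrite /attempts qN mulr_suml.
Qed.

Lemma total_pulses_ge0 : 0 <= total_pulses.
Proof.
by apply: sumr_ge0 => i _; apply: avg_ge0 => m z; apply: (pm_pulse_ge0 (PZ m)).
Qed.

Lemma attempts_le u q : attempts u q <= visits u q.
Proof.
have [qN|qN] := ltnP q N.
  apply: le_trans (code_visits_le u (ltnW qN)); rewrite /attempts qN.
  by apply: ler_sum => i _; apply: code_attempts_le.
rewrite {1}/attempts ltnNge qN /=.
elim: q u {qN} => [|q IH] [|u] /=.
- by rewrite mul1r addr_ge0 ?total_pulses_ge0.
- by rewrite mul0r.
- by apply: sumr_ge0 => w _; rewrite mulr_ge0 ?attempts_ge0 ?(empty_prob_ge0 eta01).
rewrite subr_ge0; have [qN|qN] := ltnP q N; last by rewrite /attempts ltnNge qN /= IH.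
apply: le_trans (code_visits_le u (ltnW qN)); rewrite /attempts qN.
by apply: ler_sum => i _; apply: code_attempts_le.
Qed.

Lemma visits_supp u q : (q < u)%N -> visits u q = 0.
Proof.
elim: q u => [|q IH] [|u] //= qu; first by rewrite mul0r.
by rewrite IH// attempts_supp// subrr.
Qed.

Lemma level_emission_pulses q : (q < N)%N ->
  level_emission eta N attempts q = \sum_(i < n) pulses i q.
Proof.
move=> qN; rewrite /level_emission /attempts qN.
under eq_bigr do rewrite mulr_suml; rewrite exchange_big /=.
by apply: eq_bigr => i _; rewrite sum_attempts_charged// ltnW.
Qed.

(** Of the [1 + total_pulses] cycles those with a pulse below [N] drop out; the completing cycle and
    those with a later pulse remain. *)
Lemma level_visits_top : level_visits N visits N
  = 1 + \sum_(i < n) avg i (fun m z => (N <= zeros z)%:R * pulse m z).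
Proof.
have := total_emission attempts_ge0 attempts_le visits_supp
  (fun u q _ => erefl) (fun q _ => erefl).
rewrite /= mul1r => e; apply/eqP; rewrite -subr_eq0; apply/eqP.
have : \sum_(q < N) level_emission eta N attempts q
    + \sum_(i < n) avg i (fun m z => (N <= zeros z)%:R * pulse m z) = total_pulses.
  rewrite (eq_bigr _ (fun (q : 'I_N) _ => level_emission_pulses (ltn_ord q))).
  rewrite exchange_big -big_split; apply: eq_bigr => i _ /=.
  rewrite -avg_sum -avgD; apply: avg_eq => m z _.
  rewrite -mulr_suml -mulrDl -[RHS]mul1r; congr (_ * _).
  have [zN|zN] := leqP N (zeros z).
    by rewrite big1 ?add0r// => q _; rewrite gtn_eqF// (leq_trans (ltn_ord q)).
  rewrite addr0 (bigD1 (Ordinal zN))//= eqxx big1 ?addr0// => q.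
  by rewrite -val_eqE /= eq_sym => /negPf ->.
by lra.
Qed.

Definition code_level i q : R := avg i (fun m z => (zeros z == q)%:R * P m z).

Lemma code_level_ge0 i q : 0 <= code_level i q.
Proof. by apply: avg_ge0 => m z; rewrite mulr_ge0. Qed.

Lemma code_level_silent i q : code_level i.+1 q.+1 = code_level i q - pulses i q.
Proof.
rewrite /code_level avgS -avgB; apply: avg_eq => m z _ /=.
by rewrite eqSS mul0r add0r -(pm_split (PZ m) z) /pulse; ring.
Qed.

Lemma code_level0 i : code_level i.+1 0 = avg i pulse.
Proof. by rewrite /code_level avgS; apply: avg_eq => m z _ /=; rewrite mul0r addr0 mul1r. Qed.

Lemma avg_P i : avg i P = 1.
Proof.
elim: i => [|i IH]; first by apply: avg_nil => m; apply: (pm_nil (PZ m)).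
by rewrite avgS -[RHS]IH; apply: avg_eq => m z _; rewrite (pm_split (PZ m)).
Qed.

(** The second sum is due to the completing cycle, which passes through level [q] exactly when the
    code stops at a level at most [q]. *)
Lemma level_visits_code q : (q < N)%N -> level_visits N visits q
  = \sum_(i < n) code_level i q + \sum_(k < q.+1) code_level n k.
Proof.
elim: q => [|q IH] qN.
  rewrite big_ord_recl big_ord0 addr0 (sum_shift (fun i => code_level i 0)) subrK.
  have -> : code_level 0 0 = 1.
    by apply: avg_nil => m; rewrite mul1r (pm_nil (PZ m)).
  rewrite (eq_bigr (fun i : 'I_n => avg i pulse)) => [|i _]; last exact: code_level0.
  rewrite -/total_pulses /level_visits big_ord_recl /= mul1r big1 ?addr0// => u _.
  by rewrite /bump /= mul0r.
rewrite (level_visits_succ attempts_ge0 attempts_le visits_supp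
  (fun u q _ => erefl) (fun q _ => erefl)) 1?ltnW// IH 1?ltnW//.
rewrite level_emission_pulses 1?ltnW// [in RHS]big_ord_recr /= [RHS]addrCA [RHS]addrC.
rewrite (sum_shift (fun i => code_level i q.+1)) subrK.
have -> : code_level 0 q.+1 = 0 by apply: avg_nil => m; rewrite mul0r.
rewrite (eq_bigr _ (fun (i : 'I_n) _ => code_level_silent i q)) sumrB.
by ring.
Qed.

Lemma level_visits_le q : (q < N)%N ->
  level_visits N visits q <= \sum_(i < n) code_level i q + 1.
Proof.
move=> qN; rewrite level_visits_code// lerD2l -(avg_P n) -avg_sum.
apply: avg_le => m z _; rewrite -mulr_suml ler_piMl//.
have [zq|zq] := ltnP (zeros z) q.+1.
  by rewrite (bigD1 (Ordinal zq))//= eqxx big1 ?addr0// => k; rewrite -val_eqE /= eq_sym => /negPf ->.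
by rewrite big1// => k _; rewrite gtn_eqF// (leq_trans (ltn_ord k)).
Qed.

Lemma level_visits_ge q : (q < N)%N -> \sum_(i < n) code_level i q <= level_visits N visits q.
Proof.
by move=> qN; rewrite level_visits_code// lerDl sumr_ge0// => k _; apply: code_level_ge0.
Qed.

(** The code takes [n] slots, the completing cycle at most one per level below [N] and one at the
    top. *)
Lemma flow_length : \sum_(q < N) level_visits N visits q + stay <= n%:R + N%:R + 1.
Proof.
apply: le_trans (_ : \sum_(q < N) (\sum_(i < n) code_level i q + 1) + stay <= _).
  by rewrite lerD2r; apply: ler_sum => q _; apply: level_visits_le.
rewrite big_split /= sumr_const card_ord exchange_big /= /stay.
have -> : \sum_(i < n) \sum_(q < N) code_level i q + N%:R
   + (1 + \sum_(i < n) avg i (fun m z => (N <= zeros z)%:R * P m z))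
   = \sum_(i < n) (\sum_(q < N) code_level i q + avg i (fun m z => (N <= zeros z)%:R * P m z)) + N%:R + 1.
  by rewrite big_split /=; ring.
rewrite !lerD2r (eq_bigr (fun=> 1)) ?sumr_const ?card_ord// => i _.
rewrite -avg_sum -avgD -[RHS](avg_P i); apply: avg_eq => m z _.
rewrite -mulr_suml -mulrDl -[RHS]mul1r; congr (_ * _).
have [zN|zN] := leqP N (zeros z).
  by rewrite big1 ?add0r// => q _; rewrite gtn_eqF// (leq_trans (ltn_ord q)).
rewrite addr0 (bigD1 (Ordinal zN))//= eqxx big1 ?addr0// => q.
by rewrite -val_eqE /= eq_sym => /negPf ->.
Qed.

Let lev z := minn (zeros z) N.
Let EE q : R := if (q < N)%N then level_emission eta N attempts q else level_visits N visits N.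
Let VV q : R := if (q < N)%N then level_visits N visits q else stay.

Definition output_kernel (x : bool) (q : nat) : R :=
  (if x then EE q else VV q - EE q) / VV q.

(** Outputs drawn as the circulation predicts from the level alone, by the same law for all
    messages. Its total mass may fall below 1, because the kernel is null at a level without
    visits. *)
Fixpoint reference (z : seq bool) : R :=
  if z is x :: z' then reference z' * output_kernel x (lev z') else 1.

Lemma pulse_le_P m z : pulse m z <= P m z.
Proof.
by have := pm_pulse_le (PZ m) z; have := pm_empty_ge0 (PZ m) z; rewrite /pulse; lra.
Qed.

Lemma silence_ge0 m z : 0 <= silence m z.
Proof.
by have := pulse_le_P m z; have := pm_split (PZ m) z; rewrite /pulse /silence; lra.
Qed.

Lemma pulse_ge0 m z : 0 <= pulse m z.
Proof. exact: (pm_pulse_ge0 (PZ m)). Qed.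

Lemma level_visits_top_gt0 : 0 < level_visits N visits N.
Proof.
rewrite level_visits_top ltr_wpDr// sumr_ge0// => i _; apply: avg_ge0 => m z.
by rewrite mulr_ge0 ?pulse_ge0.
Qed.

Lemma level_visits_top_le : level_visits N visits N <= stay.
Proof.
rewrite level_visits_top lerD2l; apply: ler_sum => i _; apply: avg_le => m z _.
by rewrite ler_wpM2l// pulse_le_P.
Qed.

Let EE_ge0 q : 0 <= EE q.
Proof.
rewrite /EE; case: ifP => _; last exact: ltW level_visits_top_gt0.
by apply: sumr_ge0 => u _; rewrite mulr_ge0 ?attempts_ge0// subr_ge0 empty_prob_le1.
Qed.

Let EE_le q : EE q <= VV q.
Proof.
rewrite /EE /VV; case: ifP => _; last exact: level_visits_top_le.
apply: ler_sum => u _; apply: le_trans (attempts_le u q).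
by rewrite ler_piMr ?attempts_ge0// gerBl empty_prob_ge0.
Qed.

Let VV_ge0 q : 0 <= VV q. Proof. exact: le_trans (EE_ge0 q) (EE_le q). Qed.

Lemma output_kernel_ge0 x q : 0 <= output_kernel x q.
Proof. by rewrite divr_ge0//; case: x => //; rewrite subr_ge0. Qed.

Lemma output_kernel_sum q : output_kernel true q + output_kernel false q <= 1.
Proof.
rewrite -mulrDl subrKC; have [->|v0] := eqVneq (VV q) 0; first by rewrite mul0r.
by rewrite divff.
Qed.

Lemma output_kernel_le1 x q : output_kernel x q <= 1.
Proof.
have := output_kernel_sum q; have := output_kernel_ge0 true q.
by have := output_kernel_ge0 false q; case: x; lra.
Qed.

Lemma reference_ge0 z : 0 <= reference z.
Proof. by elim: z => //= x z IH; rewrite mulr_ge0// output_kernel_ge0. Qed.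

Lemma reference_sum i : \sum_(z : i.-tuple bool) reference z <= 1.
Proof.
elim: i => [|i IH]; first by rewrite sum_tuple0.
apply: le_trans IH; rewrite sum_tuple_cons big_bool -big_split /=.
apply: ler_sum => z _; rewrite -mulrDr ler_piMr ?reference_ge0//.
exact: output_kernel_sum.
Qed.

Let levE z q : (q < N)%N -> (lev z == q) = (zeros z == q).
Proof.
move=> qN; rewrite /lev; have [zN|zN] := leqP (zeros z) N => //.
by rewrite gtn_eqF// gtn_eqF// (ltn_trans qN).
Qed.

Let levN z : (lev z == N) = (N <= zeros z)%N.
Proof. by rewrite /lev; lia. Qed.

Definition level_pulses q := \sum_(i < n) avg i (fun m z => (lev z == q)%:R * pulse m z).
Definition level_silences q := \sum_(i < n) avg i (fun m z => (lev z == q)%:R * silence m z).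

Lemma level_pulses_le q : (q <= N)%N -> level_pulses q <= EE q.
Proof.
rewrite leq_eqVlt => /predU1P[->|qN].
  rewrite /EE ltnn level_visits_top; apply: le_trans (_ : level_pulses N <= _) _ => //.
  rewrite /level_pulses -[leLHS]add0r lerD//; apply: ler_sum => i _.
  by apply: avg_le => m z _; rewrite levN.
rewrite /EE qN level_emission_pulses//; apply: ler_sum => i _.
by apply: avg_le => m z _; rewrite levE.
Qed.

Lemma level_silences_le q : (q <= N)%N -> level_silences q <= VV q - EE q.
Proof.
rewrite leq_eqVlt => /predU1P[->|qN].
  rewrite /EE /VV ltnn level_visits_top /stay /level_silences.
  rewrite [leRHS](_ : _ = \sum_(i < n) (avg i (fun m z => (N <= zeros z)%:R * P m z)
     - avg i (fun m z => (N <= zeros z)%:R * pulse m z))); last first.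
    by rewrite sumrB; ring.
  apply: ler_sum => i _; rewrite -avgB; apply: avg_le => m z _.
  by rewrite levN -mulrBr -(pm_split (PZ m) z) /pulse /silence addrC addKr.
rewrite /EE /VV qN; apply: le_trans (_ : \sum_(i < n) code_level i q - level_emission eta N attempts q <= _).
  rewrite level_emission_pulses// -sumrB; apply: ler_sum => i _.
  rewrite -avgB; apply: avg_le => m z _.
  by rewrite levE// -mulrBr -(pm_split (PZ m) z) /pulse /silence addrC addKr.
by rewrite lerD2r level_visits_ge.
Qed.

Lemma output_kernel_gt0 x q : 0 < (if x then EE q else VV q - EE q) -> 0 < output_kernel x q.
Proof.
move=> h; rewrite divr_gt0//; case: x h => h; first exact: lt_le_trans h (EE_le q).
by have := EE_ge0 q; lra.
Qed.

Lemma P_cons_gt0 m x z : 0 < P m (x :: z) -> 0 < P m z.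
Proof.
have := pm_split (PZ m) z; have := pulse_ge0 m z; have := silence_ge0 m z.
by rewrite /pulse /silence; case: x; lra.
Qed.

(** A possible prefix contributes to the averaged count of its level, and this count is part of the
    flow. So the reference law dominates every message. *)
Lemma output_kernel_support m x z : (size z < n)%N -> 0 < P m (x :: z) ->
  0 < output_kernel x (lev z).
Proof.
move=> zn Px; have levz : (lev z <= N)%N by rewrite geq_minr.
apply: output_kernel_gt0; case: x Px => Px.
  apply: lt_le_trans (level_pulses_le levz); rewrite /level_pulses (bigD1 (Ordinal zn))//=.
  rewrite ltr_wpDr//; last by apply: (avg_gt0 M0 (m := m) (z := z)) => [? ?||]; rewrite ?eqxx ?mul1r ?mulr_ge0 ?pulse_ge0.
  by apply: sumr_ge0 => i _; apply: avg_ge0 => ? ?; rewrite mulr_ge0 ?pulse_ge0.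
apply: lt_le_trans (level_silences_le levz); rewrite /level_silences (bigD1 (Ordinal zn))//=.
rewrite ltr_wpDr//; last by apply: (avg_gt0 M0 (m := m) (z := z)) => [? ?||]; rewrite ?eqxx ?mul1r ?mulr_ge0 ?silence_ge0.
by apply: sumr_ge0 => i _; apply: avg_ge0 => ? ?; rewrite mulr_ge0 ?silence_ge0.
Qed.

Lemma reference_gt0 m z : (size z <= n)%N -> 0 < P m z -> 0 < reference z.
Proof.
elim: z => //= x z IH zn Px; rewrite mulr_gt0 ?(output_kernel_support zn Px)//.
by apply: IH; rewrite ?(ltnW zn)// (P_cons_gt0 Px).
Qed.

(** An upper bound on the mutual information, in nats, between the message and the first [i] outputs
    after the silent slot, for [i] up to [n]. *)
Definition divergence i := avg i (fun m z => P m z * (ln (P m z) - ln (reference z))).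

Lemma ln_reference m x z : (size z < n)%N ->
  P m (x :: z) * ln (reference (x :: z))
  = P m (x :: z) * (ln (reference z) + ln (output_kernel x (lev z))).
Proof.
move=> zn; have [->|Px] := eqVneq (P m (x :: z)) 0; first by rewrite !mul0r.
have {}Px : 0 < P m (x :: z) by rewrite lt_neqAle eq_sym Px P_ge0.
rewrite /= lnM ?posrE ?(output_kernel_support zn Px)//.
by rewrite (@reference_gt0 m) ?(ltnW zn)// (P_cons_gt0 Px).
Qed.

Lemma divergenceS i : (i < n)%N -> divergence i.+1 = divergence i
  - avg i (fun m z => hent (pulse m z) (silence m z))
  - avg i (fun m z => pulse m z * ln (output_kernel true (lev z))
                    + silence m z * ln (output_kernel false (lev z))).
Proof.
move=> iN; rewrite /divergence avgS -!avgB; apply: avg_eq => m z zi.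
have zn : (size z < n)%N by rewrite zi.
rewrite !mulrBr !ln_reference// /hent -/(pulse m z) -/(silence m z).
have -> : P m z = pulse m z + silence m z by rewrite /pulse /silence (pm_split (PZ m)).
ring.
Qed.

Lemma divergence0 : divergence 0 = 0.
Proof. by apply: avg_nil => m; rewrite (pm_nil (PZ m)) /= subrr mulr0. Qed.

Lemma divergenceE : divergence n
  = - \sum_(i < n) avg i (fun m z => hent (pulse m z) (silence m z))
    - \sum_(q < N.+1) (level_pulses q * ln (output_kernel true q)
                       + level_silences q * ln (output_kernel false q)).
Proof.
have -> : \sum_(q < N.+1) (level_pulses q * ln (output_kernel true q)
    + level_silences q * ln (output_kernel false q))
  = \sum_(i < n) avg i (fun m z => pulse m z * ln (output_kernel true (lev z))
                    + silence m z * ln (output_kernel false (lev z))).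
  under eq_bigr do rewrite !mulr_suml -big_split.
  rewrite exchange_big; apply: eq_bigr => i _ /=.
  under eq_bigr do rewrite -!avgZr -avgD.
  rewrite -avg_sum; apply: avg_eq => m z _.
  have levz : (lev z < N.+1)%N by rewrite ltnS geq_minr.
  rewrite (bigD1 (Ordinal levz))//= eqxx !mul1r big1 ?addr0// => q.
  by rewrite -val_eqE /= eq_sym => /negPf ->; rewrite !mul0r addr0.
have H k : (k <= n)%N -> divergence k
  = - \sum_(i < k) avg i (fun m z => hent (pulse m z) (silence m z))
    - \sum_(i < k) avg i (fun m z => pulse m z * ln (output_kernel true (lev z))
                    + silence m z * ln (output_kernel false (lev z))).
  elim: k => [|k IH] kn; first by rewrite divergence0 !big_ord0 oppr0 addr0.
  by rewrite divergenceS// IH 1?ltnW// !big_ord_recr /=; ring.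
exact: H.
Qed.

Lemma code_noise_le :
  \sum_(q < N) \sum_(u < N.+1) attempts u q * hent (1 - empty_prob eta u) (empty_prob eta u)
  <= \sum_(i < n) avg i (fun m z => hent (pulse m z) (silence m z)).
Proof.
have -> : \sum_(q < N) \sum_(u < N.+1) attempts u q * hent (1 - empty_prob eta u) (empty_prob eta u)
  = \sum_(i < n) avg i (fun m z => \sum_(q < N) \sum_(u < N.+1)
      (zeros z == q)%:R * (kappa m z * wt m z u) * hent (1 - empty_prob eta u) (empty_prob eta u)).
  under [RHS]eq_bigr do rewrite avg_sum; rewrite [RHS]exchange_big /=; apply: eq_bigr => q _.
  under [RHS]eq_bigr do rewrite avg_sum; rewrite [RHS]exchange_big /=; apply: eq_bigr => u _.
  rewrite /attempts ltn_ord mulr_suml; apply: eq_bigr => i _.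
  by rewrite -avgZr.
apply: ler_sum => i _; apply: avg_le => m z _.
have [zN|zN] := ltnP (zeros z) N; last first.
  rewrite big1 ?hent_ge0 ?pulse_ge0 ?silence_ge0// => q _; apply: big1 => u _.
  by rewrite gtn_eqF ?(leq_trans (ltn_ord q))// !mul0r.
rewrite (bigD1 (Ordinal zN))//= eqxx [X in _ + X]big1 ?addr0 => [|q]; last first.
  by rewrite -val_eqE /= eq_sym => /negPf ->; apply: big1 => u _; rewrite !mul0r.
under eq_bigr do rewrite mul1r.
by apply: (weight_entropy eta01 (PZ m)); rewrite ltnS ltnW.
Qed.

(** Minus the logarithm of a kernel value is nonnegative, so raising the counts of the code to those
    of the flow turns the cross entropy into the entropy of the flow. *)
Lemma level_cross_entropy q : (q <= N)%N ->
  - (level_pulses q * ln (output_kernel true q)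
     + level_silences q * ln (output_kernel false q)) <= hent (EE q) (VV q - EE q).
Proof.
move=> qN; rewrite hent_exact ?subr_ge0// subrKC lerN2 -/(output_kernel true q).
rewrite -[(VV q - EE q) / _]/(output_kernel false q).
have lnw x : ln (output_kernel x q) <= 0 by rewrite ln_le0// output_kernel_le1.
have h1 := level_pulses_le qN; have h0 := level_silences_le qN.
by rewrite lerD// ler_wnM2r.
Qed.

Lemma divergence_le : divergence n <= (n%:R + N%:R + 1) * b_N eta N * ln 2.
Proof.
have circ := circulation_le_b_N eta01 N0 attempts_ge0 attempts_le visits_supp
  (fun u q _ => erefl) (fun q _ => erefl) level_visits_top_gt0 level_visits_top_le.
have ln2 : 0 < ln 2 :> R by rewrite ln_gt0// ltr1n.
have b0 := b_N_ge0 eta N.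
apply: le_trans (_ : _ <= (\sum_(q < N) level_visits N visits q + stay) * b_N eta N * ln 2) _;
  last by rewrite ler_wpM2r ?(ltW ln2)// ler_wpM2r// flow_length.
apply: le_trans circ; rewrite divergenceE sumrB.
have := code_noise_le.
suff : - \sum_(q < N.+1) (level_pulses q * ln (output_kernel true q)
                       + level_silences q * ln (output_kernel false q))
  <= \sum_(q < N) hent (level_emission eta N attempts q)
       (level_visits N visits q - level_emission eta N attempts q)
     + hent (level_visits N visits N) (stay - level_visits N visits N) by lra.
rewrite -sumrN big_ord_recr /=; apply: lerD.
  apply: ler_sum => q _; apply: le_trans (level_cross_entropy (ltnW (ltn_ord q))) _.
  by rewrite /EE /VV ltn_ord.
by apply: le_trans (level_cross_entropy (leqnn N)) _; rewrite /EE /VV ltnn.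
Qed.

(* [P (ln P - ln W) >= P ln K + P - W K], with [K = M] where [dec] answers [m]
   and [K = 1] elsewhere. *)
Lemma fano (dec : seq bool -> 'I_M) :
  avg n (fun m z => (dec z == m)%:R * P m z) * ln M%:R - 1 <= divergence n.
Proof.
have Mr : 0 < M%:R :> R by rewrite ltr0n.
pose K m z : R := if dec z == m then M%:R else 1.
have K0 m z : 0 < K m z by rewrite /K; case: ifP.
have step m z : size z = n ->
    (dec z == m)%:R * P m z * ln M%:R + (P m z - reference z * K m z)
    <= P m z * (ln (P m z) - ln (reference z)).
  move=> zn; have -> : (dec z == m)%:R * P m z * ln M%:R = P m z * ln (K m z).
    by rewrite /K; case: eqP => _; rewrite ?ln1 /=; ring.
  have [->|Pz] := eqVneq (P m z) 0.
    by rewrite !mul0r add0r sub0r oppr_le0 mulr_ge0 ?reference_ge0// ltW.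
  have {}Pz : 0 < P m z by rewrite lt_neqAle eq_sym Pz P_ge0.
  have Wz : 0 < reference z by apply: reference_gt0 Pz; rewrite zn.
  have := ln_gibbs (ltW Pz) (mulr_gt0 Wz (K0 m z)).
  by rewrite lnM ?posrE//; lra.
apply: le_trans (avg_le step); rewrite avgD avgZr avgB lerD2l avg_P.
suff : avg n (fun m z => reference z * K m z) <= 2 by lra.
apply: le_trans (_ : avg n (fun m z => reference z + M%:R * ((dec z == m)%:R * reference z)) <= _).
  apply: avg_le => m z _; rewrite /K; case: eqP => _ /=; last by rewrite mul0r mulr0 addr0 mulr1.
  by rewrite mul1r mulrC lerDr reference_ge0.
rewrite avgD avg_const// (_ : 2 = 1 + 1)// lerD ?reference_sum//.
apply: le_trans (reference_sum n); rewrite le_eqVlt; apply/orP; left; apply/eqP.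
rewrite /avg exchange_big mulr_sumr; apply: eq_bigr => z _.
rewrite (bigD1 (dec z))//= eqxx mul1r big1 ?addr0 => [|m /negPf mz].
  by rewrite mulrA mulVf ?mul1r// gt_eqF.
by rewrite eq_sym mz mul0r mulr0.
Qed.

End CodeFlow.

(** * Prefix measures of an encoder *)

Section Encoder.
Variables (R : realType) (eta : R).
Hypothesis eta01 : 0 <= eta <= 1.
Variables (M : nat) (enc : encoder M).
Hypothesis enc_valid : valid_encoder enc.

Let act m hs hy := enc (size hy) m hs hy.

Let act_charged m s hs hy : last false hs = s -> size hs = size hy -> act m hs hy -> s.
Proof. by move=> <- sz; apply: enc_valid. Qed.

(** The leading [false] is the first slot, silent because the battery starts empty; a prefix [z]
    begins after it. *)
Let law (g : bool -> seq bool -> seq bool -> R) m z :=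
  expect eta (act m) g (false :: rev z) false [::] [::].

Definition prefix_prob := law (fun _ _ _ => 1).
Definition prefix_empty := law (fun s _ _ => (~~ s)%:R).

Let law_cons g m x z : law g m (x :: z) = law (fun s hs hy => if act m hs hy == x then
      \sum_(e : bool) recharge eta e *
        g (next_battery x s e) (rcons hs (next_battery x s e)) (rcons hy x)
    else 0) m z.
Proof. by rewrite /law rev_cons -rcons_cons expect_rcons. Qed.

Let law_le g1 g2 m z :
  (forall s hs hy, last false hs = s -> size hs = size hy -> g1 s hs hy <= g2 s hs hy) ->
  law g1 m z <= law g2 m z.
Proof. by move=> g12; apply: expect_le. Qed.

Let law_eq g1 g2 m z :
  (forall s hs hy, last false hs = s -> size hs = size hy -> g1 s hs hy = g2 s hs hy) ->
  law g1 m z = law g2 m z.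
Proof.
by move=> g12; apply/eqP; rewrite eq_le !law_le// => s hs hy h1 h2; rewrite g12.
Qed.

Let lawB g1 g2 (a b : R) m z : law (fun s hs hy => a * g1 s hs hy - b * g2 s hs hy) m z
  = a * law g1 m z - b * law g2 m z.
Proof. exact: expectB. Qed.

Let law_ge0 g m z : (forall s hs hy, 0 <= g s hs hy) -> 0 <= law g m z.
Proof.
move=> g0; have := lawB g g 0 0 m z; rewrite !mul0r subr0 => <-.
by apply: law_le => s hs hy _ _; rewrite !mul0r subr0.
Qed.

Let lawZ g a m z : law (fun s hs hy => a * g s hs hy) m z = a * law g m z.
Proof.
have := lawB g g a 0 m z; rewrite mul0r subr0 => <-.
by apply: law_eq => s hs hy _ _; rewrite mul0r subr0.
Qed.

Let recharge1 : recharge eta true + recharge eta false = 1.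
Proof. exact: recharge_sum. Qed.

Let act_start m : act m [::] [::] = false.
Proof. by apply/negP => h; have := @enc_valid 0%N m [::] [::] erefl erefl h. Qed.

Lemma prefix_measureP m : prefix_measure eta (prefix_prob m) (prefix_empty m).
Proof.
split.
- by rewrite /prefix_prob /law /= act_start eqxx big_bool /= !mulr1 recharge1.
- by rewrite /prefix_empty /law /= act_start eqxx big_bool /= mulr0 add0r mulr1.
- move=> z; rewrite /prefix_prob !law_cons -[law _ m z + _]opprK opprD -[X in - (- X - _)]mul1r.
  rewrite -[X in - (- _ - X)]mul1r.
  have -> (a b : R) : - (- (1 * a) - 1 * b) = 1 * a - (-1) * b by ring.
  rewrite -lawB; apply: law_eq => s hs hy _ _.
  by rewrite !big_bool; case: (act m hs hy) => /=; rewrite !mulr1 recharge1; ring.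
- move=> z; rewrite /prefix_prob law_cons; apply: law_ge0 => s hs hy.
  by case: ifP => // _; rewrite big_bool /= !mulr1 recharge1.
- move=> z; rewrite /prefix_prob /prefix_empty law_cons -[X in X - _]mul1r -[X in _ - X]mul1r -lawB.
  apply: law_le => s hs hy h1 h2; rewrite big_bool /= !mulr1 recharge1.
  case: (boolP (act m hs hy)) => [/(act_charged h1 h2) ->|_] /=; first by lra.
  by case: s {h1} => /=; lra.
- by move=> z; apply: law_ge0 => s hs hy.
- move=> z; rewrite /prefix_empty law_cons -lawZ.
  apply: law_eq => s hs hy h1 h2; rewrite big_bool /=.
  case: (boolP (act m hs hy)) => [/(act_charged h1 h2) ->|_] /=; first by ring.
  by case: s {h1} => /=; ring.
- move=> z; rewrite /prefix_empty /prefix_prob !law_cons -lawZ.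
  apply: law_eq => s hs hy h1 h2; rewrite !big_bool /= !mulr1 recharge1.
  by case: (act m hs hy) => /=; ring.
Qed.

Lemma success_prob n (dec : seq bool -> 'I_M) : (0 < M)%N ->
  avg n (fun m z => (dec (false :: rev z) == m)%:R * prefix_prob m z)
  = 1 - err_prob eta n.+1 enc dec.
Proof.
move=> M0.
have -> : err_prob eta n.+1 enc dec
    = avg n (fun m z => (dec (false :: rev z) != m)%:R * prefix_prob m z).
  congr (_ * _); apply: eq_bigr => m _.
  rewrite (run_law eta n.+1 enc m (fun y => dec y != m)) /=.
  rewrite (sum_tuple_cons n (fun y => if dec y != m then
     expect eta (fun hs hy => enc (size hy) m hs hy) (fun _ _ _ => 1) y false [::] [::] else 0)).
  rewrite big_bool big1 => [|y _]; last by rewrite /= -/(act m [::] [::]) act_start if_same.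
  rewrite [LHS]add0r.
  rewrite (sum_tuple_rev n (fun y => if dec (false :: y) != m then
     expect eta (fun hs hy => enc (size hy) m hs hy) (fun _ _ _ => 1) (false :: y) false [::] [::] else 0)).
  by apply: eq_bigr => z _; case: ifP => _; rewrite ?mul1r ?mul0r.
rewrite -[X in _ = X - _](avg_P M0 prefix_measureP n) -avgB; apply: avg_eq => m z _.
by case: (dec (false :: rev z) == m); rewrite /= ?mul1r ?mul0r ?subr0 ?subrr.
Qed.

End Encoder.

(** * Rates above the upper bound are not achievable *)

Section Converse.
Variables (R : realType) (eta : R).
Hypothesis eta01 : 0 <= eta <= 1.
Variable N : nat.
Hypothesis N0 : (0 < N)%N.

Lemma code_bound n M (enc : encoder M) dec : (0 < M)%N -> valid_encoder enc ->
  (1 - err_prob eta n.+1 enc dec) * ln M%:R - 1 <= (n%:R + N%:R + 1) * b_N eta N * ln 2.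
Proof.
move=> M0 ve; rewrite -success_prob//.
have PZ := prefix_measureP eta01 ve.
apply: le_trans (divergence_le eta01 N0 M0 PZ n).
exact: (fano eta01 N0 M0 PZ n (fun z => dec (false :: rev z))).
Qed.

Lemma achievable_le_b_N r : achievable eta r -> r <= b_N eta N.
Proof.
move=> ach; rewrite leNgt; apply/negP => br.
have b0 := b_N_ge0 eta N; set b := b_N eta N in b0 br *.
have ln2 : 0 < ln 2 :> R by rewrite ln_gt0// ltr1n.
have r0 : 0 < r by exact: le_lt_trans br.
(* An error of [eps] costs half of the excess [r - b]; beyond the length [x] chosen below the other
   half outweighs the constant terms. *)
pose eps := (r - b) / (2 * r).
have eps0 : 0 < eps by rewrite divr_gt0 ?subr_gt0// mulr_gt0.
have epsE : eps * r = (r - b) / 2 by rewrite /eps; field; rewrite gt_eqF.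
have eps1 : eps <= 1.
  by rewrite /eps ler_pdivrMr ?mulr_gt0// mul1r; lra.
have [n0 Hn] := ach eps eps0.
pose x := (1 + N%:R * b * ln 2) / ((r - b) / 2 * ln 2).
have x0 : 0 <= x.
  by rewrite divr_ge0// ?addr_ge0 ?mulr_ge0 ?(ltW ln2)// ?invr_ge0 ?subr_ge0 ltW.
pose n := (n0 + Num.bound x)%N.
have [M [enc [dec [Mge ve err]]]] := Hn n.+1 (leqW (leq_addr _ _)).
have p0 : 0 < (2 : R) `^ (n.+1%:R * r) by rewrite powR_gt0.
have M0 : (0 < M)%N by rewrite -(ltr0n R); apply: lt_le_trans Mge.
have := code_bound n dec M0 ve; rewrite -/b => cb.
have lnM : n.+1%:R * r * ln 2 <= ln M%:R.
  by rewrite -ln_powR ler_ln ?posrE// ltr0n.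
have h1 : (1 - eps) * (n.+1%:R * r * ln 2) <= (1 - err_prob eta n.+1 enc dec) * ln M%:R.
  apply: le_trans (_ : (1 - eps) * ln M%:R <= _).
    by rewrite ler_wpM2l// subr_ge0.
  by rewrite ler_wpM2r ?ln_ge0 ?ler1n// lerD2l lerN2.
have h2 : (1 - eps) * (n.+1%:R * r * ln 2) = n.+1%:R * ln 2 * (r - (r - b) / 2).
  by rewrite -epsE; ring.
have nx : x < n.+1%:R.
  apply: lt_le_trans (archi_boundP x0) _; by rewrite ler_nat leqW// leq_addl.
have : 1 + N%:R * b * ln 2 < n.+1%:R * ((r - b) / 2 * ln 2).
  by rewrite -ltr_pdivrMr// mulr_gt0// divr_gt0// subr_gt0.
move: cb h1; rewrite h2 -[n.+1%:R]natr1; lra.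
Qed.

Lemma C_BEHC_le : C_BEHC eta <= b_N eta N.
Proof.
rewrite /C_BEHC; set S := [set _ | _].
have [S0|/set0P/negP] := pselect (S !=set0).
  by apply: ge_sup => // r [_]; apply: achievable_le_b_N.
by rewrite negbK => /eqP ->; rewrite sup0 b_N_ge0.
Qed.

(** The converse at one level [N] bounds the achievable rates, and only then is [sup] an upper bound
    of them. *)
Lemma achievable_le_C_BEHC r : 0 <= r -> achievable eta r -> r <= C_BEHC eta.
Proof.
move=> r0 ach; apply: ub_le_sup => //.
by exists (b_N eta N) => s [_]; apply: achievable_le_b_N.
Qed.

End Converse.

(** * Achievability *)

Section Feinstein.
Variables (R : realType) (F Y : finType) (rho : F -> R) (p : F -> Y -> R) (K eps delta : R).
Hypothesis rho_ge0 : forall f, 0 <= rho f.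
Hypothesis rho_sum : \sum_f rho f = 1.
Hypothesis p_ge0 : forall f y, 0 <= p f y.
Hypothesis p_sum : forall f, \sum_y p f y = 1.
Hypothesis K_gt0 : 0 < K.

Definition mixture y := \sum_f rho f * p f y.

Definition likely f y := K * mixture y < p f y.

Hypothesis unlikely_le : \sum_f rho f * \sum_(y | ~~ likely f y) p f y <= delta.

Lemma le_some_value (x : F -> R) : exists f, \sum_g rho g * x g <= x f.
Proof.
apply/not_existsP => H.
have lt f : x f < \sum_g rho g * x g by rewrite ltNge; apply/negP/H.
have z : \sum_f rho f * (\sum_g rho g * x g - x f) = 0.
  under eq_bigr do rewrite mulrBr.
  by rewrite sumrB -mulr_suml rho_sum mul1r subrr.
have z0 : forall f, rho f = 0.
  move=> f; have t0 g : true -> 0 <= rho g * (\sum_g rho g * x g - x g).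
    by move=> _; rewrite mulr_ge0// subr_ge0 ltW.
  have /eqP := psumr_eq0P t0 z (erefl true : xpredT f).
  rewrite mulf_eq0 subr_eq0 => /orP[/eqP//|/eqP e].
  by have := lt f; rewrite -e ltxx.
by have := rho_sum; rewrite big1// => /eqP; rewrite eq_sym oner_eq0.
Qed.

(* Greedy extension: as long as the decoding sets used so far have small
   mixture probability, some codeword is likely on most of the rest. *)
Lemma feinstein k : k%:R / K + delta <= eps ->
  exists (c : nat -> F) (d : Y -> nat),
    (forall j, (j < k)%N -> 1 - eps <= \sum_(y | d y == j) p (c j) y) /\
    (forall y, (d y < k)%N -> likely (c (d y)) y).
Proof.
elim: k => [|k IH] hk.
  have [f _] := le_some_value (fun=> 0).
  by exists (fun=> f), (fun=> 0%N); split.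
have kK : k%:R / K <= k.+1%:R / K by rewrite ler_wpM2r ?invr_ge0 ?(ltW K_gt0)// ler_nat.
have [|c [d [dc dl]]] := IH; first by apply: le_trans hk; rewrite lerD2r.
(* On its decoding set a codeword has more than [K] times the mixture probability, and at most 1 in
   total. *)
have mix_used : \sum_(y | (d y < k)%N) mixture y <= k%:R / K.
  rewrite ler_pdivlMr// mulr_suml.
  apply: le_trans (_ : \sum_(y | (d y < k)%N) p (c (d y)) y <= _).
    by apply: ler_sum => y yk; rewrite mulrC ltW//; apply: dl.
  have -> : \sum_(y | (d y < k)%N) p (c (d y)) y = \sum_(j < k) \sum_(y | d y == j) p (c j) y.
    rewrite [RHS](exchange_big_dep (fun y => (d y < k)%N))/=; last by move=> j y _ /eqP ->.
    apply: eq_bigr => y yk; rewrite (bigD1 (Ordinal yk))//= big1 ?addr0// => j.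
    by rewrite -val_eqE /= eq_sym => /andP[/eqP <-]; rewrite eqxx.
  rewrite -[leRHS]mulr1 -[k in leRHS]card_ord mulr_natl -sumr_const.
  apply: ler_sum => j _; rewrite -(p_sum (c j)) [leRHS](bigID (fun y => d y == j))/=.
  by rewrite lerDl sumr_ge0.
pose x f := \sum_(y | likely f y && (k <= d y)%N) p f y.
have [f fx] := le_some_value x.
have xf : 1 - eps <= x f.
  apply: le_trans fx.
  have -> : \sum_g rho g * x g = 1 - \sum_g rho g * \sum_(y | ~~ (likely g y && (k <= d y)%N)) p g y.
    rewrite -rho_sum -sumrB; apply: eq_bigr => g _.
    rewrite -[X in _ = X - _]mulr1 -(p_sum g) (bigID (fun y => likely g y && (k <= d y)%N))/=.
    by rewrite -mulrBr addrK.
  rewrite lerD2l lerN2; apply: le_trans (_ : k%:R / K + delta <= _); last first.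
    by apply: le_trans hk; rewrite lerD2r.
  apply: le_trans (_ : \sum_g rho g * (\sum_(y | (d y < k)%N) p g y + \sum_(y | ~~ likely g y) p g y) <= _).
    apply: ler_sum => g _; rewrite ler_wpM2l// (bigID (likely g))/= lerD//.
      rewrite [leRHS](bigID (likely g))/= -[leLHS]addr0 lerD ?sumr_ge0//.
      rewrite le_eqVlt; apply/orP; left; apply/eqP; apply: eq_bigl => y.
      by rewrite ltnNge; case: (likely g y); rewrite ?andbT ?andbF.
    rewrite le_eqVlt; apply/orP; left; apply/eqP; apply: eq_bigl => y.
    by case: (likely g y); rewrite ?andbT ?andbF.
  under eq_bigr do rewrite mulrDr; rewrite big_split lerD//.
  apply: le_trans mix_used; rewrite /mixture exchange_big /=.
  by apply: ler_sum => g _; rewrite mulr_sumr.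
exists (fun j => if j == k then f else c j).
(* Undecoded outputs are re-marked with [k.+1]: their old mark may be [k], now the index of the new
   codeword. *)
exists (fun y => if likely f y && (k <= d y)%N then k else if (d y < k)%N then d y else k.+1).
split=> [j|y].
  rewrite ltnS leq_eqVlt => /predU1P[->|jk].
    rewrite eqxx; apply: le_trans xf _; rewrite le_eqVlt; apply/orP; left; apply/eqP.
    apply: eq_bigl => y; case: ifP => _; first by rewrite eqxx.
    by case: ltnP => h; [rewrite ltn_eqF|rewrite gtn_eqF].
  rewrite ltn_eqF//; apply: le_trans (dc j jk) _; rewrite le_eqVlt; apply/orP; left; apply/eqP.
  apply: eq_bigl => y; have [h|h] := ltnP (d y) k; first by rewrite andbF.
  rewrite andbT gtn_eqF ?(leq_trans jk)//; case: ifP => _; first by rewrite gtn_eqF.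
  by rewrite gtn_eqF// ltnW.
case: ifP => [/andP[fy _] _|_]; first by rewrite eqxx.
by case: (ltnP (d y) k) => [h _|_]; [rewrite (ltn_eqF h); apply: dl h|rewrite ltnn].
Qed.

End Feinstein.

(** * The flow of a lower-bound policy *)

Section LowerFlow.
Variables (R : realType) (eta : R).
Hypothesis eta01 : 0 <= eta <= 1.
Variable N : nat.
Hypothesis N0 : (0 < N)%N.
Notation idx := 'I_N.+1.
Variables (P : policy R N) (mu : state N -> R).
Hypothesis adm : admissibleL eta P mu.

Let a (u q : idx) := P u q ord0.
Let nxt (u : idx) : idx := inord u.+1.
Let beta (u : idx) := empty_prob eta u.
Let vis (u q : idx) := mu (true, u, q) + mu (false, u, q).

Let Pp : is_policy P. Proof. by case: adm. Qed.
Let mu_ge0 t : 0 <= mu t. Proof. by case: adm => _ [[]]. Qed.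
Let mu_sum : \sum_t mu t = 1. Proof. by case: adm => _ [[_ []]]. Qed.
Let muK t' : \sum_t mu t * KL eta P t t' = mu t'. Proof. by case: adm => _ [[_ []]]. Qed.

Let a_ge0 u q : 0 <= a u q. Proof. by rewrite /a; case: Pp. Qed.
Let a_le1 u q : a u q <= 1. Proof. exact: (policy_le1 _ _ _ Pp). Qed.

Let vis_ge0 u q : 0 <= vis u q. Proof. by rewrite addr_ge0. Qed.

Let beta_ge0 u : 0 <= beta u. Proof. exact: empty_prob_ge0. Qed.
Let beta_le1 u : beta u <= 1. Proof. exact: empty_prob_le1. Qed.

Let vis_supp (u q : idx) : (q < u)%N -> vis u q = 0.
Proof. by case: adm => _ _ [s _] _ qu; rewrite /vis !s// addr0. Qed.

Lemma policyL_supp (u q up : idx) : up != ord0 -> up != u.+1 :> nat -> P u q up = 0.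
Proof.
case: adm => _ _ [_ s] top up0 upu; have [qN|qN] := ltnP q N; first by apply: s.
by apply: top => //; apply/eqP; rewrite eqn_leq qN -ltnS ltn_ord.
Qed.

(** At [u = N] the index [nxt u] falls back to [0], but its weight vanishes, since the policy can
    only attempt there. *)
Lemma policyL_sum (u q : idx) (G : idx -> R) :
  \sum_up P u q up * G up = a u q * G ord0 + (1 - a u q) * G (nxt u).
Proof.
rewrite (bigD1 ord0)//=; congr (_ + _).
have -> : 1 - a u q = \sum_(up < N.+1 | up != ord0) P u q up.
  by have [_ /(_ u q)] := Pp; rewrite (bigD1 ord0)//= -/(a u q); lra.
have [uN|uN] := ltnP u N; last first.
  rewrite !big1 ?mul0r// => up up0; rewrite policyL_supp ?mul0r//.
    by rewrite ltn_eqF// (leq_trans (ltn_ord up)).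
  by rewrite ltn_eqF// (leq_trans (ltn_ord up)).
have uS : nxt u = u.+1 :> nat by rewrite inordK.
have uS0 : nxt u != ord0 by rewrite eq_ordE uS.
rewrite (bigD1 (nxt u))//= big1 ?addr0 => [|up /andP[up0 upn]]; last first.
  by rewrite policyL_supp ?mul0r// -uS -eq_ordE.
rewrite (bigD1 (nxt u))//= big1 ?addr0// => up /andP[up0 upn].
by rewrite policyL_supp// -uS -eq_ordE.
Qed.

Let a_top (u q : idx) : q = ord_max -> a u q = 1.
Proof.
case: adm => _ _ _ top ->; have [_ /(_ u ord_max)] := Pp.
rewrite (bigD1 ord0)//= big1 ?addr0// => up up0.
by rewrite top.
Qed.

(** Index [0] is entered only by attempts, which reset the battery; index [u.+1] only from [u]
    without an attempt, which multiplies the probability of an empty battery by [etab eta]. Given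
    [u], battery and level are thus independent. *)
Lemma empty_battery (u q : idx) : mu (false, u, q) = beta u * vis u q.
Proof.
suff H k : forall u' q' : idx, u' = k :> nat -> mu (false, u', q') = beta u' * vis u' q'.
  exact: H.
clear u q; elim: k => [|k IH] u' q' uk.
  have -> : u' = ord0 by apply: val_inj.
  have E s' : mu (s', ord0, q') = recharge eta s' *
      \sum_(t : state N) mu t * (P t.1.2 t.2 ord0 * (q' == gL t.2 t.1.1)%:R).
    rewrite -[LHS]muK mulr_sumr; apply: eq_bigr => -[[s u1] q] _ /=.
    by rewrite /KL f0 bat_diag; case: (q' == _) => /=; ring.
  rewrite /vis !E -mulrDl recharge_sum mul1r /beta /empty_prob expr1.
  by [].
have kN : (k < N)%N by rewrite -ltnS -uk ltn_ord.
have ik : (inord k : idx) = k :> nat by rewrite inordK// ltnW.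
have u'0 : u' != ord0 by rewrite eq_ordE uk.
have E s' : mu (s', u', q') = \sum_q (q' == gL q false)%:R * P (inord k) q u' *
    (mu (true, inord k, q) * bat eta s' false true + mu (false, inord k, q) * bat eta s' false false).
  rewrite -[LHS]muK sum_state; apply: eq_bigr => q _.
  rewrite (bigD1 (inord k))//= [X in _ + X]big1 ?addr0 => [|u uk'].
    by rewrite /KL !fN0//; case: (q' == _) => /=; ring.
  have e0 : P u q u' = 0.
    by apply: policyL_supp => //; rewrite uk eqSS eq_sym -ik -eq_ordE.
  by rewrite /KL e0 !mul0r !mulr0 addr0.
have betaS : beta u' = etab eta * beta (inord k) by rewrite /beta /empty_prob uk ik exprS.
rewrite /vis !E -big_split mulr_sumr betaS; apply: eq_bigr => q _ /=.
have := IH (inord k) q ik; rewrite /vis; set t := mu (true, _, _); set g := mu (false, _, _) => e.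
set c := _ * P _ _ _; rewrite /bat /=.
transitivity (c * etab eta * (beta (inord k) * (t + g))); last by ring.
by rewrite -e; ring.
Qed.

Let charged_battery u q : mu (true, u, q) = (1 - beta u) * vis u q.
Proof. by have := empty_battery u q; rewrite /vis; lra. Qed.

(* [G] takes the attempt bit and the output. *)
Definition slot (u q : idx) (G : bool -> bool -> R) : R :=
  a u q * ((1 - beta u) * G true true + beta u * G true false)
  + (1 - a u q) * G false false.

Let next_u (u : idx) (b : bool) : idx := if b then ord0 else nxt u.

(** Stationarity tested on functions of [(u, q)]; [empty_battery] integrates the battery out. *)
Lemma stationary_flow (V : idx -> idx -> R) :
  \sum_q \sum_u vis u q * V u q
  = \sum_q \sum_u vis u q * slot u q (fun b x => V (next_u u b) (gL q x)).
Proof.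
transitivity (\sum_t' mu t' * V t'.1.2 t'.2).
  by rewrite sum_state; apply: eq_bigr => q _; apply: eq_bigr => u _; rewrite mulrDl.
transitivity (\sum_t mu t * \sum_t' KL eta P t t' * V t'.1.2 t'.2).
  under eq_bigr do rewrite -[X in X * _]muK mulr_suml.
  rewrite exchange_big; apply: eq_bigr => t _; rewrite mulr_sumr.
  by apply: eq_bigr => t' _; rewrite mulrA.
rewrite sum_state; apply: eq_bigr => q _; apply: eq_bigr => u _.
have step s : \sum_t' KL eta P (s, u, q) t' * V t'.1.2 t'.2
    = a u q * V ord0 (gL q s) + (1 - a u q) * V (nxt u) (gL q false).
  transitivity (\sum_up P u q up * V up (gL q (f up s))).
    rewrite sum_state exchange_big; apply: eq_bigr => up _ /=.
    rewrite (bigD1 (gL q (f up s)))//= [X in _ + X]big1 ?addr0 => [|q' /negPf q'g].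
      by rewrite /KL eqxx -mulrDl -mulrDr bat_sum; ring.
    by rewrite /KL q'g; ring.
  rewrite policyL_sum f0; have [uN|uN] := ltnP u N.
    by rewrite [f (nxt u) s]fN0// eq_ordE inordK.
  suff -> : a u q = 1 by rewrite subrr !mul0r.
  have [_ /(_ u q)] := Pp; rewrite (bigD1 ord0)//= big1 ?addr0// => up up0.
  by rewrite policyL_supp// ltn_eqF// (leq_trans (ltn_ord up)).
by rewrite !step empty_battery charged_battery /slot /next_u; ring.
Qed.

Let ma q := mass mu q.
Let em q := emission P mu q.

Let emE q : em q = \sum_u vis u q * (a u q * (1 - beta u)).
Proof. by apply: eq_bigr => u _; rewrite charged_battery -/(a u q); ring. Qed.

Let siE q : ma q - em q = \sum_u vis u q * (1 - a u q * (1 - beta u)).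
Proof.
rewrite emE /ma /mass -sumrB; apply: eq_bigr => u _.
by rewrite -/(vis u q); ring.
Qed.

Let em_ge0 q : 0 <= em q. Proof. exact: emission_ge0. Qed.
Let em_le q : em q <= ma q. Proof. exact: emission_le_mass. Qed.
Let ma_ge0 q : 0 <= ma q. Proof. exact: le_trans (em_ge0 q) (em_le q). Qed.

Lemma silent_flow (q q' : idx) (V : idx -> R) : (q < N)%N -> q' = q.+1 :> nat ->
  \sum_u vis u q' * V u
  = \sum_u vis u q * (a u q * beta u * V ord0 + (1 - a u q) * V (nxt u)).
Proof.
move=> qN q'q; have gq : gL q false = q' by apply: val_inj; rewrite /= val_gL qN q'q.
have g1 q0 : (gL q0 true == q') = false by rewrite eq_ordE val_gL q'q.
have := stationary_flow (fun u q0 => (q0 == q')%:R * V u).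
rewrite (bigD1 q')//= eqxx [X in _ + X]big1 ?addr0 => [|q0 /negPf q0q]; last first.
  by apply: big1 => u _; rewrite q0q mul0r mulr0.
under eq_bigr do rewrite mul1r.
move=> ->; rewrite (bigD1 q)//= [X in _ + X]big1 ?addr0 => [|q0 q0q]; last first.
  apply: big1 => u _; have g0 : (gL q0 false == q') = false.
    rewrite eq_ordE val_gL q'q; case: ltnP => // _.
    by rewrite eqSS -eq_ordE (negPf q0q).
  by rewrite /slot !g1 !g0 !mulr0n; ring.
apply: eq_bigr => u _; rewrite /slot /next_u g1 gq eqxx mulr0n mulr1n; ring.
Qed.

Lemma mass_succ (q q' : idx) : (q < N)%N -> q' = q.+1 :> nat -> ma q' = ma q - em q.
Proof.
move=> qN q'q; rewrite siE; have := silent_flow (fun=> 1) qN q'q.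
rewrite /ma /mass; under [LHS]eq_bigr do rewrite mulr1.
move=> ->; apply: eq_bigr => u _; ring.
Qed.

Let vis00 : vis ord0 ord0 = ma ord0.
Proof.
rewrite /ma /mass (bigD1 ord0)//= big1 ?addr0// => u u0.
by rewrite -/(vis u ord0) vis_supp// lt0n.
Qed.

Lemma mass0_gt0 : 0 < ma ord0.
Proof.
rewrite lt_neqAle eq_sym ma_ge0 andbT; apply/eqP => m0.
have H k : forall q : idx, q = k :> nat -> ma q = 0.
  elim: k => [|k IH] q qk; first by have -> : q = ord0 by apply: val_inj.
  have kN : (k < N)%N by rewrite -ltnS -qk ltn_ord.
  have ik : (inord k : idx) = k :> nat by rewrite inordK// ltnW.
  have e : ma (inord k) = 0 by apply: IH.
  have := em_ge0 (inord k); have := em_le (inord k); rewrite e => h1 h2.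
  by rewrite (@mass_succ (inord k)) ?ik// e; lra.
have := mu_sum; rewrite -sum_mass big1 => [|q _]; last exact: H.
by move/eqP; rewrite eq_sym oner_eq0.
Qed.

(** * Output laws of a policy *)

Definition out_kernel (x : bool) (q : idx) : R :=
  (if x then em q else ma q - em q) / ma q.

Lemma out_kernelE x q : ma q * out_kernel x q = if x then em q else ma q - em q.
Proof.
rewrite /out_kernel; have [m0|m0] := eqVneq (ma q) 0; last by rewrite mulrC divfK.
have := em_ge0 q; have := em_le q; rewrite m0 mul0r; case: x; lra.
Qed.

(* Law of the outputs of the policy from the state [(u, q)], and the product
   law that the level alone predicts: they agree at the start of a cycle. *)
Fixpoint policy_law (u q : idx) (ys : seq bool) : R :=
  if ys is x :: ys' then
    slot u q (fun b y => (y == x)%:R * policy_law (next_u u b) (gL q x) ys')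
  else 1.

Fixpoint level_law (q : idx) (ys : seq bool) : R :=
  if ys is x :: ys' then out_kernel x q * level_law (gL q x) ys' else 1.

(** Silence carries the stationary weights of [u] at one level to those at the next, while a pulse,
    or any output at level [N], restarts from [(0, 0)]. So the past acts on the future outputs
    through the level only. *)
Lemma policy_law_level q ys :
  \sum_u vis u q * policy_law u q ys = ma q * level_law q ys.
Proof.
elim: ys q => [|x ys IH] q.
  by rewrite /= mulr1; apply: eq_bigr => u _; rewrite mulr1.
have start : policy_law ord0 ord0 ys = level_law ord0 ys.
  have := IH ord0; rewrite (bigD1 ord0)//= big1 ?addr0 => [|u u0]; last first.
    by rewrite vis_supp ?mul0r// lt0n.
  by rewrite vis00 => /mulfI; apply; rewrite gt_eqF// mass0_gt0.
rewrite /= mulrA out_kernelE; case: x => /=.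
  have g1 : gL q true = ord0 by [].
  rewrite g1 -start emE mulr_suml; apply: eq_bigr => u _.
  by rewrite /slot /next_u /=; ring.
have [qN|qN] := ltnP q N.
  have iq : (inord q.+1 : idx) = q.+1 :> nat by rewrite inordK.
  have -> : gL q false = inord q.+1 by apply: val_inj; rewrite /= val_gL qN iq.
  rewrite -(mass_succ qN iq) -IH (silent_flow _ qN iq).
  by apply: eq_bigr => u _; rewrite /slot /next_u /=; ring.
have qm : q = ord_max by apply: val_inj; apply/eqP; rewrite eqn_leq qN -ltnS ltn_ord.
have -> : gL q false = ord0 by rewrite /gL ltnNge qN.
rewrite -start siE mulr_suml; apply: eq_bigr => u _.
by rewrite /slot /next_u /= (a_top u qm); ring.
Qed.

Lemma policy_law_start ys : policy_law ord0 ord0 ys = level_law ord0 ys.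
Proof.
have := policy_law_level ord0 ys; rewrite (bigD1 ord0)//= big1 ?addr0 => [|u u0].
  by rewrite vis00 => /mulfI; apply; rewrite gt_eqF// mass0_gt0.
by rewrite vis_supp ?mul0r// lt0n.
Qed.

Definition chan (u : idx) (b x : bool) : R :=
  if b then if x then 1 - beta u else beta u else (~~ x)%:R.

Lemma chan_ge0 u b x : 0 <= chan u b x.
Proof. by rewrite /chan; case: b => //; case: x => //; rewrite subr_ge0. Qed.

Lemma slotE u q G : slot u q G =
  a u q * \sum_x chan u true x * G true x + (1 - a u q) * \sum_x chan u false x * G false x.
Proof. by rewrite !big_bool /slot /chan /=; ring. Qed.

Lemma slot_ext u q G1 G2 : (q == ord_max -> forall x, G1 true x = G2 true x) ->
  (q != ord_max -> [/\ G1 true true = G2 true true, G1 true false = G2 true false &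
     G1 false false = G2 false false]) -> slot u q G1 = slot u q G2.
Proof.
rewrite /slot; have [qm|qm] := eqVneq q ord_max => [/(_ erefl) e _|_ /(_ isT)[-> -> ->]//].
by rewrite (a_top u qm) !e subrr !mul0r.
Qed.

Lemma slotD u q G1 G2 : slot u q (fun b x => G1 b x + G2 b x) = slot u q G1 + slot u q G2.
Proof. by rewrite /slot; ring. Qed.

Lemma slotZ u q (c : R) G : slot u q (fun b x => c * G b x) = c * slot u q G.
Proof. by rewrite /slot; ring. Qed.

Lemma slot_const u q (c : R) : slot u q (fun _ _ => c) = c.
Proof. by rewrite /slot; ring. Qed.

Lemma slot_le u q G1 G2 : (forall b x, G1 b x <= G2 b x) -> slot u q G1 <= slot u q G2.
Proof.
move=> G12; rewrite /slot lerD// ler_wpM2l ?subr_ge0//.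
by rewrite lerD// ler_wpM2l// subr_ge0.
Qed.

(** * Poisson equation and second moments *)

Let rate : R := objective P mu * ln 2.

(** Information density of one slot in nats, centred at the objective. *)
Definition score (u q : idx) (b x : bool) : R :=
  ln (chan u b x) - ln (out_kernel x q) - rate.

Lemma level_information q :
  \sum_u vis u q * slot u q (fun b x => ln (chan u b x) - ln (out_kernel x q))
  = hent (em q) (ma q - em q) - noise P mu q.
Proof.
rewrite hent_exact ?subr_ge0// subrKC -/(out_kernel true q).
rewrite -[(ma q - em q) / _]/(out_kernel false q) siE emE /noise.
rewrite !mulr_suml -big_split -sumrN -sumrB; apply: eq_bigr => u _ /=.
rewrite charged_battery empty_battery -/(a u q) !(mulrC _ (vis u q)).
rewrite hentZ ?subr_ge0// /slot /chan /hent subrK ln1 /=; ring.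
Qed.

Lemma mean_score : \sum_q \sum_u vis u q * slot u q (score u q) = 0.
Proof.
have ln2 : ln 2 != 0 :> R by rewrite gt_eqF// ln_gt0// ltr1n.
have -> : \sum_q \sum_u vis u q * slot u q (score u q)
   = \sum_q (\sum_u vis u q * slot u q (fun b x => ln (chan u b x) - ln (out_kernel x q))
             - ma q * rate).
  apply: eq_bigr => q _; rewrite mulr_suml -sumrB; apply: eq_bigr => u _.
  by rewrite -/(vis u q) /score /slot; ring.
under eq_bigr do rewrite level_information.
rewrite sumrB -mulr_suml sum_mass mu_sum mul1r /rate objectiveE// mulfVK//.
by rewrite -sumrB subrr.
Qed.

(* Solution of the Poisson equation of the chain for [score]: the expected
   total score up to the end of the cycle. *)
Fixpoint cycle_score (k : nat) (u q : idx) : R :=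
  if k is k'.+1 then slot u q (fun b x => score u q b x +
    (if x || (q == ord_max) then 0 else cycle_score k' (next_u u b) (gL q x)))
  else 0.

Definition potential (u q : idx) : R := cycle_score (N.+1 - q) u q.

Lemma potential_cycle u q : potential u q = slot u q (fun b x => score u q b x +
    (if x || (q == ord_max) then 0 else potential (next_u u b) (gL q x))).
Proof.
have qE : (N.+1 - q = (N - q).+1)%N by rewrite subSn// -ltnS ltn_ord.
rewrite {1}/potential qE [cycle_score _.+1]/=; apply: slot_ext => [qm|qm].
  by move=> x; rewrite qm orbT.
have qN := lt_ord_max qm; have fuel : (N.+1 - gL q false = N - q)%N.
  by rewrite val_gL qN subSS.
by rewrite !orTb !orFb (negPf qm); split=> //; rewrite /potential fuel.
Qed.

Lemma reset_level (q : idx) x : (gL q x == ord0) = x || (q == ord_max).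
Proof.
rewrite !eq_ordE val_gL; case: x => //=; case: ltnP => [qN|qN].
  by rewrite [RHS](ltn_eqF qN).
by rewrite [RHS]eqn_leq qN -ltnS ltn_ord.
Qed.

Lemma reset_flow : \sum_q \sum_u vis u q * slot u q (fun _ x => (x || (q == ord_max))%:R)
  = ma ord0.
Proof.
have := stationary_flow (fun _ q => (q == ord0)%:R).
rewrite (bigD1 ord0)//= [X in _ + X]big1 ?addr0 => [|q /negPf q0]; last first.
  by apply: big1 => u _; rewrite q0 mulr0.
under eq_bigr do rewrite mulr1.
rewrite -[ma ord0]/(\sum_u vis u ord0) => ->; apply: eq_bigr => q _; apply: eq_bigr => u _.
by congr (_ * _); rewrite /slot !reset_level.
Qed.

Lemma slot_potential u q : slot u q (fun b x => potential (next_u u b) (gL q x))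
  = slot u q (fun b x => if x || (q == ord_max) then 0 else potential (next_u u b) (gL q x))
    + slot u q (fun _ x => (x || (q == ord_max))%:R) * potential ord0 ord0.
Proof.
rewrite mulrC -slotZ -slotD; apply: slot_ext => [/eqP ->|/negPf qm].
  by move=> x; rewrite eqxx orbT mulr1 add0r /gL /= ltnn if_same.
by rewrite qm /=; split; rewrite ?mulr1 ?mulr0 ?add0r ?addr0.
Qed.

(** Renewal reward: averaging the Poisson equation, stationarity cancels the potentials and the mean
    score is zero; what is left is the reset rate times the value at the start of a cycle. *)
Lemma potential_start : potential ord0 ord0 = 0.
Proof.
have flow := stationary_flow potential.
have : \sum_q \sum_u vis u q * potential u q
  = \sum_q \sum_u vis u q * slot u q (score u q)
    + \sum_q \sum_u vis u q * slot u q (fun b x =>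
        if x || (q == ord_max) then 0 else potential (next_u u b) (gL q x)).
  rewrite -big_split; apply: eq_bigr => q _; rewrite -big_split; apply: eq_bigr => u _.
  by rewrite {1}potential_cycle slotD mulrDr.
have : \sum_q \sum_u vis u q * slot u q (fun b x => potential (next_u u b) (gL q x))
  = \sum_q \sum_u vis u q * slot u q (fun b x =>
        if x || (q == ord_max) then 0 else potential (next_u u b) (gL q x))
    + ma ord0 * potential ord0 ord0.
  rewrite -reset_flow mulr_suml -big_split; apply: eq_bigr => q _.
  rewrite mulr_suml -big_split; apply: eq_bigr => u _.
  by rewrite slot_potential mulrDr mulrA.
rewrite mean_score -flow => -> /eqP; rewrite add0r -subr_eq0 addrC addKr mulf_eq0.
by rewrite gt_eqF ?mass0_gt0//= => /eqP.
Qed.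

Definition increment (u q : idx) (b x : bool) : R :=
  score u q b x + potential (next_u u b) (gL q x) - potential u q.

(** Since the potential vanishes after a reset, the equation holds across cycles too, and the
    increments are martingale differences from every state. *)
Lemma mean_increment u q : slot u q (increment u q) = 0.
Proof.
have e := slot_potential u q; rewrite potential_start mulr0 addr0 in e.
have := potential_cycle u q; rewrite slotD -e -slotD => p.
have -> : slot u q (increment u q) = slot u q (fun b x => score u q b x +
   potential (next_u u b) (gL q x)) - potential u q by rewrite /increment /slot; ring.
by rewrite -p subrr.
Qed.

Let square_bound : R := \sum_q \sum_u \sum_b \sum_x increment u q b x ^+ 2.

Lemma increment_bound u q b x : increment u q b x ^+ 2 <= square_bound.
Proof.
rewrite /square_bound (bigD1 q)//= (bigD1 u)//= (bigD1 b)//= (bigD1 x)//= -!addrA lerDl.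
by rewrite !addr_ge0//; repeat (apply: sumr_ge0 => ? _); rewrite sqr_ge0.
Qed.

Fixpoint moment n (u q : idx) (z : R) : R :=
  if n is n'.+1 then
    slot u q (fun b x => moment n' (next_u u b) (gL q x) (z + increment u q b x))
  else z ^+ 2.

(** Martingale differences are orthogonal: the linear term vanishes and each slot adds at most
    [square_bound]. *)
Lemma moment_le n u q z : moment n u q z <= z ^+ 2 + n%:R * square_bound.
Proof.
elim: n u q z => [|n IH] u q z /=; first by rewrite mul0r addr0.
apply: le_trans (slot_le _ _ (fun b x => IH _ _ _)) _.
have -> : slot u q (fun b x => (z + increment u q b x) ^+ 2 + n%:R * square_bound)
  = z ^+ 2 + 2 * z * slot u q (increment u q)
    + slot u q (fun b x => increment u q b x ^+ 2) + n%:R * square_bound.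
  by rewrite /slot; ring.
have : slot u q (fun b x => increment u q b x ^+ 2) <= square_bound.
  by rewrite -[leRHS](slot_const u q); apply: slot_le => b x; apply: increment_bound.
by rewrite mean_increment -[n.+1%:R]natr1 mulrDl; lra.
Qed.

(* One-slot strategies; at the top level an attempt is made whatever they say. *)
Notation strategy := {ffun idx * idx -> bool}.

Definition attempt (phi : strategy) (u q : idx) := phi (u, q) || (q == ord_max).

Definition strategy_prob (phi : strategy) : R :=
  \prod_z (if phi z then a z.1 z.2 else 1 - a z.1 z.2).

Lemma strategy_prob_ge0 phi : 0 <= strategy_prob phi.
Proof. by apply: prodr_ge0 => z _; case: ifP; rewrite ?subr_ge0. Qed.

(** The coordinates of a random strategy are independent, so all but the one at [(u, q)] integrate
    to 1; at the top the override agrees with [a = 1]. *)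
Lemma sum_strategy u q (H : bool -> R) :
  \sum_phi strategy_prob phi * H (attempt phi u q) = a u q * H true + (1 - a u q) * H false.
Proof.
pose F z b := (if b then a z.1 z.2 else 1 - a z.1 z.2)
   * (if z == (u, q) then H (b || (q == ord_max)) else 1).
transitivity (\sum_(phi : strategy) \prod_z F z (phi z)).
  apply: eq_bigr => phi _; rewrite big_split /=; congr (_ * _).
  rewrite (bigD1 (u, q))//= eqxx big1 ?mulr1// => z /negPf zuq.
  by rewrite zuq.
rewrite -bigA_distr_bigA (bigD1 (u, q))//= [X in _ * X]big1 ?mulr1 => [|z /negPf zuq]; last first.
  by rewrite big_bool /F zuq /=; ring.
rewrite big_bool /F eqxx /=; have [qm|qm] := eqVneq q ord_max; last by [].
by rewrite (a_top u qm) subrr !mul0r.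
Qed.

Definition strategies_prob (phis : seq strategy) : R := \prod_(phi <- phis) strategy_prob phi.

Lemma strategies_prob_ge0 phis : 0 <= strategies_prob phis.
Proof. by apply: prodr_ge0 => phi _; apply: strategy_prob_ge0. Qed.

Lemma strategies_prob_sum n : \sum_(phis : n.-tuple strategy) strategies_prob phis = 1.
Proof.
elim: n => [|n IH]; first by rewrite sum_tuple0 /strategies_prob big_nil.
rewrite sum_tuple_cons -[RHS](_ : \sum_phi strategy_prob phi * 1 = 1); last first.
  by rewrite (sum_strategy ord0 ord0 (fun=> 1)); ring.
apply: eq_bigr => phi _; rewrite -IH mulr_sumr; apply: eq_bigr => phis _.
by rewrite /strategies_prob big_cons.
Qed.

Fixpoint code_law (u q : idx) (phis : seq strategy) (ys : seq bool) : R :=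
  match phis, ys with
  | phi :: phis', x :: ys' => let b := attempt phi u q in
      chan u b x * code_law (next_u u b) (gL q x) phis' ys'
  | _, _ => 1
  end.

Fixpoint drift (u q : idx) (phis : seq strategy) (ys : seq bool) : R :=
  match phis, ys with
  | phi :: phis', x :: ys' => let b := attempt phi u q in
      increment u q b x + drift (next_u u b) (gL q x) phis' ys'
  | _, _ => 0
  end.

Lemma code_law_ge0 u q phis ys : 0 <= code_law u q phis ys.
Proof.
by elim: phis u q ys => [|phi phis IH] u q [|x ys] //=; rewrite mulr_ge0 ?chan_ge0.
Qed.

Lemma chan_sum u b : \sum_x chan u b x = 1.
Proof. by rewrite big_bool /chan; case: b => /=; ring. Qed.

Lemma code_law_sum n u q (phis : n.-tuple strategy) :
  \sum_(ys : n.-tuple bool) code_law u q phis ys = 1.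
Proof.
elim: n u q phis => [|n IH] u q phis; first by rewrite sum_tuple0 (tuple0 phis).
rewrite (tuple_eta phis) (sum_tuple_cons n (code_law u q _)) /=.
rewrite -[RHS](chan_sum u (attempt (thead phis) u q)); apply: eq_bigr => x _.
by rewrite -mulr_sumr (IH _ _ [tuple of behead phis]) mulr1.
Qed.

Lemma sum_strategies n (G : strategy -> seq strategy -> R) :
  \sum_(phis : n.+1.-tuple strategy)
     strategies_prob phis * (if (phis : seq _) is phi :: phis' then G phi phis' else 0)
  = \sum_phi strategy_prob phi * \sum_(phis : n.-tuple strategy) strategies_prob phis * G phi phis.
Proof.
rewrite (sum_tuple_cons n (fun phis => strategies_prob phis *
   (if phis is phi :: phis' then G phi phis' else 0))) /=.
apply: eq_bigr => phi _; rewrite mulr_sumr; apply: eq_bigr => phis _.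
by rewrite /strategies_prob big_cons mulrA.
Qed.

(** Strategies are drawn afresh in each slot, so averaging the codewords gives back the policy. The
    mixture in the coding lemma is thereby the level law. *)
Lemma code_law_average n u q (ys : seq bool) : size ys = n ->
  \sum_(phis : n.-tuple strategy) strategies_prob phis * code_law u q phis ys
  = policy_law u q ys.
Proof.
elim: n u q ys => [|n IH] u q [|x ys] //=.
  move=> _; rewrite (sum_tuple0 (fun phis => strategies_prob phis * code_law u q phis [::])).
  by rewrite /strategies_prob big_nil mul1r.
move=> [szys].
pose G phi phis := chan u (attempt phi u q) x *
  code_law (next_u u (attempt phi u q)) (gL q x) phis ys.
transitivity (\sum_(phis : n.+1.-tuple strategy)
     strategies_prob phis * (if (phis : seq _) is phi :: phis' then G phi phis' else 0)).
  by apply: eq_bigr => phis _; rewrite {2 4}(tuple_eta phis).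
rewrite sum_strategies /G.
pose H b := chan u b x * policy_law (next_u u b) (gL q x) ys.
transitivity (\sum_phi strategy_prob phi * H (attempt phi u q)).
  apply: eq_bigr => phi _; congr (_ * _); rewrite /H -IH// mulr_sumr.
  by apply: eq_bigr => phis _; rewrite mulrCA.
by rewrite sum_strategy /H slotE !big_bool /=; case: (x) => /=; ring.
Qed.

Lemma moment_average n u q (z : R) :
  \sum_(phis : n.-tuple strategy) strategies_prob phis *
     \sum_(ys : n.-tuple bool) code_law u q phis ys * (z + drift u q phis ys) ^+ 2
  = moment n u q z.
Proof.
elim: n u q z => [|n IH] u q z.
  rewrite (sum_tuple0 (fun phis => strategies_prob phis *
    \sum_(ys : 0.-tuple bool) code_law u q phis ys * (z + drift u q phis ys) ^+ 2)).
  rewrite (sum_tuple0 (fun ys => code_law u q [::] ys * (z + drift u q [::] ys) ^+ 2)) /=.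
  by rewrite /strategies_prob big_nil !mul1r addr0.
pose G phi phis := \sum_x chan u (attempt phi u q) x *
  \sum_(ys : n.-tuple bool) code_law (next_u u (attempt phi u q)) (gL q x) phis ys *
    (z + increment u q (attempt phi u q) x + drift (next_u u (attempt phi u q)) (gL q x) phis ys) ^+ 2.
transitivity (\sum_(phis : n.+1.-tuple strategy)
     strategies_prob phis * (if (phis : seq _) is phi :: phis' then G phi phis' else 0)).
  apply: eq_bigr => phis _; congr (_ * _); rewrite (tuple_eta phis) /=.
  rewrite (sum_tuple_cons n (fun ys => code_law u q (thead phis :: behead phis) ys *
     (z + drift u q (thead phis :: behead phis) ys) ^+ 2)) /=.
  apply: eq_bigr => x _; rewrite mulr_sumr; apply: eq_bigr => ys _.
  by rewrite mulrA addrA.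
rewrite sum_strategies.
pose H b := \sum_x chan u b x * moment n (next_u u b) (gL q x) (z + increment u q b x).
transitivity (\sum_phi strategy_prob phi * H (attempt phi u q)).
  apply: eq_bigr => phi _; congr (_ * _); rewrite /H /G.
  under eq_bigr do rewrite mulr_sumr; rewrite exchange_big; apply: eq_bigr => x _ /=.
  rewrite -IH mulr_sumr; apply: eq_bigr => phis _.
  by rewrite mulrCA.
by rewrite sum_strategy; apply/esym/slotE.
Qed.

Let potential_bound : R := \sum_q \sum_u `|potential u q|.

Lemma potential_le u q : potential u q <= potential_bound.
Proof.
apply: le_trans (ler_norm _) _; rewrite /potential_bound (bigD1 q)//= (bigD1 u)//=.
by rewrite -addrA lerDl addr_ge0// !sumr_ge0// => ? _; rewrite ?sumr_ge0.
Qed.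

(** The potentials telescope along the outputs, and the final one is absorbed by
    [potential_bound]. *)
Lemma drift_le n u q phis ys : size phis = n -> size ys = n ->
  0 < code_law u q phis ys -> 0 < level_law q ys ->
  drift u q phis ys + potential u q
  <= ln (code_law u q phis ys) - ln (level_law q ys) - n%:R * rate + potential_bound.
Proof.
elim: n u q phis ys => [|n IH] u q [|phi phis] [|x ys] //=.
  by rewrite ln1 mul0r !subr0 !add0r potential_le.
move=> [szp] [szy]; set b := attempt phi u q; set u' := next_u u b; set q' := gL q x.
have c0 : 0 <= chan u b x := chan_ge0 _ _ _.
have cl0 : 0 <= code_law u' q' phis ys := code_law_ge0 _ _ _ _.
have [->|ch] := eqVneq (chan u b x) 0; first by rewrite mul0r ltxx.
have {c0}ch : 0 < chan u b x by rewrite lt_neqAle eq_sym ch.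
rewrite pmulr_rgt0// => cl.
have [->|w0] := eqVneq (out_kernel x q) 0; first by rewrite mul0r ltxx.
have {w0}w : 0 < out_kernel x q.
  rewrite lt_neqAle eq_sym w0 divr_ge0//; case: (x) => //.
  by rewrite subr_ge0.
rewrite pmulr_rgt0// => ll; have := IH u' q' phis ys szp szy cl ll.
have -> : ln (chan u b x * code_law u' q' phis ys) = ln (chan u b x) + ln (code_law u' q' phis ys).
  by rewrite lnM.
have -> : ln (out_kernel x q * level_law q' ys) = ln (out_kernel x q) + ln (level_law q' ys).
  by rewrite lnM.
by rewrite -[n.+1%:R]natr1 mulrDl mul1r /increment /score -/u' -/q'; lra.
Qed.

(** Chebyshev's inequality: an output that is not likely forces the drift below [- gap]. *)
Lemma unlikely_code_le n (K : R) : 0 < n%:R * rate - ln K - potential_bound -> 0 < K ->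
  \sum_(phis : n.-tuple strategy) strategies_prob phis *
    \sum_(ys : n.-tuple bool | ~~ (K * level_law ord0 ys < code_law ord0 ord0 phis ys))
      code_law ord0 ord0 phis ys
  <= n%:R * square_bound / (n%:R * rate - ln K - potential_bound) ^+ 2.
Proof.
set gap := _ - potential_bound => gap0 K0.
rewrite ler_pdivlMr ?exprn_gt0// mulr_suml.
have := moment_le n ord0 ord0 0; rewrite expr0n add0r; apply: le_trans.
rewrite -moment_average; apply: ler_sum => phis _.
have [->|wp] := eqVneq (strategies_prob phis) 0; first by rewrite !mul0r.
have {}wp : 0 < strategies_prob phis by rewrite lt_neqAle eq_sym wp strategies_prob_ge0.
rewrite -mulrA; apply: ler_wpM2l; first exact: ltW.
rewrite mulr_suml [leRHS](bigID (fun ys : n.-tuple bool =>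
  ~~ (K * level_law ord0 ys < code_law ord0 ord0 phis ys)))/= -[leLHS]addr0 lerD//; last first.
  by apply: sumr_ge0 => ys _; rewrite mulr_ge0 ?code_law_ge0 ?sqr_ge0.
apply: ler_sum => ys; rewrite -leNgt => bad; rewrite add0r.
have [->|cl] := eqVneq (code_law ord0 ord0 phis ys) 0; first by rewrite !mul0r.
have {}cl : 0 < code_law ord0 ord0 phis ys by rewrite lt_neqAle eq_sym cl code_law_ge0.
have ll : 0 < level_law ord0 ys.
  rewrite -policy_law_start -(@code_law_average n) ?size_tuple// (bigD1 phis)//= ltr_wpDr//.
    by apply: sumr_ge0 => p _; rewrite mulr_ge0 ?strategies_prob_ge0 ?code_law_ge0.
  by rewrite mulr_gt0.
rewrite ler_wpM2l ?(ltW cl)//.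
have := drift_le (size_tuple phis) (size_tuple ys) cl ll; rewrite potential_start addr0 => dle.
have lnle : ln (code_law ord0 ord0 phis ys) <= ln K + ln (level_law ord0 ys).
  by rewrite -lnM ?posrE// ler_ln ?posrE// mulr_gt0.
have dgap : drift ord0 ord0 phis ys <= - gap by rewrite /gap; lra.
by rewrite -[leRHS]sqrrN ler_sqr ?nnegrE; lra.
Qed.

(** * Random codes on the actual channel *)

Fixpoint battery_law (s : bool) (u q : idx) (phis : seq strategy) (ys : seq bool) : R :=
  match phis, ys with
  | phi :: phis', x :: ys' => let b := attempt phi u q in
      if s && b == x then
        \sum_(e : bool) recharge eta e *
          battery_law (next_battery x s e) (next_u u b) (gL q x) phis' ys'
      else 0
  | _, _ => 1
  end.

(* [beta u] is the probability of an empty battery in the state [(u, q)]; it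
   loses this meaning when [q < u]. *)
Lemma code_law_battery (u q : idx) phis ys : (u <= q)%N -> size phis = size ys ->
  beta u * battery_law false u q phis ys + (1 - beta u) * battery_law true u q phis ys
  = code_law u q phis ys.
Proof.
elim: phis u q ys => [|phi phis IH] u q [|x ys] //= uq; first by rewrite !mulr1 subrKC.
move=> [sz]; have b0 : beta ord0 = etab eta by rewrite /beta /empty_prob expr1.
have IH0 x' : etab eta * battery_law false ord0 (gL q x') phis ys
    + eta * battery_law true ord0 (gL q x') phis ys = code_law ord0 (gL q x') phis ys.
  have := IH ord0 (gL q x') ys (leq0n _) sz.
  by rewrite b0 => <-; rewrite /etab subKr.
rewrite /chan /next_u; have [at_|nat_] := boolP (attempt phi u q).
  rewrite /= !big_bool /next_battery /recharge; case: x => /=.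
    by rewrite -IH0; ring.
  by rewrite -IH0; ring.
rewrite /= !big_bool /next_battery /recharge; case: x => /=; first by ring.
have qm : q != ord_max by move: nat_; rewrite /attempt negb_or => /andP[].
have qN := lt_ord_max qm; have uN : (u < N)%N by apply: leq_ltn_trans qN.
have uS : nxt u = u.+1 :> nat by rewrite inordK.
have := IH (nxt u) (gL q false) ys.
rewrite uS val_gL qN => /(_ uq sz) <-; rewrite mul1r.
have -> : beta (nxt u) = etab eta * beta u by rewrite /beta /empty_prob uS exprS.
rewrite /etab; ring.
Qed.

Fixpoint attempt_after (u q : idx) (phis : seq strategy) (ys : seq bool) : bool :=
  match phis, ys with
  | phi :: _, [::] => attempt phi u q
  | phi :: phis', x :: ys' => attempt_after (next_u u (attempt phi u q)) (gL q x) phis' ys'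
  | [::], _ => false
  end.

Lemma expect_battery_law act s hs hy u q phis ys :
  (forall hs' ys', act hs' (hy ++ ys') = last false hs' && attempt_after u q phis ys') ->
  last false hs = s -> size phis = size ys ->
  expect eta act (fun _ _ _ => 1) ys s hs hy = battery_law s u q phis ys.
Proof.
elim: phis s hs hy u q ys => [|phi phis IH] s hs hy u q [|x ys] //= actE hs_s [sz].
have -> : act hs hy = s && attempt phi u q by have := actE hs [::]; rewrite cats0 hs_s.
case: ifP => // _; apply: eq_bigr => e _; congr (_ * _); apply: IH => //.
  by move=> hs' ys'; rewrite cat_rcons actE.
by rewrite last_rcons.
Qed.

(** Silence in the first slot gives the battery the law of the state [(0, 0)]. The attempts are
    replayed from past outputs; the observed battery only suppresses a pulse that it cannot feed. *)
Definition strategy_encoder M n (c : 'I_M -> n.-tuple strategy) : encoder M :=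
  fun _ m hs hy =>
    last false hs && (if hy is _ :: ys then attempt_after ord0 ord0 (c m) ys else false).

Lemma strategy_encoder_valid M n (c : 'I_M -> n.-tuple strategy) :
  valid_encoder (strategy_encoder c).
Proof. by move=> i m hs hy _ _ /andP[]. Qed.

Lemma strategy_encoder_law M n (c : 'I_M -> n.-tuple strategy) m x (ys : n.-tuple bool) :
  expect eta (fun hs hy => strategy_encoder c (size hy) m hs hy) (fun _ _ _ => 1)
    (x :: ys) false [::] [::] = (~~ x)%:R * code_law ord0 ord0 (c m) ys.
Proof.
rewrite /= {1}/strategy_encoder /=; case: x; first by rewrite mul0r.
have sz : size (c m) = size ys by rewrite !size_tuple.
rewrite eqxx mul1r big_bool /next_battery /=.
rewrite !(@expect_battery_law _ _ _ _ ord0 ord0 (c m))//.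
rewrite -code_law_battery// /beta /empty_prob expr1 /recharge /etab; ring.
Qed.

Lemma strategy_encoder_error M n (c : 'I_M -> n.-tuple strategy) (dec : seq bool -> 'I_M) :
  err_prob eta n.+1 (strategy_encoder c) (fun y => dec (behead y))
  = M%:R^-1 * \sum_(m < M) \sum_(ys : n.-tuple bool | dec ys != m) code_law ord0 ord0 (c m) ys.
Proof.
congr (_ * _); apply: eq_bigr => m _.
rewrite (run_law eta n.+1 (strategy_encoder c) m (fun y => dec (behead y) != m)).
rewrite (sum_tuple_cons n (fun y => if dec (behead ([::] ++ y)) != m then
   expect eta (fun hs hy => strategy_encoder c (size hy) m hs hy) (fun _ _ _ => 1)
     y false [::] [::] else 0)).
rewrite big_bool big1 => [|ys _]; last by rewrite strategy_encoder_law mul0r if_same.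
rewrite [LHS]add0r [RHS]big_mkcond; apply: eq_bigr => ys _.
by rewrite strategy_encoder_law mul1r.
Qed.

Lemma code_exists n k (K eps : R) : 0 < K -> 0 < n%:R * rate - ln K - potential_bound ->
  k.+1%:R / K + n%:R * square_bound / (n%:R * rate - ln K - potential_bound) ^+ 2 <= eps ->
  exists (enc : encoder k.+1) (dec : seq bool -> 'I_k.+1),
    valid_encoder enc /\ err_prob eta n.+1 enc dec <= eps.
Proof.
move=> K0 gap0 small.
pose p (phis : n.-tuple strategy) (ys : n.-tuple bool) := code_law ord0 ord0 phis ys.
pose rho (phis : n.-tuple strategy) := strategies_prob phis.
have mixE ys : mixture rho p ys = level_law ord0 ys.
  by rewrite /mixture -policy_law_start -(@code_law_average n) ?size_tuple.
have unl : \sum_f rho f * \sum_(y | ~~ likely rho p K f y) p f y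
    <= n%:R * square_bound / (n%:R * rate - ln K - potential_bound) ^+ 2.
  apply: le_trans (unlikely_code_le gap0 K0); apply: ler_sum => phis _.
  rewrite ler_wpM2l ?strategies_prob_ge0// le_eqVlt; apply/orP; left; apply/eqP.
  by apply: eq_bigl => ys; rewrite /likely mixE.
have [c [d [dc _]]] := @feinstein R _ _ rho p K eps _ (fun f => strategies_prob_ge0 f)
  (strategies_prob_sum n) (fun f y => code_law_ge0 ord0 ord0 f y)
  (fun f => code_law_sum ord0 ord0 f) K0 unl k.+1 small.
pose dec (y : seq bool) : 'I_k.+1 := if insub y is Some t then inord (d t) else ord0.
exists (strategy_encoder (fun m : 'I_k.+1 => c m)), (fun y => dec (behead y)); split.
  exact: strategy_encoder_valid.
rewrite strategy_encoder_error.
rewrite ler_pdivrMl ?ltr0n//; apply: le_trans (_ : \sum_(m < k.+1) eps <= _); last first.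
  by rewrite sumr_const card_ord mulr_natl.
apply: ler_sum => m _.
have decE (ys : n.-tuple bool) : dec ys = inord (d ys).
  by rewrite /dec; case: insubP => [t _ /val_inj -> //|]; rewrite size_tuple eqxx.
have total := code_law_sum ord0 ord0 (c m).
rewrite (bigID (fun ys : n.-tuple bool => dec ys == m))/= in total.
have : 1 - eps <= \sum_(ys : n.-tuple bool | dec ys == m) code_law ord0 ord0 (c m) ys.
  apply: le_trans (dc m (ltn_ord m)) _.
  rewrite [leRHS](bigID (fun ys => d ys == m))/= -[leLHS]addr0 lerD//; last first.
    by apply: sumr_ge0 => ys _; apply: code_law_ge0.
  rewrite le_eqVlt; apply/orP; left; apply/eqP; apply: eq_bigl => ys.
  by rewrite decE; case: eqP => [->|_]; rewrite ?andbF// inord_val eqxx.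
lra.
Qed.

Lemma below_objective_achievable r : 0 <= r -> r < objective P mu -> achievable eta r.
Proof.
move=> r0 rv eps eps0; have ln2 : 0 < ln 2 :> R by rewrite ln_gt0// ltr1n.
pose d := (rate - r * ln 2) / 2.
have d0 : 0 < d by rewrite divr_gt0// subr_gt0 /rate ltr_pM2r.
(* The total error is at most [c / n%:R]: the first term bounds code size over threshold through
   [expR (n%:R * d) >= n%:R * d], the second is Chebyshev's. *)
pose c := 2 * expR (r * ln 2 + potential_bound) / d + square_bound / d ^+ 2.
have sq0 : 0 <= square_bound.
  by do 4 (apply: sumr_ge0 => ? _); rewrite sqr_ge0.
have c0 : 0 <= c.
  by apply: addr_ge0; apply: divr_ge0 => //; rewrite ?sqr_ge0 ?(ltW d0)//.
exists (Num.bound (c / eps)).+2 => n1; case: n1 => // n; rewrite ltnS => nb.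
have n0 : 0 < n%:R :> R by rewrite ltr0n; apply: leq_trans nb.
have cn : c / n%:R <= eps.
  rewrite ler_pdivrMr// mulrC -ler_pdivrMr//.
  apply: le_trans (ltW (archi_boundP (divr_ge0 c0 (ltW eps0)))) _.
  by rewrite ler_nat ltnW.
(* This threshold makes the Chebyshev gap exactly [n%:R * d], and [X / K] still decays like
   [expR (- (n%:R * d))]. *)
pose K := expR (n%:R * (rate - d) - potential_bound).
have lnK : ln K = n%:R * (rate - d) - potential_bound by rewrite expRK.
have gapE : n%:R * rate - ln K - potential_bound = n%:R * d by rewrite lnK; ring.
pose X := (2 : R) `^ (n.+1%:R * r).
have XE : X = expR (n.+1%:R * r * ln 2) by rewrite /X /powR pnatr_eq0.
have X1 : 1 <= X.
  rewrite XE; apply: le_trans (expR_ge1Dx _).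
  by rewrite lerDl mulr_ge0 ?(ltW ln2)// mulr_ge0.
have X0 : 0 < X := lt_le_trans ltr01 X1.
pose k := Num.truncn X.
have kX : X <= k.+1%:R by exact/ltW/truncnS_gt.
have k2X : k.+1%:R <= 2 * X.
  by have /andP[h _] := truncn_itv (ltW X0); rewrite -natr1; lra.
have [enc [dec [ve err]]] : exists (enc : encoder k.+1) (dec : seq bool -> 'I_k.+1),
    valid_encoder enc /\ err_prob eta n.+1 enc dec <= eps; last first.
  by exists k.+1, enc, dec.
apply: (@code_exists n k K); rewrite ?expR_gt0// gapE ?(mulr_gt0 n0 d0)//.
apply: le_trans cn; rewrite /c mulrDl lerD//; last first.
  by rewrite le_eqVlt; apply/orP; left; apply/eqP; field; rewrite !gt_eqF.
have nd : 0 < n%:R * d by rewrite mulr_gt0.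
apply: le_trans (_ : 2 * X / K <= _).
  by rewrite ler_wpM2r// invr_ge0 expR_ge0.
have -> : 2 * X / K = 2 * expR (r * ln 2 + potential_bound) / expR (n%:R * d).
  by rewrite XE -!mulrA -!expRB; congr (_ * expR _); rewrite -[n.+1%:R]natr1 /d; field.
set E := expR (r * _ + _); have -> : 2 * E / d / n%:R = 2 * E / (n%:R * d).
  by field; rewrite !gt_eqF.
apply: ler_wpM2l; first by rewrite mulr_ge0 ?expR_ge0.
rewrite lef_pV2 ?posrE ?expR_gt0//.
by have := expR_ge1Dx (n%:R * d); lra.
Qed.

End LowerFlow.

(** * The squeeze *)

Lemma a_N_le_C_BEHC (R : realType) (eta : R) N : 0 <= eta <= 1 -> (0 < N)%N ->
  a_N eta N <= C_BEHC eta.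
Proof.
move=> eta01 N0; have C0 : 0 <= C_BEHC eta by apply: sup_ge0 => r [].
rewrite {1}/a_N; set S := [set _ | _].
have [S0|/set0P/negP] := pselect (S !=set0); last first.
  by rewrite negbK => /eqP ->; rewrite sup0.
apply: ge_sup => // _ [P [mu [ad ->]]]; rewrite leNgt; apply/negP => Cv.
have r0 : 0 <= (C_BEHC eta + objective P mu) / 2 by lra.
have rv : (C_BEHC eta + objective P mu) / 2 < objective P mu by lra.
have ach := below_objective_achievable eta01 ad r0 rv.
by have := achievable_le_C_BEHC eta01 N0 r0 ach; lra.
Qed.

Lemma cvg_inv_sqrt (R : realType) (c : R) : 0 <= c ->
  c / Num.sqrt n%:R @[n --> \oo] --> 0.
Proof.
move=> c0; apply/cvgrPdist_le => e e0.
exists (Num.bound ((c / e) ^+ 2)).+1 => // n /= nb.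
have n0 : 0 < n%:R :> R by rewrite ltr0n; apply: leq_trans nb.
rewrite sub0r normrN ger0_norm ?divr_ge0 ?sqrtr_ge0//.
rewrite ler_pdivrMr ?sqrtr_gt0// mulrC -ler_pdivrMr//.
have ce : 0 <= c / e by rewrite divr_ge0// ltW.
rewrite -[leLHS]ger0_norm// -sqrtr_sqr ler_wsqrtr//.
apply: le_trans (ltW (archi_boundP (sqr_ge0 _))) _.
by rewrite ler_nat ltnW.
Qed.

Unset Implicit Arguments.

Theorem theorem6 (R : realType) (eta : R) :
  0 <= eta <= 1 ->
  a_N eta @ \oo --> C_BEHC eta /\ b_N eta @ \oo --> C_BEHC eta.
Proof.
move=> eta01; pose gap (n : nat) : R := 3 / ln 2 / Num.sqrt n%:R.
have gap0 : gap n @[n --> \oo] --> 0.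
  by apply: cvg_inv_sqrt; rewrite divr_ge0// ln_ge0// ler1n.
have bounds n : (0 < n)%N -> [/\ a_N eta n <= C_BEHC eta, C_BEHC eta <= b_N eta n &
    b_N eta n <= a_N eta n + gap n].
  by move=> n0; split; [exact: a_N_le_C_BEHC|exact: C_BEHC_le|exact: b_N_le].
split.
  apply: (@squeeze_cvgr _ _ _ _ (fun n => C_BEHC eta - gap n) (fun=> C_BEHC eta)).
  - exists 1%N => // n /= n0; have [h1 h2 h3] := bounds n n0.
    by rewrite h1 andbT; lra.
  - by rewrite -[X in _ --> X]subr0; apply: cvgB => //; apply: cvg_cst.
  - exact: cvg_cst.
apply: (@squeeze_cvgr _ _ _ _ (fun=> C_BEHC eta) (fun n => C_BEHC eta + gap n)).
- exists 1%N => // n /= n0; have [h1 h2 h3] := bounds n n0.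
  by rewrite h2 /=; lra.
- exact: cvg_cst.
- by rewrite -[X in _ --> X]addr0; apply: cvgD => //; apply: cvg_cst.
Qed.
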